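(* Let $e\ge 2$ be an integer. For all $i,j\in\mathbb{Z}/e\mathbb{Z}$, under the Poissonised Plancherel measure $\mathrm{pl}_t$, as $t\to+\infty$ we have $$\mathbb{E}_t\, x_i(\lambda)=O(1),$$ $$\mathrm{Cov}_t\bigl(x_i(\lambda),x_j(\lambda)\bigr)\sim\frac{2\sqrt t}{\pi e^2}\left[\cot\Bigl(\bigl(j-i+\tfrac12\bigr)\tfrac{\pi}{e}\Bigr)-\cot\Bigl(\bigl(j-i-\tfrac12\bigr)\tfrac{\pi}{e}\Bigr)\right].$$ In particular, $\mathrm{Var}_t\, x_i(\lambda)\sim\frac{4\sqrt t}{\pi e^2}\cot\frac{\pi}{2e}$.
   Context: A partition is a finite non-increasing sequence $\lambda=(\lambda_1\ge\dots\ge\lambda_h>0)$ of positive integers (possibly empty), with size $|\lambda|=\sum_a\lambda_a$; $\mathcal{P}$ is the set of all partitions. Its Young diagram is $\mathcal{Y}(\lambda)=\{(a,b)\in\mathbb{Z}_{\ge1}^2: 1\le a\le h,\ 1\le b\le\lambda_a\}$, and $\mathrm{Std}(\lambda)$ is the set of standard Young tableaux of shape $\lambda$ (bijections $\mathcal{Y}(\lambda)\to\{1,\dots,|\lambda|\}$ increasing along rows and down columns). For $t>0$, the Poissonised Plancherel measure is the probability measure on $\mathcal{P}$ given by $\mathrm{pl}_t(\lambda)=\exp(-t)\,t^{|\lambda|}\left(\frac{\#\mathrm{Std}(\lambda)}{|\lambda|!}\right)^2$. $\mathbb{E}_t,\mathrm{Var}_t,\mathrm{Cov}_t$ denote expectation,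 variance and covariance when $\lambda$ is distributed according to $\mathrm{pl}_t$. For $i\in\mathbb{Z}/e\mathbb{Z}$ (identified with $\{0,\dots,e-1\}$), $c_i(\lambda)$ is the number of nodes $(a,b)\in\mathcal{Y}(\lambda)$ with $b-a\equiv i\pmod e$, and $x_i(\lambda)=c_i(\lambda)-c_{i+1}(\lambda)$ (indices mod $e$). The symbol $\sim$ means that the ratio of the two sides tends to $1$. *)

(* Defs.v *)
From HB Require Import structures.
From mathcomp Require Import all_boot all_order all_algebra.
From mathcomp Require Import all_classical all_reals all_analysis.
From mathcomp Require Import zify ring.

Set Implicit Arguments.
Unset Strict Implicit.
Unset Printing Implicit Defensive.

Definition is_intpart (s : seq nat) := sorted geq s && (0 \notin s).

Record intpart := IntPart {
  parts :> seq nat;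
  _ : is_intpart parts }.

HB.instance Definition _ := [isSub for parts].
HB.instance Definition _ := [Countable of intpart by <:].

Definition psize (la : intpart) := sumn la.

Definition empty_intpart := @IntPart [::] isT.

(* Rows and columns are numbered from 0, which leaves contents b - a unchanged;
   row a has exactly la_a nodes. *)
Definition node (la : intpart) := {a : 'I_(size la) & 'I_(nth 0 la a)}.
Definition node_row la (u : node la) : nat := tag u.
Definition node_col la (u : node la) : nat := tagged u.

(* The entries 1, ..., |la| are represented by 'I_|la|, i.e. shifted by one. *)
Definition Std la : {set {ffun node la -> 'I_(psize la)}} :=
  [set T : {ffun node la -> 'I_(psize la)} | [&& injectiveb T, [forall k, k \in codom T],
    [forall u, forall v, (node_row u == node_row v) && (node_col u < node_col v) ==> (T u < T v)] &
    [forall u, forall v, (node_col u == node_col v) && (node_row u < node_row v) ==> (T u < T v)]]].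

HB.instance Definition _ := isPointed.Build intpart empty_intpart.
HB.instance Definition _ := @isMeasurable.Build default_measure_display
  intpart discrete_measurable discrete_measurable0
  discrete_measurableC discrete_measurableU.

Local Notation "la @@ k" := (nth 0 la k) (at level 8).

Lemma part_noninc (la : intpart) k : la@@k.+1 <= la@@k.
Proof.
case: la => s /= /andP[/sortedP-/(_ 0) sS _].
case: (ltnP k.+1 (size s)) => [/sS//|h].
by rewrite nth_default.
Qed.

Lemma part_gt0 (la : intpart) k : (0 < la@@k) = (k < size la).
Proof.
case: (ltnP k (size la)) => h; last by rewrite nth_default.
case: la h => s /= /andP[_ s0] h.
by rewrite lt0n; apply: contraNneq s0 => <-; rewrite mem_nth.
Qed.

Lemma part_ext (la mu : intpart) : (forall k, la@@k = mu@@k) -> la = mu.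
Proof.
move=> E; apply: val_inj => /=; apply: (@eq_from_nth _ 0) => [|i _]; last exact: E.
apply/eqP; rewrite eqn_leq; apply/andP; split; rewrite leqNgt; apply/negP => h.
  by move: (part_gt0 mu (size mu)); rewrite ltnn -E part_gt0 h.
by move: (part_gt0 la (size la)); rewrite ltnn E part_gt0 h.
Qed.

Lemma part_exists (r : nat -> nat) N : (forall k, r k.+1 <= r k) -> r N = 0 ->
  exists la : intpart, forall k, la@@k = r k.
Proof.
move=> rS rN.
have rle i j : i <= j -> r j <= r i.
  by move=> /subnK <-; elim: (j - i) => //= k; apply: leq_trans; rewrite addSn.
have ex : exists n, r n == 0 by exists N; apply/eqP.
case: (ex_minnP ex) => M /eqP rM minM.
have P : is_intpart (mkseq r M).
  apply/andP; split.
    apply/(sortedP 0) => i; rewrite size_mkseq => iM.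
    by rewrite !nth_mkseq ?(ltnW iM)//; exact: rS.
  apply/negP => /mapP[i]; rewrite mem_iota /= => iM /esym/eqP/minM; lia.
exists (IntPart P) => k /=.
case: (ltnP k M) => h; first by rewrite nth_mkseq.
rewrite nth_default ?size_mkseq//; apply/esym/eqP.
by rewrite -leqn0 -rM rle.
Qed.

Lemma psizeE (la : intpart) N : size la <= N -> psize la = \sum_(k < N) la@@k.
Proof.
move=> h; rewrite /psize sumnE (big_nth 0) big_mkord.
rewrite -(subnKC h) big_split_ord /= [X in _ = _ + X]big1 ?addn0// => i _.
by rewrite nth_default// leq_addr.
Qed.

Lemma part_le_psize (la : intpart) k : la@@k <= psize la.
Proof.
case: (ltnP k (size la)) => h; last by rewrite nth_default.
by rewrite (psizeE (leqnn _)) (bigD1 (Ordinal h)) //= leq_addr.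
Qed.

Lemma size_le_psize (la : intpart) : size la <= psize la.
Proof.
rewrite (psizeE (leqnn _)) -[X in X <= _](card_ord (size la)) -sum1_card.
by apply: leq_sum => i _; rewrite part_gt0.
Qed.

Definition addable (r : nat -> nat) k := (k == 0) || (r k < r k.-1).
Definition removable (r : nat -> nat) k := r k.+1 < r k.

Definition add_node (la : intpart) b : intpart :=
  xget la (fun mu : intpart => forall k, mu@@k = la@@k + (k == b)).
Definition rem_node (la : intpart) b : intpart :=
  xget la (fun mu : intpart => forall k, mu@@k = la@@k - (k == b)).

Lemma nth_add (la : intpart) b : addable (nth 0 la) b ->
  forall k, (add_node la b)@@k = la@@k + (k == b).
Proof.
move=> ab; rewrite /add_node; case: xgetP => // H.
have [||mu muE] := @part_exists (fun k => la@@k + (k == b)) (size la + b.+1).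
- move=> k; have := part_noninc la k; move: ab; rewrite /addable; case: b H => [|b] H /=.
    by rewrite addn0; lia.
  rewrite eqSS; case: eqP => [->|]; lia.
- by rewrite nth_default ?leq_addr//; lia.
- by case: (H mu).
Qed.

Lemma nth_rem (la : intpart) b : removable (nth 0 la) b ->
  forall k, (rem_node la b)@@k = la@@k - (k == b).
Proof.
move=> ab; rewrite /rem_node; case: xgetP => // H.
have [||mu muE] := @part_exists (fun k => la@@k - (k == b)) (size la).
- move=> k; have := part_noninc la k; move: ab; rewrite /removable.
  case: (k =P b) => [->|]; lia.
- by rewrite nth_default.
- by case: (H mu).
Qed.

Lemma psize_add (la : intpart) b : addable (nth 0 la) b ->
  psize (add_node la b) = (psize la).+1.
Proof.
move=> ab; set N := size la + size (add_node la b) + b.+1.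
have bN : b < N by rewrite /N; lia.
rewrite (@psizeE _ N) ?(@psizeE la N) /N; [|lia..].
under eq_bigr do rewrite nth_add//.
rewrite big_split /= [X in _ + X](_ : _ = 1) ?addn1//.
rewrite (bigD1 (Ordinal bN)) //= eqxx big1 // => i.
by rewrite -val_eqE /= => /negPf ->.
Qed.

Lemma rem_addable (la : intpart) b : removable (nth 0 la) b ->
  addable (nth 0 (rem_node la b)) b.
Proof.
move=> rb; rewrite /addable !nth_rem// eqxx.
case: b rb => //= b; rewrite /removable => rb.
have := part_noninc la b; lia.
Qed.

Lemma add_removable (la : intpart) b : addable (nth 0 la) b ->
  removable (nth 0 (add_node la b)) b.
Proof.
by move=> rb; rewrite /removable !nth_add// eqxx; have := part_noninc la b; lia.
Qed.

Lemma addK (la : intpart) b : addable (nth 0 la) b ->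
  rem_node (add_node la b) b = la.
Proof.
move=> ab; apply: part_ext => k.
by rewrite nth_rem ?add_removable// nth_add// addnK.
Qed.

Lemma remK (la : intpart) b : removable (nth 0 la) b ->
  add_node (rem_node la b) b = la.
Proof.
move=> ab; apply: part_ext => k.
rewrite nth_add ?rem_addable// nth_rem//.
move: ab; rewrite /removable; case: (k =P b) => [->|]; lia.
Qed.

Lemma psize_rem (la : intpart) b : removable (nth 0 la) b ->
  psize la = (psize (rem_node la b)).+1.
Proof. by move=> ab; rewrite -(psize_add (rem_addable ab)) remK. Qed.

Lemma add_rem_comm (la : intpart) a b : a != b ->
  (addable (nth 0 la) a && removable (nth 0 (add_node la a)) b) =
  (removable (nth 0 la) b && addable (nth 0 (rem_node la b)) a).
Proof.
move=> ab; have ba : (b == a) = false by rewrite eq_sym (negPf ab).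
have key : addable (nth 0 la) a -> removable (nth 0 la) b ->
    removable (nth 0 (add_node la a)) b = addable (nth 0 (rem_node la b)) a.
  move=> aa rb; move: (aa) (rb).
  rewrite /addable /removable !nth_rem// !nth_add// ba (negPf ab).
  case: a ab ba aa => [|a] ab ba aa h1 h2 /=; first by lia.
  by rewrite eqSS [b == a]eq_sym; move: h1 h2; case: (a =P b) => [->|] /=; lia.
apply/andP/andP => -[h1 h2].
  have rb : removable (nth 0 la) b.
    by move: h2; rewrite /removable !nth_add// ba; lia.
  by rewrite -key.
have aa : addable (nth 0 la) a.
  move: h2; rewrite /addable !nth_rem// (negPf ab).
  by case: a {key} ab ba => //= a _ _; lia.
by rewrite key.
Qed.

Lemma add_remC (la : intpart) a b : a != b ->
  addable (nth 0 la) a -> removable (nth 0 (add_node la a)) b ->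
  rem_node (add_node la a) b = add_node (rem_node la b) a.
Proof.
move=> ab h1 h2; have := add_rem_comm la ab; rewrite h1 h2 => /esym/andP[h3 h4].
apply: part_ext => k; rewrite nth_rem// nth_add// nth_add// nth_rem//.
case: (k =P b) => [->|]; rewrite ?[b == a]eq_sym ?(negPf ab) ?addn0; lia.
Qed.

(* Standard tableaux (with entries 1, ..., n) whose shape has row lengths r,
   extended by 0 to an N x N box: the ambient type does not depend on the
   shape, which makes removing the largest entry easy. *)
Definition box N := {ffun 'I_N * 'I_N -> 'I_N.+1}.

Definition box_std N (r : nat -> nat) n (T : box N) : Prop :=
  [/\ forall p : 'I_N * 'I_N, (0 < T p) = (p.2 < r p.1),
      forall p, T p <= n,
      forall k, 0 < k <= n -> exists p : 'I_N * 'I_N, T p = k :> nat,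
      forall p q : 'I_N * 'I_N, 0 < T p -> T p = T q :> nat -> p = q &
      forall p q : 'I_N * 'I_N, 0 < T q ->
        (p.1 = q.1 :> nat /\ p.2 < q.2) \/ (p.2 = q.2 :> nat /\ p.1 < q.1) -> T p < T q].

Definition nbox N r n := #|[set T : box N | `[< @box_std N r n T >]]|.

Lemma card_can_in (aT bT : finType) (A : {set aT}) (B : {set bT})
    (F : aT -> bT) (G : bT -> aT) :
  (forall x, x \in A -> F x \in B /\ G (F x) = x) ->
  (forall y, y \in B -> G y \in A /\ F (G y) = y) -> #|A| = #|B|.
Proof.
move=> AB BA; have <- : #|F @: A| = #|A|.
  apply: card_in_imset => x y xA yA E.
  by rewrite -(AB _ xA).2 E (AB _ yA).2.
apply: eq_card => y; apply/imsetP/idP => [[x /AB[xB _] ->//]|/BA[GA GK]].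
by exists (G y).
Qed.

Lemma card_Std la N : psize la <= N -> #|Std la| = nbox N (nth 0 la) (psize la).
Proof.
move=> laN.
have sN : size la <= N := leq_trans (size_le_psize la) laN.
have pN k : la@@k <= N := leq_trans (part_le_psize la k) laN.
pose pos (u : node la) : 'I_N * 'I_N :=
  (widen_ord sN (tag u), widen_ord (pN _) (tagged u)).
pose nd (p : 'I_N * 'I_N) : option (node la) :=
  [pick u | pos u == p].
have pos_inj : injective pos.
  move=> [[a ha] [b hb]] [[a' ha'] [b' hb']] [] /= aa; subst a'.
  rewrite (bool_irrelevance ha' ha) in hb' * => bb; subst b'.
  by rewrite (bool_irrelevance hb' hb).
have posK u : nd (pos u) = Some u.
  rewrite /nd; case: pickP => [v /eqP/pos_inj -> //|/(_ u)]; by rewrite eqxx.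
have ndK p u : nd p = Some u -> pos u = p.
  by rewrite /nd; case: pickP => // v /eqP <- [->].
have ndP (p : 'I_N * 'I_N) : p.2 < la@@(p.1) -> exists u, pos u = p.
  case: p => [a b] /= h.
  have ha : a < size la by rewrite -part_gt0; lia.
  exists (Tagged (fun a : 'I_(size la) => 'I_(la@@a)) (Ordinal h : 'I_(la@@(Ordinal ha)))).
  by congr pair; apply: val_inj.
have posP u : (pos u).2 < la@@((pos u).1) by case: u => a b /=.
pose F (T : {ffun node la -> 'I_(psize la)}) : box N :=
  [ffun p => if nd p is Some u then inord (T u).+1 else ord0].
pose G (T : box N) : {ffun node la -> 'I_(psize la)} :=
  [ffun u : node la => insubd (Ordinal (leq_trans (ltn_ord (tagged u)) (part_le_psize la (tag u)) )
    : 'I_(psize la)) (T (pos u)).-1].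
apply: (@card_can_in _ _ _ _ F G) => T; rewrite !inE.
  have FE u : F T (pos u) = (T u).+1 :> nat.
    by rewrite ffunE posK inordK// ltnS (leq_trans _ laN).
  move=> /and4P[/injectiveP Ti /forallP Ts /'forall_forallP Tr /'forall_forallP Tc].
  split; last first.
    by apply/ffunP => u; rewrite ffunE FE /=; apply: val_inj; rewrite val_insubd /= ltn_ord.
  have Fpos p : 0 < F T p -> exists u, p = pos u.
    by rewrite ffunE; case E : (nd p) => [u|//] _; exists u; rewrite (ndK _ _ E).
  split.
  - move=> p; apply/idP/idP => [/Fpos[u ->]//|/ndP[u <-]]; by rewrite FE.
  - by move=> p; case: (posnP (F T p)) => [->//|/Fpos[u ->]]; rewrite FE.
  - move=> [//|k] /andP[_ kn]; have /codomP[u E] := Ts (Ordinal kn).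
    by exists (pos u); rewrite FE -E.
  - move=> p q p0 pq; have q0 : 0 < F T q by rewrite -pq.
    move: p0 q0 pq => /Fpos[u ->] /Fpos[v ->]; rewrite !FE => -[] E.
    by rewrite (Ti _ _ (val_inj E)).
  - move=> p q /Fpos[v ->] H.
    case: (posnP (F T p)) => [->|]; first by rewrite FE.
    move=> /Fpos[u E]; rewrite E in H *; rewrite !FE ltnS.
    by case: H => -[/eqP h1 h2]; [apply: (implyP (Tr u v))|apply: (implyP (Tc u v))];
      rewrite [_ == _]h1.
move=> [Tp Tn Ts Ti Tm].
have GE u : (G T u).+1 = T (pos u).
  rewrite ffunE val_insubd.
  have h0 : 0 < T (pos u) by rewrite Tp.
  have h1 := Tn (pos u); have h2 : (T (pos u)).-1 < psize la by rewrite prednK.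
  by rewrite h2 prednK.
split; last first.
  apply/ffunP => p; rewrite ffunE; case E : (nd p) => [u|].
    by apply: val_inj; rewrite GE /= (ndK _ _ E) inordK.
  apply: val_inj => /=; apply/esym/eqP; rewrite -leqn0 leqNgt Tp; apply/negP.
  by move=> /ndP[u up]; rewrite -up posK in E.
apply/and4P; split.
- apply/injectiveP => u v /(congr1 val)/(congr1 S); rewrite !GE => /Ti h.
  by apply: pos_inj; apply: h; rewrite Tp.
- apply/forallP => k; have [|p Tk] := Ts k.+1; first by rewrite ltn_ord.
  have /ndP[u up] : p.2 < la@@(p.1) by rewrite -Tp Tk.
  apply/codomP; exists u; apply: val_inj; apply: succn_inj.
  by rewrite GE up Tk.
- apply/'forall_forallP => u v; apply/implyP => /andP[/eqP h1 h2].
  by rewrite -ltnS !GE; apply: Tm; [rewrite Tp|left].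
- apply/'forall_forallP => u v; apply/implyP => /andP[/eqP h1 h2].
  by rewrite -ltnS !GE; apply: Tm; [rewrite Tp|right].
Qed.
Lemma nbox_branch N (r : nat -> nat) n : (forall k, r k.+1 <= r k) ->
    r N = 0 -> (forall k, r k <= N) -> 0 < n <= N ->
  nbox N r n = \sum_(b < N | removable r b) nbox N (fun k => r k - (k == b)) n.-1.
Proof.
move=> rS rN rleN /andP[n0 nN].
pose cell (b : 'I_N) : 'I_N * 'I_N := (b, insubd b (r b).-1).
have cell2 (b : 'I_N) : removable r b -> (cell b).2 = (r b).-1 :> nat.
  rewrite /removable => rb; rewrite /cell /= val_insubd.
  by have := rleN b; case: ifP => //; lia.
have cellr (b : 'I_N) : removable r b -> (cell b).2.+1 = r b.
  by move=> rb; rewrite cell2// prednK//; move: rb; rewrite /removable; lia.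
pose A := [set T : box N | `[< box_std r n T >]].
have hit T : T \in A -> exists2 b : 'I_N, removable r b & T (cell b) = n :> nat.
  rewrite /A !inE => -[Tp Tn Ts Ti Tm].
  have [|[a c] Tac] := Ts n; first by rewrite n0 leqnn.
  have ca : c < r a by have := Tp (a, c); rewrite Tac n0 => /esym.
  have crn : ~~ (c.+1 < r a).
    apply/negP => h.
    have c1 : c.+1 < N by rewrite (leq_trans h).
    have : T (a, c) < T (a, Ordinal c1) by apply: Tm; [rewrite Tp|left].
    by rewrite Tac ltnNge Tn.
  have ra : removable r a.
    rewrite /removable ltnNge; apply/negP => h.
    have a1 : a.+1 < N.
      rewrite ltn_neqAle ltn_ord andbT; apply/eqP => E.
      by move: h ca; rewrite E rN; lia.
    have : T (a, c) < T (Ordinal a1, c).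
      by apply: Tm; [rewrite Tp /= (leq_trans ca)|right].
    by rewrite Tac ltnNge Tn.
  exists a => //; rewrite -Tac; congr (nat_of_ord (T _)); congr pair.
  by apply: val_inj => /=; have := cellr _ ra; rewrite /=; lia.
have hit1 T : T \in A -> \sum_(b < N | removable r b) (T (cell b) == n :> nat) = 1.
  move=> TA; have [b rb Tb] := hit _ TA.
  rewrite (bigD1 b)//= Tb eqxx big1// => c /andP[rc cb]; apply/eqP.
  rewrite eqb0; apply: contraNneq cb => Tc.
  move: TA; rewrite /A !inE => -[Tp Tn Ts Ti Tm].
  have : cell c = cell b by apply: Ti; rewrite Tc ?Tb.
  by case=> ->.
rewrite /nbox -/A -sum1_card.
under eq_bigr => T TA do rewrite -(hit1 _ TA).
rewrite exchange_big /=; apply: eq_bigr => b rb.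
rewrite -big_mkcondr /= sum1dep_card.
pose F (T : box N) : box N := [ffun p => if p == cell b then ord0 else T p].
pose G (T : box N) : box N := [ffun p => if p == cell b then inord n else T p].
have r'E (p : 'I_N * 'I_N) : (p.2 < r p.1 - (p.1 == b :> nat)) = (p != cell b) && (p.2 < r p.1).
  case: p => [a c] /=; have := cellr _ rb.
  rewrite xpair_eqE -!val_eqE /=; case: ((a : nat) =P b) => [->|_] /=; last by rewrite subn0.
  by case: eqP => /=; lia.
have FE (T : box N) p : F T p = (if p == cell b then 0 else T p) :> nat.
  by rewrite ffunE; case: ifP.
have GE (T : box N) p : G T p = (if p == cell b then n else T p) :> nat.
  by rewrite ffunE; case: ifP => // _; rewrite inordK// ltnS.
apply: (@card_can_in _ _ _ _ F G) => T; rewrite ?/A !inE.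
  move=> /andP[/asboolP[Tp Tn Ts Ti Tm] /eqP Tb]; split; last first.
    apply/ffunP => p; apply: val_inj => /=; rewrite GE FE.
    by case: eqP => // ->.
  have Tlt p : p != cell b -> T p < n.
    move=> pb; rewrite ltn_neqAle Tn andbT; apply: contraNneq pb => Tpn.
    by apply/eqP; apply: Ti; rewrite ?Tpn ?Tb.
  split.
  - by move=> p; rewrite r'E FE -Tp; case: eqP.
  - by move=> p; rewrite FE; case: eqVneq => // /Tlt h; rewrite -ltnS prednK.
  - move=> k kn; have [|p Tk] := Ts k; first lia.
    exists p; rewrite FE; case: eqP => // pb.
    by move: Tk; rewrite pb Tb; lia.
  - by move=> p q; rewrite !FE; case: eqP => // _; case: eqP => [_|_]; [lia|exact: Ti].
  - move=> p q; rewrite !FE; case: (q =P _) => // _ q0 /Tm-/(_ q0).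
    by case: eqP => //; lia.
move=> [Tp Tn Ts Ti Tm].
have Tb0 : T (cell b) = 0 :> nat.
  by apply/eqP; rewrite -leqn0 leqNgt Tp r'E eqxx.
split; last first.
  by apply/ffunP => p; apply: val_inj => /=; rewrite FE GE; case: eqP => [->|//]; rewrite Tb0.
rewrite GE !eqxx andbT.
have inr (p : 'I_N * 'I_N) : (p.2 < r p.1) = (0 < T p) || (p == cell b).
  rewrite Tp r'E; case: eqP => [->|_] /=; last by rewrite orbF.
  rewrite cell2//.
  by move: rb; rewrite /removable /=; lia.
apply/asboolP; split.
- by move=> p; rewrite GE inr; case: eqP => //; rewrite ?orbT ?orbF//; lia.
- by move=> p; rewrite GE; case: eqP => // _; have := Tn p; lia.
- move=> k kn; have [->|kn'] := eqVneq k n.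
    by exists (cell b); rewrite GE eqxx.
  have [|p Tk] := Ts k; first lia.
  exists p; rewrite GE; case: eqP => // pb.
  by move: Tk; rewrite pb Tb0; lia.
- move=> p q; rewrite !GE; case: eqP => [->|_]; case: eqP => [->|_]//.
  + by have := Tn q; lia.
  + by have := Tn p; lia.
  + exact: Ti.
- move=> p q; rewrite !GE; case: (q =P _) => [->|_].
    move=> _ pq; case: eqP => [E|_]; last by have := Tn p; lia.
    by move: pq; rewrite E; lia.
  move=> q0 pq; case: eqP => [E|_]; last exact: Tm.
  exfalso; have := cellr _ rb; have : q.2 < r q.1 by rewrite inr q0.
  move: pq rb; rewrite E /removable /=; case: q {q0} => a c /=.
  have rr i j : i <= j -> r j <= r i.
    by move=> /subnK <-; elim: (j - i) => //= m; apply: leq_trans; rewrite addSn.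
  case=> -[] => [<-|h]; first lia.
  by move=> /rr; lia.
Qed.

Lemma card_Std_rec N (la : intpart) : 0 < psize la <= N ->
  #|Std la| = \sum_(b < N | removable (nth 0 la) b) #|Std (rem_node la b)|.
Proof.
move=> /andP[n0 nN]; rewrite (card_Std nN) nbox_branch ?n0//.
- apply: eq_bigr => b rb; have pE := psize_rem rb.
  rewrite (@card_Std _ N); last by rewrite -ltnS -pE ltnW.
  by rewrite pE /=; congr nbox; apply/funext => k; rewrite nth_rem.
- exact: part_noninc.
- by rewrite nth_default// (leq_trans (size_le_psize la)).
- by move=> k; rewrite (leq_trans (part_le_psize la k)).
Qed.

Lemma card_Std0 (la : intpart) : psize la = 0 -> #|Std la| = 1.
Proof.
move=> la0; rewrite (@card_Std _ 0) ?la0//.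
transitivity #|{: box 0}|; last by rewrite card_ffun card_ord exp1n.
apply: eq_card => T; rewrite !inE; apply: asboolT; split => //.
- by case=> -[].
- by case=> -[].
- by move=> k; lia.
- by case=> -[].
- by case=> -[].
Qed.

Lemma card_addable (la : intpart) N : psize la < N ->
  \sum_(a < N | addable (nth 0 la) a) 1 =
  (\sum_(b < N | removable (nth 0 la) b) 1).+1.
Proof.
case: N => // N laN; have sN := leq_trans (size_le_psize la) laN.
rewrite big_mkcond big_ord_recl /= add1n; congr S.
rewrite [RHS]big_mkcond big_ord_recr /=.
rewrite {2}/removable [_@@N]nth_default// ltn0 addn0.
by apply: eq_bigr => i _; rewrite /addable /removable /bump /= add1n.
Qed.

(* Together with card_Std_rec, this is the differential-poset structure of
   Young's lattice, which yields the normalisation of the measure below. *)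
Lemma card_Std_up (la : intpart) N n : psize la = n -> n < N ->
  n.+1 * #|Std la| =
  \sum_(a < N | addable (nth 0 la) a) #|Std (add_node la a)|.
Proof.
elim: n la N => [|n IH] la N En nN.
  rewrite mul1n card_Std0// -[RHS](_ : \sum_(a < N | addable (nth 0 la) a) 1 = _).
    rewrite card_addable ?En// big1 // => b /psize_rem; lia.
  apply: eq_bigr => a aa; have an : psize (add_node la a) = 1 by rewrite psize_add// En.
  rewrite (@card_Std_rec N) ?an//.
  rewrite (bigD1 a) ?add_removable//= addK// card_Std0// big1// => b /andP[rb].
  rewrite eq_sym -val_eqE /= => ab; have := add_rem_comm la ab.
  by rewrite aa rb => /esym/andP[/psize_rem]; lia.
have downE (a : 'I_N) : addable (nth 0 la) a -> #|Std (add_node la a)| =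
    #|Std la| + \sum_(b < N | (b != a) && (removable (nth 0 la) b &&
        addable (nth 0 (rem_node la b)) a)) #|Std (add_node (rem_node la b) a)|.
  move=> aa; have an : psize (add_node la a) = n.+2 by rewrite psize_add// En.
  rewrite (@card_Std_rec N) ?an//.
  rewrite (bigD1 a) ?add_removable//= addK//; congr addn.
  apply: eq_big => [b|b /andP[rb]].
    case: (eqVneq b a) => [->|ba]; first by rewrite andbF.
    by rewrite andbT /= -add_rem_comm ?aa// eq_sym.
  by rewrite eq_sym -val_eqE /= => ab; rewrite add_remC.
rewrite (eq_bigr _ downE) big_split /= sum_nat_const -sum1_card.
rewrite card_addable ?En// [LHS]mulSn [X in _ = X + _]mulSn -addnA; congr addn.
transitivity (\sum_(b < N | removable (nth 0 la) b) n.+1 * #|Std (rem_node la b)|).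
  have laN : 0 < psize la <= N by rewrite En; exact: ltnW.
  by rewrite -big_distrr /= -(card_Std_rec laN).
transitivity (\sum_(b < N | removable (nth 0 la) b)
   (#|Std la| + \sum_(a < N | (b != a) && addable (nth 0 (rem_node la b)) a)
       #|Std (add_node (rem_node la b) a)|)).
  apply: eq_bigr => b rb; have pb : psize (rem_node la b) = n.
    by apply: succn_inj; rewrite -psize_rem.
  rewrite (IH _ N)//; last exact: ltnW.
  rewrite (bigD1 b) ?rem_addable//= remK//; congr addn.
  by apply: eq_bigl => a; rewrite andbC eq_sym.
rewrite big_split /= sum_nat_const sum1_card; congr addn.
rewrite (exchange_big_dep (fun a : 'I_N => addable (nth 0 la) a)) /=; last first.
  move=> b a rb /andP[]; rewrite -val_eqE /= eq_sym => ba ab.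
  by have := add_rem_comm la ba; rewrite rb ab => /andP[].
by apply: eq_bigr => a aa; apply: eq_bigl => b; rewrite andbCA.
Qed.

Import Order.TTheory GRing.Theory Num.Theory.
Import numFieldNormedType.Exports.
Local Open Scope classical_set_scope.
Local Open Scope ring_scope.

Lemma esumZl (R : realType) (T : choiceType) (I : set T) (c : R)
    (a : T -> \bar R) : 0 < c -> (forall x, 0 <= a x)%E ->
  (\esum_(x in I) (c%:E * a x) = c%:E * \esum_(x in I) a x)%E.
Proof.
move=> c0 a0.
have H (k : R) (b : T -> \bar R) : 0 < k -> (forall x, 0 <= b x)%E ->
    (\esum_(x in I) (k%:E * b x) <= k%:E * \esum_(x in I) b x)%E.
  move=> k0 b0; apply: ge_ereal_sup => _ [X [finX XI] <-].
  rewrite -ge0_mule_fsumr//; apply: lee_wpmul2l; first by rewrite lee_fin ltW.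
  by apply: ereal_sup_ubound; exists X.
apply/eqP; rewrite eq_le H//=.
rewrite -lee_pdivlMl//; apply: le_trans (H _ _ _ _).
- by apply: le_esum => x _; rewrite muleA -EFinM mulVf ?gt_eqF// mul1e.
- by rewrite invr_gt0.
- by move=> x; rewrite mule_ge0// lee_fin ltW.
Qed.

Lemma esum_card_Std (R : realType) n :
  (\esum_(la in [set la | psize la = n]) (#|Std la| ^ 2)%N%:R%:E = n`!%:R%:E :> \bar R)%E.
Proof.
elim: n => [|n IH].
  have -> : [set la | psize la = 0%N] = [set empty_intpart].
    apply/seteqP; split => [la /= la0|_ ->//].
    apply: val_inj => /=; have := size_le_psize la; rewrite la0 leqn0.
    by move=> /nilP.
  by rewrite esum_set1 ?lee_fin// card_Std0.
pose N := n.+2.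
transitivity (\esum_(la in [set la | psize la = n.+1])
    \sum_(b < N | removable (nth 0%N la) b) (#|Std la| * #|Std (rem_node la b)|)%N%:R%:E
  : \bar R)%E.
  apply: eq_esum => la /= Pla.
  have laN : (0 < psize la <= N)%N by rewrite Pla /N /= leqnSn.
  by rewrite sumEFin -natr_sum -big_distrr /= -(card_Std_rec laN).
transitivity (\sum_(b < N)
    \esum_(la in [set la | psize la = n.+1 /\ removable (nth 0%N la) b])
      (#|Std la| * #|Std (rem_node la b)|)%N%:R%:E : \bar R)%E.
  under eq_esum do rewrite big_mkcond.
  rewrite esum_sum => [|la b _ _]; last by case: ifP => //; rewrite lee_fin.
  apply: eq_bigr => b _.
  rewrite -/([set la | psize la = n.+1] `&` [set la | removable (nth 0%N la) b]).
  by rewrite esum_mkcondr; apply: eq_esum => la _; rewrite mem_setE.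
transitivity (\sum_(b < N)
    \esum_(la in [set la | psize la = n /\ addable (nth 0%N la) b])
      (#|Std (add_node la b)| * #|Std la|)%N%:R%:E : \bar R)%E.
  apply: eq_bigr => b _.
  rewrite (@reindex_esum _ _ _ [set la | psize la = n /\ addable (nth 0%N la) b]
     _ (fun la => add_node la b)); last first.
    split.
    - by move=> la /= [Pla ab]; rewrite psize_add// Pla add_removable.
    - move=> la mu; rewrite !inE /= => -[_ ab] [_ ab'] E.
      by rewrite -(addK ab) E addK.
    - move=> la /= [Pla rb]; exists (rem_node la b); last exact: remK.
      by split; [apply: succn_inj; rewrite -psize_rem|exact: rem_addable].
  by apply: eq_esum => la [_ ab]; rewrite addK.
transitivity (\esum_(la in [set la | psize la = n])
    \sum_(b < N | addable (nth 0%N la) b) (#|Std (add_node la b)| * #|Std la|)%N%:R%:E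
  : \bar R)%E.
  under [RHS]eq_esum do rewrite big_mkcond.
  rewrite esum_sum => [|la b _ _]; last by case: ifP => //; rewrite lee_fin.
  apply: eq_bigr => b _.
  rewrite -/([set la | psize la = n] `&` [set la | addable (nth 0%N la) b]).
  by rewrite esum_mkcondr; apply: eq_esum => la _; rewrite mem_setE.
rewrite factS natrM EFinM -IH -esumZl//.
apply: eq_esum => la /= Pla.
rewrite sumEFin -natr_sum -big_distrl /= -(card_Std_up Pla (leqW (leqnn n.+1))).
by rewrite -EFinM -natrM mulnA.
Qed.

Section poissonised_plancherel.
Context {R : realType}.
Implicit Types (t : R) (la : intpart).

Definition plancherel_pmf t la : R :=
  expR (- t) * t ^+ psize la * (#|Std la|%:R / (psize la)`!%:R) ^+ 2.

(* The case t <= 0 is a dummy value making this a probability for all t. *)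
Definition plancherel t : set intpart -> \bar R := fun A =>
  if 0 < t then (\esum_(la in A) (plancherel_pmf t la)%:E)%E
  else \d_empty_intpart A.

Variable t : R.
Local Notation pl := (plancherel t).

Let pmf_ge0 la : 0 < t -> (0 <= (plancherel_pmf t la)%:E)%E.
Proof.
by move=> t0; rewrite lee_fin !mulr_ge0 ?expR_ge0 ?exprn_ge0 ?divr_ge0// ltW.
Qed.

Let pl0 : pl set0 = 0%E.
Proof. by rewrite /plancherel measure0; case: ifPn => //; rewrite esum_set0. Qed.

Let pl_ge0 A : (0 <= pl A)%E.
Proof.
by rewrite /plancherel; case: ifPn => // t0; apply: esum_ge0 => la _; exact: pmf_ge0.
Qed.

Let pl_sigma_additive : semi_sigma_additive pl.
Proof.
move=> F mF tF mUF; rewrite /plancherel; case: ifPn => t0; last first.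
  exact: measure_semi_sigma_additive.
apply: cvg_toP.
  apply: ereal_nondecreasing_is_cvgn => a b ab.
  apply: lee_sum_nneg_natr => // n _ _.
  by apply: esum_ge0 => /= ? _; exact: pmf_ge0.
by rewrite nneseries_sum_bigcup// => i; exact: pmf_ge0.
Qed.

HB.instance Definition _ := isMeasure.Build _ _ _ pl pl0 pl_ge0 pl_sigma_additive.

Let pl_setT : pl setT = 1%E.
Proof.
rewrite /plancherel; case: ifPn => [t0|_]; last by rewrite probability_setT.
have <- : (\esum_(k in [set: nat]) (poisson_pmf t k)%:E = 1)%E.
  have : poisson_prob t 0%N [set: nat] = 1%E := probability_setT _.
  by rewrite /poisson_prob t0.
rewrite -nneseries_esumT => [|n]; last by rewrite lee_fin poisson_pmf_ge0.
have -> : [set: intpart] = \bigcup_n [set la | psize la = n].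
  by apply/seteqP; split => // la _; exists (psize la).
rewrite nneseries_sum_bigcup; first last.
- by move=> la; exact: pmf_ge0.
- by apply/trivIsetP => m n _ _ mn; apply/seteqP; split => // la /= [-> /eqP]; rewrite (negPf mn).
apply: eq_eseriesr => n _.
pose c := expR (- t) * t ^+ n / n`!%:R ^+ 2.
have c0 : 0 < c by rewrite !mulr_gt0 ?expR_gt0 ?exprn_gt0 ?invr_gt0 ?exprn_gt0 ?ltr0n ?fact_gt0.
transitivity (\esum_(la in [set la | psize la = n]) (c%:E * (#|Std la| ^ 2)%N%:R%:E))%E.
  apply: eq_esum => la /= Pla; rewrite /plancherel_pmf -EFinM /c -Pla.
  by rewrite natrX exprMn exprVn mulrA mulrAC.
rewrite esumZl// esum_card_Std -EFinM; congr EFin.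
rewrite /c /poisson_pmf t0 mulrC -mulrA; rewrite expr2 invfM.
have f0 : n`!%:R != 0 :> R by rewrite pnatr_eq0 gtn_eqF// fact_gt0.
by field.
Qed.

HB.instance Definition _ := @Measure_isProbability.Build _ _ R pl pl_setT.

End poissonised_plancherel.

Section residues.
Context {R : realType} (e : nat).

(* 'Z_e is Z/eZ when 1 < e. *)
Definition residue (la : intpart) (u : node la) : 'Z_e :=
  (node_col u)%:R - (node_row u)%:R.

Definition res_count (i : 'Z_e) (la : intpart) : nat :=
  #|[pred u : node la | residue u == i]|.

Definition res_diff (i : 'Z_e) (la : intpart) : R :=
  (res_count i la)%:R - (res_count (i + 1) la)%:R.

End residues.

Definition cot {R : realType} (y : R) : R := cos y / sin y.

(* f ~ g at +oo: the ratio of the two sides tends to 1.  Since the limit is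
   taken in \bar R, f is in particular finite near +oo. *)
Definition asymp_equiv {R : realType} (f : R -> \bar R) (g : R -> R) : Prop :=
  (f t * ((g t)^-1)%:E)%E @[t --> +oo] --> (1%:E : \bar R).

(* Main.v *)
Require Import Defs.
From HB Require Import structures.
From mathcomp Require Import all_boot all_order all_algebra.
From mathcomp Require Import perm finmap.
From mathcomp Require Import all_classical all_reals all_analysis.
From mathcomp Require Import zify ring lra.

(** Write f for the indicator of the residue class i. Along a row of the diagram the difference
of the indicators of b - a = i and b - a = i + 1 telescopes, so x_i(la) is the linear
statistic [linstat f la] of the point configuration la_j - j, normalised to vanish on the
empty partition ([res_diff_linstat]). The class indicator is an average of the e waves cos
(th_a x + al) with th_a = 2 pi a / e, so everything reduces to first and second moments of
linear statistics of waves.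

Exact moments. Partitions of size at most N are configurations of N distinct particles, and
#Std la is the value at that configuration of U^n vac, where vac is the (antisymmetric)
ground state and U moves one particle up; its companion D moves one particle back.
Multiplication by a linear statistic is the one-body operator [hop 0 f]; commuting it with U
or D produces the one-body operator of a discrete derivative of f ([hop_comm]). Pushing all
U to the left and all D to the right therefore writes the sum over the partitions of size n
of #Std la ^ 2 times one or two statistics as sum_k 'C(n, k) n!/k! c_k, with c_k a vacuum
expectation ([ladder_descent], [level_mean], [level_pair]). The Poissonised weights are made
so that this binomial transform cancels: the expectation is sum_k t^k c_k / k!^2
([expectation_coef]).

For a wave, each discrete derivative multiplies by 2 sin (th/2) and shifts the phase, and
the series become Bessel functions: the mean is a bounded multiple of J_0 - 1, and the
covariance of two waves is sum_m G_m J_m J'_m, where the Bessel arguments are 2 sqrt t * 2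
sin (th/2) and G_m is a sum of m products of two cosines ([wave_first_moment],
[wave_second_moment]). The product-to-sum formula turns G_m into two geometric sums: they
are bounded in m, except that each of them is linear in m when th_a - th_b, resp. th_a +
th_b, is a multiple of 2 pi. Since sum_m J_m^2 <= 1, bounded coefficients contribute O(1),
and only S(z) = sum_m m J_m(2z)^2 matters.

S(z) is asymptotic to 2z/pi ([J_sum_asymp]). The numbers J_r(2z)^2, r an integer, form a
probability law whose central factorial moments are exactly 'C(2k, k) z^(2k)
([bessel_moment]); hence the moments of u = (r / 2z)^2 tend to those of the arcsine law. As
|r| / 2z is the square root of u, it is enclosed, for all u >= 0, between two explicit
polynomials in 1 - u ([sqrt_poly_ge], [sqrt_poly_le]), whose arcsine means are the Wallis
product (2n+1) c_n^2 and a quantity close to it; the same two inequalities at the points sin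
(pi a / N) show that these means enclose 2/pi ([wallis_bracket]).

Finally the sum over a of cos (th_a (j - i)) 2 sin (pi a / e) is a difference of two sums of
sines in arithmetic progression, each of which is a cotangent ([sum_cos_amp]). *)

Set Implicit Arguments.
Unset Strict Implicit.
Unset Printing Implicit Defensive.
Import Order.TTheory GRing.Theory Num.Theory.
Import numFieldNormedType.Exports.
Local Open Scope classical_set_scope.
Local Open Scope ring_scope.

(** * The branching rule summed over all partitions of a given size *)

Section levels.

Definition level (n : nat) : set intpart := [set la | psize la = n].

(** Every nonempty partition is obtained by adding a node to the last row of a smaller one,
so levels are finite by induction. *)
Lemma finite_level n : finite_set (level n).
Proof.
elim: n => [|n IH].
  apply: (@sub_finite_set _ _ [set empty_intpart]); last exact: finite_set1.
  move=> la /= la0; apply: val_inj => /=.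
  by have := size_le_psize la; rewrite la0 leqn0 => /nilP.
apply: (@sub_finite_set _ _
    ((fun p : intpart * nat => add_node p.1 p.2) @` (level n `*` `I_n.+1))); last first.
  by apply: finite_image; apply: finite_setX => //; exact: finite_II.
move=> la /= laS.
have s0 : (0 < size la)%N.
  rewrite lt0n; apply/eqP => /size0nil E.
  by move: laS; rewrite /level /= /psize E.
have rb : removable (nth 0%N la) (size la).-1.
  by rewrite /removable prednK// nth_default// Defs.part_gt0 prednK.
exists (rem_node la (size la).-1, (size la).-1); last exact: remK.
split => /=; first by apply: succn_inj; rewrite -laS (psize_rem rb).
by rewrite prednK// -laS size_le_psize.
Qed.

Definition level_seq n := fset_set (level n).

Lemma mem_level_seq n la : (la \in level_seq n) = (psize la == n).
Proof.
rewrite in_fset_set; last exact: finite_level.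
by apply/idP/eqP; rewrite in_setE.
Qed.

Lemma uniq_level_seq n : uniq (level_seq n).
Proof. exact: fset_uniq. Qed.

(** Adding a node to row a and removing a node from row a are mutually inverse, so the edges
of Young's lattice between two consecutive levels can be listed from either end. *)
Lemma sum_level_branching (V : zmodType) (H : intpart -> intpart -> V) N n :
  \sum_(la <- level_seq n) \sum_(a < N | addable (nth 0%N la) a) H la (add_node la a) =
  \sum_(mu <- level_seq n.+1) \sum_(b < N | removable (nth 0%N mu) b) H (rem_node mu b) mu.
Proof.
rewrite (exchange_big_dep predT)//= [RHS](exchange_big_dep predT)//=.
apply: eq_bigr => a _.
rewrite -big_filter -[RHS]big_filter.
rewrite (@perm_big _ _ _ _ _ [seq rem_node mu a | mu : intpart <-
   [seq mu : intpart <- level_seq n.+1 | removable (nth 0%N mu) a]]) /=; last first.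
  apply: uniq_perm; first by rewrite filter_uniq ?uniq_level_seq.
    rewrite map_inj_in_uniq ?filter_uniq ?uniq_level_seq// => x y.
    rewrite !mem_filter => /andP[rx _] /andP[ry _] E.
    by rewrite -(remK rx) E remK.
  move=> la; rewrite mem_filter mem_level_seq; apply/andP/mapP => [[aa /eqP Pla]|[mu]].
    exists (add_node la a); last by rewrite addK.
    by rewrite mem_filter mem_level_seq add_removable// psize_add// Pla eqxx.
  rewrite mem_filter mem_level_seq => /andP[ra /eqP Pm] ->; split; first exact: rem_addable.
  by rewrite -eqSS -(psize_rem ra) Pm.
rewrite big_map; apply: eq_big_seq => mu; rewrite mem_filter => /andP[ra _].
by rewrite remK.
Qed.

End levels.

(** * Partitions as configurations of particles *)

Section first_quantisation.
Context {R : realType} {N : nat}.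
Implicit Types (l : 'I_N -> int) (i j : 'I_N) (r q : int) (f g : int -> R)
  (phi : ('I_N -> int) -> R).

(** The sign is chosen so that positive [r] lowers the particle seen by [phi] in [hop], i.e.
the state itself is raised. *)
Definition displace l j r : 'I_N -> int := fun i => l i - (if i == j then r else 0).

Lemma displaceC l i j r q : displace (displace l j r) i q = displace (displace l i q) j r.
Proof. by apply/funext => k; rewrite /displace addrAC. Qed.

Lemma displaceD l j r q : displace (displace l j r) j q = displace l j (r + q).
Proof. by apply/funext => k; rewrite /displace; case: eqP => _; ring. Qed.

Lemma displace_eq l j r : displace l j r j = l j - r.
Proof. by rewrite /displace eqxx. Qed.

Lemma displace_neq l i j r : i != j -> displace l j r i = l i.
Proof. by rewrite /displace => /negPf ->; rewrite subr0. Qed.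

Lemma displace0 l j : displace l j 0 = l.
Proof. by apply/funext => k; rewrite /displace if_same subr0. Qed.

(** The one-body operator of second quantisation, in first-quantised form. *)
Definition hop r f phi l : R := \sum_(j < N) f (l j) * phi (displace l j r).

(** Terms that move two different particles commute; only the ones that move the same
particle twice survive in the commutator, and they form again a one-body operator. *)
Lemma hop_comm r q f g phi l :
  hop r f (hop q g phi) l - hop q g (hop r f phi) l =
  hop (r + q) (fun x => f x * g (x - r) - g x * f (x - q)) phi l.
Proof.
rewrite /hop; under eq_bigr do rewrite big_distrr.
under [X in _ - X]eq_bigr do rewrite big_distrr.
rewrite [X in _ - X]exchange_big -sumrB; apply: eq_bigr => j _.
rewrite -sumrB (bigD1 j)//= big1 => [|i ij].
  by rewrite addr0 !displace_eq !displaceD [q + r]addrC; ring.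
by rewrite (displace_neq _ _ ij) displace_neq 1?eq_sym// displaceC; ring.
Qed.

Lemma hopD r f phi1 phi2 l :
  hop r f (fun m => phi1 m + phi2 m) l = hop r f phi1 l + hop r f phi2 l.
Proof. by rewrite -big_split; apply: eq_bigr => j _; rewrite mulrDr. Qed.

Definition antisym phi := forall i j, i != j ->
  forall l, phi (l \o tperm i j) = - phi l.

(** The particles live on the sites >= -N; this support condition makes the system of [N]
particles behave like one with infinitely many particles below. *)
Definition above phi := forall l, (exists i, l i < - N%:Z) -> phi l = 0.

Lemma antisym0 phi l i j : antisym phi -> i != j -> l i = l j -> phi l = 0.
Proof.
move=> a ij lij; have := a _ _ ij l.
rewrite (_ : l \o _ = l); last first.
  by apply/funext => k /=; case: tpermP => [->|->|].
by move=> h; lra.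
Qed.

Lemma displace_tperm l i j k r : displace (l \o tperm i j) k r =
  displace l (tperm i j k) r \o tperm i j.
Proof. by apply/funext => m; rewrite /displace /= (inj_eq perm_inj). Qed.

Lemma antisym_hop r f phi : antisym phi -> antisym (hop r f phi).
Proof.
move=> a i j ij l; rewrite /hop (reindex_inj (@perm_inj _ (tperm i j))) /= -sumrN.
by apply: eq_bigr => k _; rewrite displace_tperm /= !tpermK a// mulrN.
Qed.

(** The Maya diagram of the partition, cut after [N] particles: each row sits at the content
of its last node, an empty row just before its first possible node. *)
Definition conf (la : intpart) : 'I_N -> int := fun j => (nth 0%N la j)%:Z - j%:Z - 1.

Lemma confE la j : conf la j = (nth 0%N la j)%:Z - j%:Z - 1.
Proof. by []. Qed.

Definition sea : 'I_N -> int := fun j => - j%:Z - 1.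

Lemma conf_empty : conf empty_intpart = sea.
Proof. by apply/funext => j; rewrite confE /sea nth_nil; ring. Qed.

(** The determinant is the antisymmetrised indicator of the sea: it equals the sign of the
permutation that sorts [l] into [sea], and 0 when there is none. *)
Definition vac l : R := \det (\matrix_(i < N, j < N) (l i == sea j)%:R).

Lemma vac_sea : vac sea = 1.
Proof.
rewrite /vac -[RHS](det1 _ N); congr (\det _).
apply/matrixP => i j; rewrite !mxE; congr (_ *+ nat_of_bool _).
by apply/eqP/eqP => [|->//]; rewrite /sea => h; apply: val_inj => /=; lia.
Qed.

Lemma antisym_vac : antisym vac.
Proof.
move=> i j ij l; rewrite /vac.
rewrite (_ : \matrix_(_, _) _ = row_perm (tperm i j) (\matrix_(i < N, j < N) (l i == sea j)%:R)).
  by rewrite row_permE det_mulmx det_perm odd_tperm ij expr1 mulN1r.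
by apply/matrixP => k m; rewrite !mxE.
Qed.

Lemma vac_neq0 l : vac l != 0 -> forall i, exists k, l i = sea k.
Proof.
move=> v0 i; apply: contrapT => H; case/eqP: v0.
rewrite /vac (expand_det_row _ i) big1// => k _; rewrite mxE.
by case: eqP => [e|]; [case: H; exists k|rewrite mul0r].
Qed.

Lemma above_vac : above vac.
Proof.
move=> l [i li]; apply/eqP/negPn/negP => /vac_neq0/(_ i)[k].
by rewrite /sea => e; move: li; rewrite e; have := ltn_ord k; lia.
Qed.

Lemma sea_surj l : injective l -> (forall i, exists k, l i = sea k) ->
  forall k, exists i, l i = sea k.
Proof.
move=> linj H; pose h i := projT1 (cid (H i)).
have hE i : l i = sea (h i) by rewrite /h; case: cid.
have hi : injective h by move=> i j e; apply: linj; rewrite !hE e.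
move=> k; exists (invF hi k); by rewrite hE f_invF.
Qed.

Lemma in_sea (x : int) : - N%:Z <= x -> x < 0 -> exists k : 'I_N, x = sea k.
Proof.
move=> h1 h2; have h : (absz (x + 1)%R < N)%N by lia.
by exists (Ordinal h); rewrite /sea /=; lia.
Qed.

(** Exclusion principle: for the state not to vanish, [l] with one particle raised by [r]
must be a permutation of the sea. Undoing the move leaves the lowered particle on a site
that is either below the region or already occupied. *)
Lemma hop_vac (r : int) f l : 0 < r -> (forall i, - N%:Z <= l i) ->
  hop (- r) f vac l = 0.
Proof.
move=> r0 lN; have [linj|] := pselect (injective l); last first.
  move=> ninj; have [i [j [ij lij]]] : exists i j, i != j /\ l i = l j.
    apply: contrapT => H; apply: ninj => i j lij.
    by apply: contrapT => ij; apply: H; exists i, j; split => //; exact/eqP.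
  by apply: (antisym0 _ ij) => //; apply: antisym_hop; exact: antisym_vac.
rewrite /hop big1// => j _; apply/eqP; rewrite mulf_eq0; apply/orP; right.
apply/negPn/negP => v0; have vs := vac_neq0 v0.
have mj : displace l j (- r) j = l j + r by rewrite displace_eq opprK.
have ls i : exists k, l i = sea k.
  have [->|ij] := eqVneq i j; last by have := vs i; rewrite displace_neq.
  apply: in_sea => //; have [k] := vs j; rewrite mj /sea => e.
  by have := ltn_ord k; lia.
have [k kE] := vs j; have [i iE] := sea_surj linj ls k.
have ij : i != j by apply: contra_eq_neq iE => ->; rewrite -kE mj; apply/eqP; lia.
have : displace l j (- r) i = displace l j (- r) j by rewrite displace_neq// iE kE.
by move=> /(antisym0 antisym_vac ij)/eqP; rewrite (negPf v0).
Qed.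

(** On antisymmetric states that vanish below the region, [U] and [D] sum over the removable
and addable nodes ([U_conf], [D_conf]): they are the up and down operators of Young's
lattice. *)
Definition U phi := hop 1 (fun=> 1) phi.
Definition D phi := hop (-1) (fun=> 1) phi.

Lemma above_U phi : above phi -> above (U phi).
Proof.
move=> a l [i li]; rewrite /U /hop big1// => j _; rewrite a ?mulr0//.
by exists i; rewrite /displace; case: ifP => _; lia.
Qed.

Lemma conf_above la i : - N%:Z <= conf la i.
Proof. by rewrite confE; have := ltn_ord i; lia. Qed.

(** Moving a particle down onto the next one gives 0 by antisymmetry, and moving the last
one out of the region gives 0 by the support condition, so only the rows with a
removable node contribute. *)
Lemma U_conf phi la : (psize la <= N)%N -> antisym phi -> above phi ->
  U phi (conf la) = \sum_(b < N | removable (nth 0%N la) b) phi (conf (rem_node la b)).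
Proof.
move=> laN an ab; rewrite /U /hop [RHS]big_mkcond /=; apply: eq_bigr => b _.
rewrite mul1r; case: ifPn => rb.
  congr phi; apply/funext => k; rewrite /displace !confE nth_rem// -val_eqE /=.
  by move: rb; rewrite /removable; case: eqP => [->|]; lia.
move: rb; rewrite /removable -leqNgt => rb.
have h := part_noninc la b.
have [bN|bN] := ltnP b.+1 N.
  have bb : b != Ordinal bN by rewrite -val_eqE /=; lia.
  apply: (antisym0 an bb); rewrite displace_eq displace_neq 1?eq_sym// !confE /=; lia.
apply: ab; exists b; rewrite displace_eq confE.
have := size_le_psize la; have := Defs.part_gt0 la b.+1; lia.
Qed.

(** Moving a particle up onto the previous one gives 0 by antisymmetry, so only the rows
with an addable node contribute. *)
Lemma D_conf phi la : antisym phi ->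
  D phi (conf la) = \sum_(a < N | addable (nth 0%N la) a) phi (conf (add_node la a)).
Proof.
move=> an; rewrite /D /hop [RHS]big_mkcond /=; apply: eq_bigr => a _.
rewrite mul1r; case: ifPn => ra.
  congr phi; apply/funext => k; rewrite /displace !confE nth_add// -val_eqE /=.
  by case: eqP => [->|]; lia.
move: ra; rewrite /addable negb_or -leqNgt => /andP[a0 ra].
have aN : (a.-1 < N)%N by have := ltn_ord a; lia.
have h := part_noninc la a.-1; rewrite prednK ?lt0n// in h.
have bb : a != Ordinal aN by rewrite -val_eqE /=; lia.
apply: (antisym0 an bb); rewrite displace_eq displace_neq 1?eq_sym// !confE /=; lia.
Qed.

Definition phin n := iter n U vac.

Lemma antisym_phin n : antisym (phin n).
Proof. by elim: n => [|n IH]; [exact: antisym_vac|exact: antisym_hop]. Qed.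

Lemma above_phin n : above (phin n).
Proof. by elim: n => [|n IH]; [exact: above_vac|exact: above_U]. Qed.

(** Both sides obey the branching rule #Std la = sum of #Std mu over the partitions mu
obtained by removing a node. *)
Lemma phin_conf n la : psize la = n -> (n <= N)%N ->
  phin n (conf la) = #|Std la|%:R.
Proof.
elim: n la => [|n IH] la Pla nN.
  rewrite card_Std0// /=.
  rewrite (_ : la = empty_intpart) ?conf_empty ?vac_sea//.
  by apply: val_inj => /=; have := size_le_psize la; rewrite Pla leqn0 => /nilP.
rewrite /phin iterS U_conf ?Pla//; [|exact: antisym_phin|exact: above_phin].
rewrite (@card_Std_rec N) ?Pla// natr_sum; apply: eq_bigr => b rb.
by apply: IH; [apply: succn_inj; rewrite -(psize_rem rb)|exact: ltnW].
Qed.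

(** The pairing of a state with the combination of all configurations of level [n], each
weighted by its number of standard tableaux, that is with the [n]-th power of [D] at the
sea. *)
Definition std_sum n phi : R := \sum_(la <- level_seq n) #|Std la|%:R * phi (conf la).

Lemma std_sum0 phi : std_sum 0 phi = phi sea.
Proof.
rewrite /std_sum (perm_big [:: empty_intpart]) /=; last first.
  apply: uniq_perm => //; first exact: uniq_level_seq.
  move=> la; rewrite mem_level_seq inE; apply/eqP/eqP => [la0|->//].
  by apply: val_inj => /=; have := size_le_psize la; rewrite la0 leqn0 => /nilP.
by rewrite big_seq1 card_Std0// mul1r conf_empty.
Qed.

Lemma eq_std_sum n phi1 phi2 :
  (forall l, (forall i, - N%:Z <= l i) -> phi1 l = phi2 l) -> std_sum n phi1 = std_sum n phi2.
Proof. by move=> H; apply: eq_bigr => la _; rewrite H// => i; exact: conf_above. Qed.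

Lemma std_sumD n phi1 phi2 : std_sum n (fun l => phi1 l + phi2 l) = std_sum n phi1 + std_sum n phi2.
Proof. by rewrite -big_split; apply: eq_bigr => la _; rewrite mulrDr. Qed.

Lemma std_sum_D n phi : (n < N)%N -> antisym phi -> std_sum n.+1 phi = std_sum n (D phi).
Proof.
move=> nN an; rewrite /std_sum.
under [RHS]eq_bigr do rewrite D_conf// big_distrr.
rewrite (@sum_level_branching _ (fun la mu => #|Std la|%:R * phi (conf mu))).
apply: eq_big_seq => mu; rewrite mem_level_seq => /eqP Pm.
by rewrite (@card_Std_rec N) ?Pm// natr_sum big_distrl.
Qed.

Lemma std_sum0_U phi : antisym phi -> above phi -> std_sum 0 (U phi) = 0.
Proof.
move=> an ab; rewrite std_sum0 -conf_empty U_conf// big1// => b.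
by rewrite /removable !nth_nil.
Qed.

(** By [card_Std_up], (n + 1) #Std la is the sum of #Std mu over the partitions mu obtained
by adding a node to la; this is the relation D U - U D = 1 of Young's lattice,
integrated. *)
Lemma std_sum_U n phi : (n < N)%N -> antisym phi -> above phi ->
  std_sum n.+1 (U phi) = n.+1%:R * std_sum n phi.
Proof.
move=> nN an ab; rewrite /std_sum.
transitivity (\sum_(mu <- level_seq n.+1) \sum_(b < N | removable (nth 0%N mu) b)
    #|Std mu|%:R * phi (conf (rem_node mu b))).
  apply: eq_big_seq => mu; rewrite mem_level_seq => /eqP Pm.
  by rewrite U_conf// ?Pm// big_distrr.
rewrite -(@sum_level_branching _ (fun la mu => #|Std mu|%:R * phi (conf la))) big_distrr.
apply: eq_big_seq => la; rewrite mem_level_seq => /eqP Pm /=.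
by rewrite mulrA -natrM (card_Std_up Pm nN) natr_sum big_distrl.
Qed.

End first_quantisation.

(** * Moments of linear statistics over the partitions of a given size *)

Section pascal.
Context {R : comPzRingType}.

(** Pascal's rule in the form needed by recursions on two complementary indices. *)
Lemma binom_sum_shift (F : nat -> nat -> R) k :
  \sum_(u < k.+2) 'C(k.+1, u)%:R * F u (k.+1 - u)%N =
  \sum_(u < k.+1) 'C(k, u)%:R * F u.+1 (k - u)%N +
  \sum_(u < k.+1) 'C(k, u)%:R * F u (k - u).+1%N.
Proof.
rewrite big_ord_recl /= bin0 subn0 [X in _ = _ + X]big_ord_recl /= bin0 subn0.
rewrite [RHS]addrCA; congr (_ + _).
under eq_bigr => u _ do rewrite /bump /= add1n binS natrD mulrDl subSS.
rewrite big_split /= addrC; congr (_ + _).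
rewrite big_ord_recr /= bin_small// mul0r addr0.
by apply: eq_bigr => u _; rewrite /bump /= add1n; congr (_ * F _ _); have := ltn_ord u; lia.
Qed.

(** Solution of the recursion met when [D] is moved to the right through two operators: each
of the [i] copies is absorbed by one of the two. The bounds [B] and [I0] restrict the
recursion to the indices for which it holds. *)
Lemma annihilation_descent (P : nat -> nat -> nat -> R) B I0 :
  (forall i a c, (i < I0)%N -> (a + c + i < B)%N ->
     P i.+1 a c = P i a.+1 c + P i a c.+1) ->
  forall i a c, (i <= I0)%N -> (a + c + i <= B)%N ->
  P i a c = \sum_(u < i.+1) 'C(i, u)%:R * P 0%N (a + u)%N (c + (i - u))%N.
Proof.
move=> H; elim=> [|i IH] a c iI acB.
  by rewrite big_ord1 bin0 mul1r !addn0.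
rewrite H; [|lia..]; rewrite !IH; [|lia..].
rewrite (binom_sum_shift (fun u v => P 0%N (a + u)%N (c + v)%N)).
by congr (_ + _); apply: eq_bigr => u _; rewrite ?addSn ?addnS.
Qed.

(** Solution of the recursion met when [U] is moved to the left: each of the [j] copies is
absorbed by one of two operators or, once at the left, lowers the level and produces a
factor [i]; the falling factorial collects these factors. *)
Lemma creation_descent (P : nat -> nat -> nat -> nat -> R) B I0 :
  (forall i j a c, (i <= I0)%N -> (a + c + j < B)%N ->
     P i j.+1 a c = i%:R * P i.-1 j a c + (P i j a.+1 c + P i j a c.+1)) ->
  forall i j a c, (i <= I0)%N -> (a + c + j <= B)%N ->
  P i j a c = \sum_(k < j.+1) 'C(j, k)%:R * (i ^_ (j - k))%:R *
    \sum_(u < k.+1) 'C(k, u)%:R * P (i - (j - k))%N 0%N (a + u)%N (c + (k - u))%N.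
Proof.
move=> H i j; elim: j i => [|j IH] i a c iI acB.
  by rewrite !big_ord1 !bin0 !mul1r !addn0 subn0.
rewrite H; [|lia..]; rewrite !IH; [|lia..].
pose W k i' := \sum_(u < k.+1) 'C(k, u)%:R * P i' 0%N (a + u)%N (c + (k - u))%N.
pose F k q := (i ^_ q)%:R * W k (i - q)%N.
transitivity (\sum_(k < j.+2) 'C(j.+1, k)%:R * F k (j.+1 - k)%N); last first.
  by apply: eq_bigr => k _; rewrite /F mulrA.
rewrite binom_sum_shift addrC; congr (_ + _).
  rewrite -big_split; apply: eq_bigr => k _ /=.
  rewrite -mulrDr /F mulrA; congr (_ * _).
  rewrite /W (binom_sum_shift (fun u v => P _ 0%N (a + u)%N (c + v)%N)).
  by congr (_ + _); apply: eq_bigr => u _; rewrite ?addSn ?addnS.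
rewrite big_distrr; apply: eq_bigr => k _ /=.
rewrite /F /W; case: i iI {F} => [|i] iI /=; first by rewrite ffact0n /= !mul0r mulr0.
by rewrite ffactSS natrM subSS; ring.
Qed.

End pascal.

Section families.
Context {R : realType} {N : nat}.
Implicit Types (l : 'I_N -> int) (i j : 'I_N) (r q : int) (f g : int -> R)
  (phi : ('I_N -> int) -> R).

Definition bdiff f : int -> R := fun x => f x - f (x - 1).
Definition fdiff f : int -> R := fun x => f (x + 1) - f x.
Definition iter_diff a b f := iter b fdiff (iter a bdiff f).

(** The two difference operators commute. *)
Lemma iter_diff_bdiff a b f : iter_diff a.+1 b f = bdiff (iter_diff a b f).
Proof.
rewrite /iter_diff; elim: b => [//|b IH]; rewrite [in LHS]iterS IH [in RHS]iterS.
by apply/funext => x; rewrite /bdiff /fdiff subrK addrK; ring.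
Qed.

Lemma iter_diff_fdiff a b f : iter_diff a b.+1 f = fdiff (iter_diff a b f).
Proof. by []. Qed.

Lemma iter_diff_supp a b f (L : int) : (forall x, x < L -> f x = 0) ->
  forall x, x < L - b%:Z -> iter_diff a b f x = 0.
Proof.
move=> fL; elim: b => [|b IH] x xL.
  have {xL} : x < L by lia.
  rewrite /iter_diff /=; elim: a x => [|a IH] x xL; first exact: fL.
  by rewrite iterS /bdiff !IH ?subr0//; lia.
by rewrite iter_diff_fdiff /fdiff !IH ?subr0//; lia.
Qed.

Local Notation op := ((('I_N -> int) -> R) -> ('I_N -> int) -> R).

(** What the descent uses about a family [A a b]: commuting with [U] raises the first index,
commuting with [D] raises the second, and for indices up to [B] the operators do not see
the states below the region. One-body operators and the identity both fit, which gives
first and second moments from one argument. *)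
Record ladder (B : nat) (A : nat -> nat -> op) : Prop := Ladder {
  ladder_add : forall a b phi1 phi2 l,
    A a b (fun m => phi1 m + phi2 m) l = A a b phi1 l + A a b phi2 l;
  ladder_antisym : forall a b phi, antisym phi -> antisym (A a b phi);
  ladder_above : forall a b phi, (a <= B)%N -> (b <= B)%N -> above phi -> above (A a b phi);
  ladder_local : forall a b phi, (a <= B)%N -> (b <= B)%N ->
    (forall l, (forall i, - N%:Z <= l i) -> phi l = 0) ->
    forall l, (forall i, - N%:Z <= l i) -> A a b phi l = 0;
  ladder_U : forall a b phi l, A a b (U phi) l = U (A a b phi) l + A a.+1 b phi l;
  ladder_D : forall a b phi l, D (A a b phi) l = A a b (D phi) l + A a b.+1 phi l }.

(** The first index counts the commutators with [U], the second those with [D]. *)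
Definition hops f a b : op := hop (a%:Z - b%:Z) (iter_diff a b f).

(** By [hop_comm], commuting with [U] or [D], whose weight is constant, replaces the weight
by its difference. The support of the weight grows by one site at each commutator with
[D]; it stays in the region as long as [L + B <= N]. *)
Lemma ladder_hops B L f : (forall x, x < - L%:Z -> f x = 0) -> (L + B <= N)%N ->
  ladder B (hops f).
Proof.
move=> fL LB; split.
- by move=> a b phi1 phi2 l; rewrite /hops hopD.
- by move=> a b phi; exact: antisym_hop.
- move=> a b phi aB bB ab l [i li]; rewrite /hops /hop big1// => j _.
  have [h|h] := ltP (l j) (- L%:Z - b%:Z); first by rewrite (iter_diff_supp _ fL)// mul0r.
  rewrite ab ?mulr0//; exists i; rewrite displace_neq//; apply: contraTneq li => ->.
  by rewrite -leNgt; lia.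
- move=> a b phi aB bB H l lN; rewrite /hops /hop big1// => j _.
  have [h|h] := ltP (l j) (- L%:Z - b%:Z); first by rewrite (iter_diff_supp _ fL)// mul0r.
  rewrite H ?mulr0// => i; have [->|ij] := eqVneq i j; last by rewrite displace_neq.
  by rewrite displace_eq; lia.
- move=> a b phi l; apply/eqP; rewrite addrC -subr_eq; apply/eqP.
  rewrite /hops /U hop_comm iter_diff_bdiff.
  rewrite (_ : (a.+1)%:Z - b%:Z = a%:Z - b%:Z + 1); last by lia.
  by apply: eq_bigr => j _; rewrite /bdiff mulr1 mul1r.
- move=> a b phi l; apply/eqP; rewrite addrC -subr_eq; apply/eqP.
  rewrite /hops /D hop_comm iter_diff_fdiff.
  rewrite (_ : a%:Z - (b.+1)%:Z = -1 + (a%:Z - b%:Z)); last by lia.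
  by apply: eq_bigr => j _; rewrite /fdiff mulr1 mul1r opprK.
Qed.

(** The identity commutes with everything, hence all its higher members vanish; it serves as
second factor for first moments. *)
Definition unit_ladder a b : op := fun phi l => if (a + b == 0)%N then phi l else 0.

Lemma ladder_unit B : ladder B unit_ladder.
Proof.
rewrite /unit_ladder; split => a b.
- by move=> phi1 phi2 l; case: ifP => _; rewrite ?addr0.
- by move=> phi H i j ij l; case: ifP => _; [exact: H|rewrite oppr0].
- by move=> phi _ _ H l il; case: ifP => // _; exact: H.
- by move=> phi _ _ H l il; case: ifP => // _; exact: H.
- move=> phi l; rewrite addSn addr0; case: ifP => // _.
  by rewrite /U /hop big1// => j _; rewrite mulr0.
- move=> phi l; rewrite addnS addr0; case: ifP => // _.
  by rewrite /D /hop big1// => j _; rewrite mulr0.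
Qed.

Lemma D_vac l : (forall i, - N%:Z <= l i) -> D (vac (R := R)) l = 0.
Proof. exact: hop_vac. Qed.

Section descent.
Variables (n : nat) (A A' : nat -> nat -> op).
Hypotheses (LA : ladder n A) (LA' : ladder n A') (nN : (n <= N)%N).

(** [i] is the level still to be descended with [D] and [j] the number of [U] still to be
moved. *)
Let P (i j a b c d : nat) : R := std_sum i (A a b (A' c d (phin j))).

Let P_U (i j a b c d : nat) : (i <= n)%N -> (a + c + j < n)%N -> (b <= n)%N -> (d <= n)%N ->
  P i j.+1 a b c d =
    i%:R * P i.-1 j a b c d + (P i j a.+1 b c d + P i j a b c.+1 d).
Proof.
move=> iN acB bB dB; rewrite /P.
have an := antisym_phin (R := R) (N := N) j.
have ab := above_phin (R := R) (N := N) j.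
have [aB cB] : (a <= n)%N /\ (c <= n)%N by lia.
have an2 := ladder_antisym LA a b (ladder_antisym LA' c d an).
have ab2 := ladder_above LA aB bB (ladder_above LA' cB dB ab).
rewrite /phin iterS -/(phin j).
have -> : A a b (A' c d (U (phin j))) = (fun l =>
    (U (A a b (A' c d (phin j))) l + (A a.+1 b (A' c d (phin j)) l
       + A a b (A' c.+1 d (phin j)) l))).
  apply/funext => l.
  have -> : A' c d (U (phin j)) = (fun l => U (A' c d (phin j)) l + A' c.+1 d (phin j) l).
    by apply/funext => m; rewrite (ladder_U LA').
  by rewrite (ladder_add LA) (ladder_U LA) addrA.
rewrite !std_sumD; congr (_ + _).
case: i iN => [|i] iN; first by rewrite std_sum0_U// mul0r.
by rewrite std_sum_U//; lia.
Qed.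

Let P_D (i a b c d : nat) : (i < n)%N -> (b + d + i < n)%N -> (a <= n)%N -> (c <= n)%N ->
  P i.+1 0 a b c d = P i 0 a b.+1 c d + P i 0 a b c d.+1.
Proof.
move=> iN bdB aB cB; rewrite /P /=.
have [bB dB] : (b <= n)%N /\ (d <= n)%N by lia.
rewrite std_sum_D; [|lia|exact: (ladder_antisym LA a b (ladder_antisym LA' c d antisym_vac))].
have -> : D (A a b (A' c d vac)) = (fun l =>
    A a b (A' c d (D vac)) l + (A a b.+1 (A' c d vac) l + A a b (A' c d.+1 vac) l)).
  apply/funext => l; rewrite (ladder_D LA).
  have -> : D (A' c d vac) = (fun l => A' c d (D vac) l + A' c d.+1 vac l).
    by apply/funext => m; rewrite (ladder_D LA').
  by rewrite (ladder_add LA); ring.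
rewrite !std_sumD -[RHS]add0r; congr (_ + _).
rewrite (@eq_std_sum _ _ _ _ (fun=> 0)); first by rewrite /std_sum big1// => la _; rewrite mulr0.
by apply: (ladder_local LA aB bB) => l; apply: (ladder_local LA' cB dB); exact: D_vac.
Qed.

(** First all [U] are moved to the left of [A] and [A'], where they lower the level, then
the remaining level is descended by [D], which is moved to the right until it kills the
vacuum. What is left are vacuum expectations. *)
Lemma ladder_descent :
  std_sum n (A 0%N 0%N (A' 0%N 0%N (phin n))) =
  \sum_(k < n.+1) 'C(n, k)%:R * (n ^_ (n - k))%:R *
    \sum_(u < k.+1) \sum_(v < k.+1) 'C(k, u)%:R * 'C(k, v)%:R *
      A u v (A' (k - u) (k - v) vac)%N sea.
Proof.
rewrite -/(P n n 0 0 0 0).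
rewrite (@creation_descent _ (fun x y a c => P x y a 0 c 0)%N n n); [|by move=> *; exact: P_U|lia..].
apply: eq_bigr => k _; congr (_ * _); apply: eq_bigr => u _.
have kn := ltn_ord k; have uk := ltn_ord u.
rewrite (_ : n - (n - k) = k)%N; last by lia.
rewrite (@annihilation_descent _ (fun x b d => P x 0 (0 + u) b (0 + (k - u)) d)%N n n);
  [|move=> *; apply: P_D; lia|lia..].
rewrite big_distrr; apply: eq_bigr => v _ /=.
by rewrite /P std_sum0 /= !add0n mulrA.
Qed.

End descent.

Lemma hop0E f phi l : hop 0 f phi l = (\sum_(j < N) f (l j)) * phi l.
Proof. by rewrite big_distrl; apply: eq_bigr => j _; rewrite displace0. Qed.

Lemma sum_sea (h : int -> R) : \sum_(j < N) h (sea j) = \sum_(0 <= p < N) h (- p%:Z - 1).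
Proof. by rewrite big_mkord. Qed.

(** The product in the opposite order vanishes by [hop_vac], so the value is that of the
commutator, a one-body operator of degree 0 evaluated on the sea. Its weight is a
difference of two translates, whence the sum over the sea telescopes to the [m] highest
sites. *)
Lemma vac_two_point B f g L L' a b c d (m : nat) :
  (forall x, x < - L%:Z -> f x = 0) -> (L + B <= N)%N ->
  (forall x, x < - L'%:Z -> g x = 0) -> (L' + B <= N)%N ->
  (a <= B)%N -> (b <= B)%N -> (c <= B)%N -> (d <= B)%N ->
  (a + m = b)%N -> (d + m = c)%N -> (0 < m)%N ->
  hops f a b (hops g c d vac) sea =
  \sum_(0 <= p < m) iter_diff a b f (- p%:Z - 1) * iter_diff c d g (- p%:Z - 1 + m%:Z).
Proof.
move=> fL LB gL LB' aB bB cB dB am dm m0.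
have LA' := ladder_hops gL LB'.
have := hop_comm (a%:Z - b%:Z) (c%:Z - d%:Z) (iter_diff a b f) (iter_diff c d g) vac (sea (N := N)).
rewrite -/(hops f a b _) -/(hops g c d _) -/(hops f a b _) -/(hops g c d _).
rewrite [X in _ - X = _](_ : _ = 0) => [|]; last first.
  apply: (ladder_local LA') => //; last by move=> i; rewrite /sea; have := ltn_ord i; lia.
  move=> l lN; rewrite /hops (_ : a%:Z - b%:Z = - m%:Z); last by lia.
  by apply: hop_vac => //; lia.
rewrite subr0 => ->; rewrite (_ : a%:Z - b%:Z + (c%:Z - d%:Z) = 0); last by lia.
(* The weight of the commutator is kap at x minus kap at x - m. *)
pose kap (x : int) := iter_diff a b f x * iter_diff c d g (x + m%:Z).
rewrite hop0E vac_sea mulr1 (sum_sea (fun x => iter_diff a b f x * iter_diff c d g (x - (a%:Z - b%:Z))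
  - iter_diff c d g x * iter_diff a b f (x - (c%:Z - d%:Z)))).
under eq_bigr => p _.
  rewrite (_ : _ - _ = kap (- p%:Z - 1) - kap (- (p + m)%N%:Z - 1)); last first.
    rewrite /kap; congr (_ * iter_diff c d g _ - _); first by lia.
    by rewrite mulrC; congr (iter_diff _ _ _ _ * iter_diff _ _ _ _); lia.
  over.
have mN : (m <= N)%N by lia.
rewrite /= sumrB [X in X - _](big_cat_nat (n := m))//=.
rewrite -addrA -[RHS]addr0; congr (_ + _).
apply/eqP; rewrite subr_eq0; apply/eqP.
rewrite -[in RHS](add0n m) in |- *.
rewrite [in RHS](_ : \sum_(0 <= p < N) kap (- (p + m)%N%:Z - 1) =
   \sum_(0 <= p < N - m) kap (- (p + m)%N%:Z - 1)).
  by rewrite -[X in index_iota X _](add0n m) big_addn.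
rewrite (big_cat_nat (n := N - m)%N) ?leq_subr//= [X in _ + X]big1_seq ?addr0// => p.
rewrite mem_index_iota => /andP[_ /andP[pN _]].
by rewrite /kap (iter_diff_supp _ fL) ?mul0r//; lia.
Qed.

(** Here the operator next to the vacuum is of the kind that kills it. *)
Lemma vac_two_point0 B f g L L' a b c d :
  (forall x, x < - L%:Z -> f x = 0) -> (L + B <= N)%N ->
  (forall x, x < - L'%:Z -> g x = 0) -> (L' + B <= N)%N ->
  (a <= B)%N -> (b <= B)%N -> (c <= B)%N -> (d <= B)%N ->
  (a + c = b + d)%N -> (b < a)%N ->
  hops f a b (hops g c d vac) sea = 0.
Proof.
move=> fL LB gL LB' aB bB cB dB e ba.
have LA := ladder_hops fL LB.
apply: (ladder_local LA) => //; last by move=> i; rewrite /sea; have := ltn_ord i; lia.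
move=> l lN; rewrite /hops (_ : c%:Z - d%:Z = - (a%:Z - b%:Z)); last by lia.
by apply: hop_vac => //; lia.
Qed.

(** The vacuum expectation of the [k]-th member of the ladder of [f]. *)
Definition mean_coef f k : R := \sum_(0 <= p < N) iter_diff k k f (- p%:Z - 1).

(** The connected part of the vacuum two-point function; the disconnected part is the
product of two [mean_coef]. *)
Definition pair_coef f g k u v : R :=
  \sum_(0 <= p < v - u) iter_diff u v f (- p%:Z - 1) *
     iter_diff (k - u) (k - v) g (- p%:Z - 1 + (v - u)%N%:Z).

Lemma level_mean f L n : (forall x, x < - L%:Z -> f x = 0) -> (L + n <= N)%N ->
  \sum_(la <- level_seq n) #|Std la|%:R ^+ 2 * \sum_(j < N) f (conf la j) =
  \sum_(k < n.+1) 'C(n, k)%:R * (n ^_ (n - k))%:R * mean_coef f k.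
Proof.
move=> fL LN; have nN : (n <= N)%N by lia.
have := ladder_descent (ladder_hops fL LN) (ladder_unit n) nN.
rewrite /unit_ladder /= {1}/hops subrr => E.
transitivity (std_sum n (hop 0 (iter_diff 0 0 f) (phin (R := R) (N := N) n))).
  apply: eq_big_seq => la; rewrite mem_level_seq => /eqP Pla.
  (* One factor #Std la is the value of U^n vac, the other one the weight in std_sum. *)
  by rewrite hop0E phin_conf// expr2 -mulrA; congr (_ * _); rewrite mulrC.
rewrite E; apply: eq_bigr => k _; congr (_ * _).
rewrite big_ord_recr big_ord_recr /= !binn !subnn addn0 eqxx mul1r mul1r.
rewrite /hops subrr hop0E vac_sea mulr1 sum_sea -[RHS]add0r; congr (_ + _).
  rewrite big1 // => u _; rewrite big1// => v _.
  have h : (k - u + (k - v) == 0)%N = false by have := ltn_ord u; lia.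
  rewrite (_ : (fun=> _) = (fun=> 0)); last by apply/funext => l; rewrite h.
  by rewrite /hop big1 ?mulr0// => j _; rewrite mulr0.
rewrite big1 ?add0r// => v _.
have h : (k - v == 0)%N = false by have := ltn_ord v; lia.
rewrite (_ : (fun=> _) = (fun=> 0)); last by apply/funext => l; rewrite h.
by rewrite /hop big1 ?mulr0// => j _; rewrite mulr0.
Qed.

(** Among the pairs [u], [v] of the descent, [u = v] gives the product of means, [u < v] the
two-point function, and [v < u] nothing. *)
Lemma level_pair f g L L' n :
  (forall x, x < - L%:Z -> f x = 0) -> (L + n <= N)%N ->
  (forall x, x < - L'%:Z -> g x = 0) -> (L' + n <= N)%N ->
  \sum_(la <- level_seq n) #|Std la|%:R ^+ 2 *
     ((\sum_(j < N) f (conf la j)) * (\sum_(j < N) g (conf la j))) =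
  \sum_(k < n.+1) 'C(n, k)%:R * (n ^_ (n - k))%:R *
    (\sum_(u < k.+1) 'C(k, u)%:R ^+ 2 * (mean_coef f u * mean_coef g (k - u)) +
     \sum_(u < k.+1) \sum_(v < k.+1 | (u < v)%N) 'C(k, u)%:R * 'C(k, v)%:R *
       pair_coef f g k u v).
Proof.
move=> fL LN gL LN'; have nN : (n <= N)%N by lia.
have := ladder_descent (ladder_hops fL LN) (ladder_hops gL LN') nN.
rewrite {1 2}/hops !subrr => E.
transitivity (std_sum n (hop 0 (iter_diff 0 0 f) (hop 0 (iter_diff 0 0 g) (phin (R := R) (N := N) n)))).
  apply: eq_big_seq => la; rewrite mem_level_seq => /eqP Pla.
  by rewrite !hop0E phin_conf// expr2 /iter_diff /=; ring.
rewrite E; apply: eq_bigr => k _; congr (_ * _).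
rewrite -big_split; apply: eq_bigr => u _ /=.
have kn := ltn_ord k; have uk := ltn_ord u.
rewrite (bigD1 u)//=; congr (_ + _).
  by rewrite /hops !subrr !hop0E vac_sea mulr1 !sum_sea expr2.
rewrite (bigID (fun v : 'I_k.+1 => u < v)%N) /= [X in _ + X]big1 ?addr0.
  apply: eq_big => [v|v]; first by rewrite -val_eqE /=; lia.
  move=> /andP[_ uv]; congr (_ * _); have vk := ltn_ord v.
  by rewrite (vac_two_point (B := n) (m := v - u) fL LN gL LN')//; lia.
move=> v /andP[vu uv]; rewrite (vac_two_point0 (B := n) fL LN gL LN') ?mulr0//; try lia.
by move: vu uv; rewrite -val_eqE /=; lia.
Qed.

End families.

(** * Linear statistics, residue counts and waves *)

Section linear_statistics.
Context {R : realType}.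
Implicit Types (f g : int -> R) (la : intpart).

(** The sum of [f] over the Maya diagram of [la], regularised by subtracting the sum over
the sea; it is finite since only the rows of [la] differ from the sea. *)
Definition linstat f la : R :=
  \sum_(0 <= j < size la) (f ((nth 0%N la j)%:Z - j%:Z - 1) - f (- j%:Z - 1)).

Lemma linstat_sum (I : Type) (r : seq I) (c : I -> R) (F : I -> int -> R) la :
  linstat (fun x => \sum_(a <- r) c a * F a x) la = \sum_(a <- r) c a * linstat (F a) la.
Proof.
rewrite /linstat; under eq_bigr do rewrite -sumrB.
rewrite exchange_big; apply: eq_bigr => a _; rewrite big_distrr.
by apply: eq_bigr => j _; rewrite /= mulrBr.
Qed.

Lemma linstat_bound f (C : R) la : (forall x, `|f x| <= C) ->
  `|linstat f la| <= 2 * C * (psize la)%:R.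
Proof.
move=> fC; have C0 : 0 <= C by apply: le_trans (fC 0).
apply: le_trans (ler_norm_sum _ _ _) _.
apply: (@le_trans _ _ (\sum_(0 <= j < size la) 2 * C)).
  apply: ler_sum => j _; apply: le_trans (ler_normB _ _) _.
  by rewrite mulr_natl mulr2n lerD.
rewrite big_mkord sumr_const card_ord -[leLHS]mulr_natr ler_wpM2l ?mulr_ge0//.
by rewrite ler_nat size_le_psize.
Qed.

(** A linear statistic must be written as a sum over [N] particles of a function that
vanishes far below. The compensating value is put on the site -L-1, which the particles
of partitions of size at most [L] leave occupied, so that the sum over the sea is 0 and
the plain sum over the particles is already normalised. *)
Definition cutoff f (L : nat) : int -> R := fun x =>
  if - L%:Z <= x then f x
  else if x == - L%:Z - 1 then - \sum_(0 <= p < L) f (- p%:Z - 1) else 0.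

Lemma cutoff_supp f L x : x < - (L.+1)%:Z -> cutoff f L x = 0.
Proof.
move=> xL; rewrite /cutoff; case: ifPn => [h|_]; first by lia.
by case: eqP => // h; lia.
Qed.

Lemma cutoffE f (L : nat) (x : int) : - L%:Z <= x -> cutoff f L x = f x.
Proof. by rewrite /cutoff => ->. Qed.

Lemma cutoff_sea f L N : (L < N)%N ->
  \sum_(0 <= p < N) cutoff f L (- p%:Z - 1) = 0.
Proof.
move=> LN; rewrite (big_cat_nat (n := L.+1))//= [X in _ + X]big1_seq ?addr0; last first.
  move=> p; rewrite mem_index_iota => /andP[_ /andP[pL _]].
  by rewrite cutoff_supp//; lia.
rewrite big_nat_recr//= {2}/cutoff ifF; last by lia.
rewrite eqxx (eq_big_nat _ _ (F2 := fun p => f (- p%:Z - 1))) ?subrr// => p pL.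
by rewrite cutoffE//; lia.
Qed.

Lemma linstat_cutoff f L N la : (psize la <= L)%N -> (L < N)%N ->
  \sum_(j < N) cutoff f L (conf la j) = linstat f la.
Proof.
move=> laL LN; have sL := leq_trans (size_le_psize la) laL.
(* The sum over the sea is 0, hence may be subtracted particle by particle. *)
have E := cutoff_sea f LN; rewrite big_mkord in E.
rewrite -[LHS]subr0 -[X in _ - X]E -sumrB.
rewrite /linstat -(big_mkord predT (fun j =>
  cutoff f L ((nth 0%N la j)%:Z - j%:Z - 1) - cutoff f L (- j%:Z - 1))).
rewrite (big_cat_nat (n := size la))//=; last by lia.
rewrite [X in _ + X]big1_seq ?addr0 => [|p]; last first.
  rewrite mem_index_iota => /andP[_ /andP[pL _]].
  by rewrite nth_default// sub0r subrr.
apply: eq_big_nat => p pL; rewrite !cutoffE//; lia.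
Qed.

Lemma iter_diff_local a b f g x : (forall y, x - a%:Z <= y -> f y = g y) ->
  iter_diff a b f x = iter_diff a b g x.
Proof.
elim: b x => [|b IH] x H; last by rewrite !iter_diff_fdiff /fdiff !IH// => y h; apply: H; lia.
rewrite /iter_diff /=; elim: a x H => [|a IH] x H; first by apply: H; lia.
by rewrite !iterS /bdiff !IH// => y h; apply: H; lia.
Qed.

(** The sum over the sea of an exact difference is its boundary value at the top of the sea. *)
Definition mean_term f k : R := if k is k'.+1 then iter_diff k k' f 0 else 0.

(** Telescoping leaves the value at the top of the sea; the value at the bottom is 0, out of
reach of the support of the cut-off function. *)
Lemma mean_coef_cutoff f L N k : (k <= L)%N -> (L.+1 + k <= N)%N ->
  mean_coef (N := N) (cutoff f L) k = mean_term f k.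
Proof.
move=> kL LN; rewrite /mean_coef; case: k kL LN => [|k] kL LN.
  by rewrite cutoff_sea//; lia.
rewrite iter_diff_fdiff /fdiff (telescope_sumr_eq (fun p : nat =>
  - iter_diff k.+1 k (cutoff f L) (- p%:Z))) //; last first.
  move=> p _; rewrite opprK [RHS]addrC; congr (iter_diff _ _ _ _ - iter_diff _ _ _ _); lia.
rewrite (iter_diff_supp _ (L := - (L.+1)%:Z)); [|by move=> x; exact: cutoff_supp|lia].
rewrite oppr0 opprK add0r /mean_term.
by apply: iter_diff_local => y h; rewrite cutoffE//; lia.
Qed.

Lemma pair_coef_cutoff f g L k u v : (u <= v)%N -> (v <= k)%N -> (k <= L)%N ->
  pair_coef (cutoff f L) (cutoff g L) k u v = pair_coef f g k u v.
Proof.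
move=> uv vk kL; apply: eq_big_nat => p pv.
by congr (_ * _); apply: iter_diff_local => y h; rewrite cutoffE//; lia.
Qed.

Lemma level_linstat f n :
  \sum_(la <- level_seq n) #|Std la|%:R ^+ 2 * linstat f la =
  \sum_(k < n.+1) 'C(n, k)%:R * (n ^_ (n - k))%:R * mean_term f k.
Proof.
have nN : (n.+1 + n <= n.+1 + n)%N by [].
rewrite -[RHS](_ : \sum_(k < n.+1) 'C(n, k)%:R * (n ^_ (n - k))%:R *
  mean_coef (N := (n.+1 + n)%N) (cutoff f n) k = _); last first.
  by apply: eq_bigr => k _; rewrite mean_coef_cutoff//; have := ltn_ord k; lia.
rewrite -(level_mean (L := n.+1) _ nN); last by move=> x; exact: cutoff_supp.
apply: eq_big_seq => la; rewrite mem_level_seq => /eqP Pla.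
by rewrite linstat_cutoff ?Pla//; lia.
Qed.

Lemma level_linstat2 f g n :
  \sum_(la <- level_seq n) #|Std la|%:R ^+ 2 * (linstat f la * linstat g la) =
  \sum_(k < n.+1) 'C(n, k)%:R * (n ^_ (n - k))%:R *
    (\sum_(u < k.+1) 'C(k, u)%:R ^+ 2 * (mean_term f u * mean_term g (k - u)) +
     \sum_(u < k.+1) \sum_(v < k.+1 | (u < v)%N) 'C(k, u)%:R * 'C(k, v)%:R *
       pair_coef f g k u v).
Proof.
have nN : (n.+1 + n <= n.+1 + n)%N by [].
transitivity (\sum_(la <- level_seq n) #|Std la|%:R ^+ 2 *
  ((\sum_(j < n.+1 + n) cutoff f n (conf la j)) *
   (\sum_(j < n.+1 + n) cutoff g n (conf la j)))).
  apply: eq_big_seq => la; rewrite mem_level_seq => /eqP Pla.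
  by rewrite !linstat_cutoff ?Pla//; lia.
rewrite (level_pair (L := n.+1) (L' := n.+1) _ nN _ nN); try by move=> x; exact: cutoff_supp.
apply: eq_bigr => k _; congr (_ * (_ + _)).
  apply: eq_bigr => u _; congr (_ * (_ * _)); rewrite mean_coef_cutoff//;
    have := ltn_ord k; have := ltn_ord u; lia.
apply: eq_bigr => u _; apply: eq_bigr => v uv; congr (_ * _).
by rewrite pair_coef_cutoff//; have := ltn_ord k; have := ltn_ord v; lia.
Qed.

(** Along a row the difference of the indicators of two consecutive residues telescopes,
leaving the positions of the end of the row and of its beginning. *)
Lemma res_diff_linstat e (i : 'Z_e) la :
  res_diff i la = linstat (fun x => (x%:~R == i)%:R) la.
Proof.
have countE (k : 'Z_e) : (res_count k la)%:R =
    \sum_(a < size la) \sum_(b < nth 0%N la a) ((b%:Z - a%:Z)%:~R == k)%:R :> R.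
  rewrite /res_count -sum1_card natr_sum big_mkcond /=.
  rewrite sig_big_dep /=; apply: eq_bigr => u _.
  rewrite inE /residue /node_col /node_row rmorphB /= !pmulrn.
  by case: eqP.
rewrite /res_diff !countE -sumrB /linstat big_mkord; apply: eq_bigr => a _.
rewrite -sumrB -(big_mkord predT (fun b : nat => ((b%:Z - a%:Z)%:~R == i)%:R -
  ((b%:Z - a%:Z)%:~R == i + 1)%:R)).
rewrite (telescope_sumr_eq
   (fun b : nat => ((b%:Z - a%:Z - 1)%:~R == i)%:R)) ?sub0r// => b _.
congr (_%:R - _%:R).
  by congr (nat_of_bool (_%:~R == _)); lia.
by rewrite [in RHS]rmorphB /= subr_eq.
Qed.

Definition wave (th al : R) : int -> R := fun x => cos (th * x%:~R + al).

Lemma wave_bound th al x : `|wave th al x| <= 1.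
Proof. by rewrite ler_norml cos_geN1 cos_le1. Qed.

(** By the product formula, a difference of a cosine over a unit step is again a cosine,
scaled by 2 sin (th/2) and turned by a quarter; this is why waves are the right basis. *)
Lemma bdiff_wave c th al :
  bdiff (fun x => c * wave th al x) =
  fun x => c * (2 * sin (th / 2)) * wave th (al - th / 2 + pi / 2) x.
Proof.
apply/funext => x; rewrite /bdiff /wave -mulrBr -mulrA; congr (_ * _).
rewrite rmorphB /=; set B := th * x%:~R + al - th / 2.
rewrite [X in cos X - _](_ : _ = B + th / 2); last by rewrite /B; field.
rewrite [X in _ - cos X](_ : _ = B - th / 2); last by rewrite /B; field.
rewrite [X in _ * cos X](_ : _ = B + pi / 2); last by rewrite /B; ring.
by rewrite !cosD sinN cosN cos_pihalf sin_pihalf; ring.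
Qed.

Lemma fdiff_wave c th al :
  fdiff (fun x => c * wave th al x) =
  fun x => c * (2 * sin (th / 2)) * wave th (al + th / 2 + pi / 2) x.
Proof.
apply/funext => x; rewrite /fdiff /wave -mulrBr -mulrA; congr (_ * _).
rewrite rmorphD /=; set B := th * x%:~R + al + th / 2.
rewrite [X in cos X - _](_ : _ = B + th / 2); last by rewrite /B; field.
rewrite [X in _ - cos X](_ : _ = B - th / 2); last by rewrite /B; field.
rewrite [X in _ * cos X](_ : _ = B + pi / 2); last by rewrite /B; ring.
by rewrite !cosD sinN cosN cos_pihalf sin_pihalf; ring.
Qed.

Lemma iter_diff_wave a b th al :
  iter_diff a b (wave th al) = fun x => (2 * sin (th / 2)) ^+ (a + b) *
    wave th (al + (b%:R - a%:R) * (th / 2) + (a + b)%:R * (pi / 2)) x.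
Proof.
elim: b => [|b IH].
  elim: a => [|a IH].
    by apply/funext => x; rewrite expr0 mul1r; congr wave; ring.
  rewrite iter_diff_bdiff IH bdiff_wave; apply/funext => x; rewrite !addn0 -exprSr.
  by congr (_ * wave _ _ _); rewrite -natr1; ring.
rewrite iter_diff_fdiff IH fdiff_wave; apply/funext => x; rewrite addnS -exprSr.
by congr (_ * wave _ _ _); rewrite -natr1 -[in RHS]natr1; ring.
Qed.

End linear_statistics.

(** * Dominated convergence and Cauchy products of series *)

Section series_lemmas.
Context {R : realType}.
Implicit Types (a : nat -> nat -> R) (b f g M : nat -> R).

Lemma cvg_sum_nat {T : Type} {F : set_system T} {FF : Filter F} (u : T -> nat -> R)
    (v : nat -> R) K : (forall k, (k < K)%N -> u x k @[x --> F] --> v k) ->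
  (\sum_(0 <= k < K) u x k) @[x --> F] --> \sum_(0 <= k < K) v k.
Proof.
elim: K => [|K IH] h.
  under eq_fun do rewrite big_geq//; rewrite big_geq//; exact: cvg_cst.
under eq_fun do rewrite big_nat_recr//=; rewrite big_nat_recr//=.
by apply: cvgD; [apply: IH => k kK; apply: h; lia|exact: h].
Qed.

(** Dominated convergence for sums whose range grows together with the parameter. *)
Lemma tannery a b M : (forall n k, `|a n k| <= M k) -> cvgn (series M) ->
  (forall k, a n k @[n --> \oo] --> b k) ->
  cvgn (series b) /\
  (\sum_(0 <= k < n) a n k) @[n --> \oo] --> limn (series b).
Proof.
move=> aM cM ab.
have M0 k : 0 <= M k by apply: le_trans (aM 0%N k).
have bM k : `|b k| <= M k.
  have h : `|a n k| @[n --> \oo] --> `|b k| by exact: cvg_norm.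
  rewrite -(cvg_lim _ h)//.
  by apply: limr_le; [apply/cvg_ex; eexists; exact: h|exact: nearW].
have ndM : nondecreasing_seq (series M) by apply: nondecreasing_series => *.
have Mle n : series M n <= limn (series M) by exact: nondecreasing_cvgn_le.
have cnb : cvgn (series (fun k => `|b k|)) by apply: (series_le_cvg _ _ bM).
have cb : cvgn (series b) by exact: normed_cvg.
split=> //.
have tailM K n (c : nat -> R) : (forall k, `|c k| <= M k) -> (K <= n)%N ->
    `|\sum_(K <= k < n) c k| <= limn (series M) - series M K.
  move=> cM' Kn; apply: le_trans (ler_norm_sum _ _ _) _.
  apply: (@le_trans _ _ (\sum_(K <= k < n) M k)); first by apply: ler_sum => k _.
  by rewrite -sub_series_geq// lerD2r.
have tailb K : `|limn (series b) - series b K| <= limn (series M) - series M K.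
  have h : `|series b n - series b K| @[n --> \oo] --> `|limn (series b) - series b K|.
    by apply: cvg_norm; apply: cvgB => //; exact: cvg_cst.
  rewrite -(cvg_lim _ h)//; apply: limr_le; first by apply/cvg_ex; eexists; exact: h.
  by near=> n; rewrite sub_series_geq; [apply: tailM|]; near: n; exists K.
apply/cvgrPdist_le => e e0; have e3 : 0 < e / 3 by rewrite divr_gt0.
have [K HK] : exists K, limn (series M) - series M K <= e / 3.
  have [K _ /(_ K (leqnn K))] := (cvgrPdist_le _ _).1 cM _ e3.
  by rewrite /= ger0_norm ?subr_ge0// => h; exists K.
have := (cvgrPdist_le _ _).1 (@cvg_sum_nat _ _ _ _ _ K (fun k _ => ab k)) _ e3 => HK2.
near=> n; have Kn : (K <= n)%N by near: n; exists K.
have h : `|\sum_(0 <= k < K) b k - \sum_(0 <= k < K) a n k| <= e / 3.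
  by near: n; exact: HK2.
rewrite (big_cat_nat (n := K))//=.
have h1 := tailb K; have h2 := tailM K n (a n) (aM n) Kn.
rewrite (_ : _ - _ = (limn (series b) - series b K) +
   (\sum_(0 <= k < K) b k - \sum_(0 <= k < K) a n k) - \sum_(K <= k < n) a n k);
  last by rewrite /series /=; ring.
apply: le_trans (ler_normB _ _) _.
apply: le_trans (lerD (ler_normD _ _) (lexx _)) _.
rewrite [leRHS](_ : _ = e / 3 + e / 3 + e / 3); last by field.
by apply: lerD; [apply: lerD => //; exact: le_trans h1 HK|exact: le_trans h2 HK].
Unshelve. all: by end_near. Qed.

Lemma series_triangle (G : nat -> nat -> R) K :
  \sum_(0 <= p < K) \sum_(0 <= r < p.+1) G r (p - r)%N =
  \sum_(0 <= r < K) series (G r) (K - r)%N.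
Proof.
elim: K => [|K IH]; first by rewrite !big_geq.
rewrite big_nat_recr//= IH [RHS]big_nat_recr//= subSnn {3}/series /= big_nat1.
rewrite [\sum_(0 <= r < K.+1) G _ _]big_nat_recr//= subnn addrA; congr (_ + _).
rewrite -big_split; apply: eq_big_nat => r rK /=.
by rewrite subSn ?seriesSr//; lia.
Qed.

Definition cauchy_prod f g n : R := \sum_(k < n.+1) f k * g (n - k)%N.

(** The partial sums are regrouped by the index of the first factor, which is the form to
which [tannery] applies. *)
Lemma series_cauchy_prod f g n :
  series (cauchy_prod f g) n = \sum_(0 <= k < n) f k * series g (n - k)%N.
Proof.
rewrite /series /= /cauchy_prod.
elim: n => [|n IH]; first by rewrite !big_geq.
rewrite big_nat_recr//= IH -(big_mkord xpredT (fun k => f k * g (n - k)%N)).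
rewrite [RHS]big_nat_recr//= subSnn big_nat1 [\sum_(0 <= k < n.+1) _]big_nat_recr//=.
rewrite subnn addrA; congr (_ + _); rewrite -big_split.
apply: eq_big_nat => k kn /=; rewrite -mulrDr subSn; last by lia.
by rewrite big_nat_recr.
Qed.

Lemma series_cauchy_prod_bound (f g : nat -> R) (F G : R) n :
  (forall n, series (fun i => `|f i|) n <= F) ->
  (forall n, series (fun i => `|g i|) n <= G) ->
  `|series (cauchy_prod f g) n| <= F * G.
Proof.
move=> fF gG; rewrite series_cauchy_prod.
have G0 : 0 <= G by apply: le_trans (gG 0%N); rewrite /series /= big_geq.
apply: le_trans (ler_norm_sum _ _ _) _.
apply: (@le_trans _ _ (\sum_(0 <= k < n) `|f k| * G)); last first.
  by rewrite -big_distrl ler_wpM2r//; exact: fF.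
apply: ler_sum => k _; rewrite normrM ler_wpM2l//.
by apply: le_trans (gG (n - k)%N); exact: ler_norm_sum.
Qed.

Lemma series_norm_cauchy_prod_bound (f g : nat -> R) (F G : R) n :
  (forall n, series (fun i => `|f i|) n <= F) ->
  (forall n, series (fun i => `|g i|) n <= G) ->
  series (fun i => `|cauchy_prod f g i|) n <= F * G.
Proof.
move=> fF gG.
apply: (@le_trans _ _ (series (cauchy_prod (fun i => `|f i|) (fun i => `|g i|)) n)).
  apply: ler_sum => k _; apply: le_trans (ler_norm_sum _ _ _) _.
  by apply: ler_sum => i _; rewrite normrM.
apply: le_trans (ler_norm _) _; apply: series_cauchy_prod_bound => k.
  by under eq_fun do rewrite normr_id.
by under eq_fun do rewrite normr_id.
Qed.

Lemma norm_series_le f n : cvgn (series (fun k => `|f k|)) ->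
  `|series f n| <= limn (series (fun k => `|f k|)).
Proof.
move=> cf; apply: le_trans (ler_norm_sum _ _ _) _.
apply: (nondecreasing_cvgn_le _ cf).
by apply: nondecreasing_series => *.
Qed.

Lemma cvg_series_cauchy_prod f g :
  cvgn (series (fun k => `|f k|)) -> cvgn (series (fun k => `|g k|)) ->
  series (cauchy_prod f g) @ \oo --> limn (series f) * limn (series g).
Proof.
move=> cf cg; have cg' := normed_cvg cg; have cf' := normed_cvg cf.
pose a n k := f k * series g (n - k)%N.
have [] := @tannery a (fun k => f k * limn (series g))
  (fun k => `|f k| * limn (series (fun k => `|g k|))).
- move=> n k; rewrite normrM ler_wpM2l//; exact: norm_series_le.
- rewrite (_ : series _ = (fun n => series (fun k => `|f k|) n * limn (series (fun k => `|g k|)))).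
    by apply/cvg_ex; eexists; apply: cvgMr_tmp; exact: cf.
  by apply/funext => n; rewrite /series /= big_distrl.
- move=> k; apply: cvgMl_tmp; rewrite -(cvg_shiftn k) /=.
  by under eq_fun do rewrite addnK.
- move=> _ h; rewrite (_ : series (cauchy_prod f g) = (fun n => \sum_(0 <= k < n) a n k)).
    rewrite (_ : _ * _ = limn (series (fun k => f k * limn (series g))))//.
    rewrite (_ : series _ = (fun n => series f n * limn (series g))).
      by apply/esym/cvg_lim => //; exact: cvgMr_tmp.
    by apply/funext => n; rewrite /series /= big_distrl.
  by apply/funext => n; rewrite series_cauchy_prod.
Qed.

Lemma is_cvg_series_norm_cauchy_prod f g :
  cvgn (series (fun k => `|f k|)) -> cvgn (series (fun k => `|g k|)) ->
  cvgn (series (fun n => `|cauchy_prod f g n|)).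
Proof.
move=> cf cg.
have h : cvgn (series (cauchy_prod (fun k => `|f k|) (fun k => `|g k|))).
  apply/cvg_ex; eexists; apply: cvg_series_cauchy_prod.
    by under eq_fun do rewrite normr_id.
  by under eq_fun do rewrite normr_id.
apply: series_le_cvg h => [//|n|n].
- by apply: sumr_ge0 => k _; rewrite mulr_ge0.
- by apply: le_trans (ler_norm_sum _ _ _) _; apply: ler_sum => k _; rewrite normrM.
Qed.

(** Summation of an absolutely convergent double array along its antidiagonals. *)
Lemma diag_sum (D : nat -> nat -> R) (B : nat -> R) :
  (forall m n, series (fun k => `|D m k|) n <= B m) -> cvgn (series B) ->
  cvgn (series (fun k => `|\sum_(m < k.+1) D m (k - m)%N|)) /\
  series (fun k => \sum_(m < k.+1) D m (k - m)%N) @ \oo -->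
    limn (series (fun m => limn (series (D m)))).
Proof.
move=> DB cB.
have main (E : nat -> nat -> R) : (forall m n, series (fun k => `|E m k|) n <= B m) ->
    series (fun k => \sum_(m < k.+1) E m (k - m)%N) @ \oo -->
        limn (series (fun m => limn (series (E m)))).
  move=> EB; have B0 m : 0 <= B m by apply: le_trans (EB m 0%N); rewrite /series /= big_geq.
  pose a n m := if (m < n)%N then series (E m) (n - m)%N else 0.
  have [||m|c1 c2] := @tannery a (fun m => limn (series (E m))) B.
  - move=> n m; rewrite /a; case: ifP => _; last by rewrite normr0.
    exact: le_trans (ler_norm_sum _ _ _) (EB m _).
  - exact: cB.
  - apply: (@cvg_trans _ ((fun n => series (E m) (n - m)%N) @ \oo)).
      by apply: near_eq_cvg; near=> n; rewrite /a ifT//; near: n; exists m.+1.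
    rewrite -(cvg_shiftn m) /=; under eq_fun do rewrite addnK.
    have cE : cvgn (series (fun k => `|E m k|)).
      apply: nondecreasing_is_cvgn; first by apply: nondecreasing_series => *.
      by exists (B m) => _ [n _ <-]; exact: EB.
    have h : cvgn (series (E m)) by exact: normed_cvg.
    exact: h.
  rewrite (_ : series _ = (fun n => \sum_(0 <= k < n) a n k))//.
  apply/funext => n; rewrite {1}/series /=.
  under eq_bigr do rewrite -(big_mkord xpredT (fun m => E m (_ - m)%N)).
  rewrite series_triangle; apply: eq_big_nat => m /andP[_ mn].
  by rewrite /a mn.
split; last exact: main.
have d2 := main (fun m k => `|D m k|).
have {}d2 : series (fun k => \sum_(m < k.+1) `|D m (k - m)%N|) @ \oo -->
    limn (series (fun m => limn (series (fun k => `|D m k|)))).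
  by apply: d2 => m n; under eq_fun do rewrite normr_id; exact: DB.
apply: (series_le_cvg (v_ := fun k => \sum_(m < k.+1) `|D m (k - m)%N|)) => //.
- by move=> k; exact: sumr_ge0.
- by move=> k; exact: ler_norm_sum.
- by apply/cvg_ex; eexists; exact: d2.
Unshelve. all: by end_near. Qed.

End series_lemmas.

(** * Poissonised expectations as series over the size *)

Section expectation_by_levels.
Context {R : realType}.
Implicit Types (t : R) (F : intpart -> R).

(** The Poissonised Plancherel probability of a partition of size [n] is this weight times
the square of its number of standard tableaux. *)
Definition level_weight t n : R := expR (- t) * (t ^+ n / n`!%:R ^+ 2).

Definition level_sum F n : R := \sum_(la <- level_seq n) #|Std la|%:R ^+ 2 * F la.

(** The identity of Frobenius and Young, sum of #Std la ^ 2 = n!. *)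
Lemma level_sum1 n : level_sum (fun=> 1) n = n`!%:R.
Proof.
have := @esum_card_Std R n; rewrite esum_fset; last 2 first.
- exact: finite_level.
- by move=> la _; rewrite lee_fin.
rewrite fsbig_finite; last exact: finite_level.
rewrite sumEFin => -[<-]; apply: eq_bigr => la _.
by rewrite mulr1 natrX.
Qed.

Lemma level_sum_bound F n (c : R) : (forall la, psize la = n -> `|F la| <= c) ->
  `|level_sum F n| <= c * n`!%:R.
Proof.
move=> Fc; rewrite -level_sum1 /level_sum big_distrr.
apply: le_trans (ler_norm_sum _ _ _) _.
rewrite big_seq [leRHS]big_seq; apply: ler_sum => la; rewrite mem_level_seq => /eqP Pla.
by rewrite /= normrM mulr1 mulrC (ger0_norm (exprn_ge0 _ _))// ler_wpM2r ?exprn_ge0// Fc.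
Qed.

Lemma plancherel_set1 t la : 0 < t -> plancherel t [set la] = (plancherel_pmf t la)%:E.
Proof.
move=> t0; rewrite /plancherel t0 esum_set1// lee_fin !mulr_ge0 ?expR_ge0//.
by rewrite exprn_ge0// ltW.
Qed.

Lemma plancherel_pmfE t la n : psize la = n ->
  plancherel_pmf t la = level_weight t n * #|Std la|%:R ^+ 2.
Proof.
move=> <-; rewrite /plancherel_pmf /level_weight expr_div_n.
by rewrite -!mulrA; do 2 congr (_ * _); rewrite mulrA -expr2 mulrC.
Qed.

Lemma levelE n : level n = \big[setU/set0]_(la <- level_seq n) [set la].
Proof.
rewrite -bigcup_seq; apply/seteqP; split => la /=.
  by move=> /eqP Pla; exists la => //=; rewrite mem_level_seq.
by move=> [mu /=]; rewrite mem_level_seq => /eqP Pmu ->.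
Qed.

Lemma integral_set1_plancherel t F la : 0 < t ->
  (\int[plancherel t]_(x in [set la]) (F x)%:E = (plancherel_pmf t la * F la)%:E)%E.
Proof.
move=> t0; rewrite (eq_integral (cst (F la)%:E)); last first.
  by move=> x; rewrite inE => ->.
rewrite integral_cst//= [X in (_ * X)%E](plancherel_set1 _ t0) -EFinM.
by rewrite mulrC.
Qed.

Lemma integral_level t F n : 0 < t ->
  (\int[plancherel t]_(x in level n) (F x)%:E = (level_weight t n * level_sum F n)%:E)%E.
Proof.
move=> t0; rewrite levelE integral_bigsetU_EFin//=; last first.
  by apply/trivIsetP => /= x y _ _ xy; apply/seteqP; split=> // z /= [->] e; move: xy; rewrite e eqxx.
rewrite /level_sum big_distrr -sumEFin big_seq [RHS]big_seq.
apply: eq_bigr => la; rewrite mem_level_seq => /eqP Pla.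
by rewrite integral_set1_plancherel// (plancherel_pmfE _ Pla) -mulrA.
Qed.

Lemma bigcup_level : \bigcup_n level n = [set: intpart].
Proof. by apply/seteqP; split => // la _; exists (psize la). Qed.

Lemma trivIset_level : trivIset setT level.
Proof.
apply/trivIsetP => m n _ _ mn; apply/seteqP; split => // la [/= em en].
by move: mn; rewrite -em -en eqxx.
Qed.

(** One factor n! of the weight cancels the total mass of the level, so that the other one
absorbs any exponential growth. Base 4 leaves room for a product of two statistics
bounded by multiples of |la| <= 2 ^ |la|. *)
Lemma expectation_level_series t F (C : R) : 0 < t ->
  (forall la, `|F la| <= C * 4 ^+ psize la) ->
  [/\ F \in Lfun (plancherel t) 1,
      cvgn (series (fun n => level_weight t n * level_sum F n)) &
      ('E_(plancherel t)[F] =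
        (limn (series (fun n => level_weight t n * level_sum F n))%R)%:E)%E].
Proof.
move=> t0 FC; have C0 : 0 <= C by have := FC empty_intpart; rewrite mulr1; exact: le_trans.
have w0 n : 0 <= level_weight t n.
  by rewrite mulr_ge0 ?expR_ge0// divr_ge0 ?exprn_ge0// ltW.
pose B n := C * (exp_coeff (4 * t) n).
have cB : cvgn (series B).
  rewrite (_ : series B = (fun n => C * series (exp_coeff (4 * t)) n)).
    by apply/cvg_ex; eexists; apply: cvgMl_tmp; exact: is_cvg_series_exp_coeff.
  by apply/funext => n; rewrite /series /= big_distrr.
have bnd (G : intpart -> R) : (forall la, `|G la| <= C * 4 ^+ psize la) ->
    forall n, `|level_weight t n * level_sum G n| <= B n.
  move=> GC n; rewrite normrM (ger0_norm (w0 n)).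
  apply: le_trans (ler_wpM2l (w0 n) (@level_sum_bound G n (C * 4 ^+ n) _)) _.
    by move=> la <-; exact: GC.
  rewrite /B /exp_coeff /= /level_weight exprMn.
  have f0 : n`!%:R != 0 :> R by rewrite pnatr_eq0 -lt0n fact_gt0.
  rewrite [leLHS](_ : _ = expR (- t) * (C * (4 ^+ n * t ^+ n / n`!%:R))); last by field.
  apply: ler_piMl; last by rewrite -expR0 ler_expR oppr_le0 ltW.
  by rewrite mulr_ge0// divr_ge0// mulr_ge0// exprn_ge0// ltW.
have cF (G : intpart -> R) : (forall la, `|G la| <= C * 4 ^+ psize la) ->
    cvgn (series (fun n => level_weight t n * level_sum G n)).
  move=> GC; apply: normed_cvg; apply: (series_le_cvg _ _ (bnd G GC)) => //.
  by move=> n; apply: le_trans (bnd G GC n).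
have lim_series (G : intpart -> R) : (forall la, `|G la| <= C * 4 ^+ psize la) ->
    (\sum_(n <oo) (\int[plancherel t]_(x in level n) (G x)%:E) =
      (limn (series (fun n => level_weight t n * level_sum G n)))%:E)%E.
  move=> GC; rewrite -EFin_lim; last exact: cF.
  apply: congr_lim; apply/funext => n /=; rewrite /series /= -sumEFin.
  by apply: eq_bigr => k _; rewrite integral_level.
have iF : (plancherel t).-integrable setT (EFin \o F).
  apply/integrableP; split => //.
  rewrite -bigcup_level ge0_integral_bigcup//; last exact: trivIset_level.
  under eq_eseriesr => n _ do rewrite /=.
  have := lim_series (fun la => `|F la|) => /= -> //; first by rewrite ltry.
  by move=> la; rewrite normr_id.
split; [exact/Lfun1_integrable|exact: cF|].
rewrite unlock -bigcup_level integral_bigcup//; last 2 first.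
- exact: trivIset_level.
- by rewrite bigcup_level.
exact: lim_series.
Qed.

End expectation_by_levels.

(** * Bessel functions and the factorial moments of their squares *)

Section bessel.
Context {R : realType}.
Implicit Types (z : R) (m n k r p : nat).

Lemma fact_neq0 n : n`!%:R != 0 :> R.
Proof. by rewrite pnatr_eq0 -lt0n fact_gt0. Qed.

Lemma binomial_factE n a b : (a + b)%N = n ->
  'C(n, a)%:R = n`!%:R / (a`!%:R * b`!%:R) :> R.
Proof.
move=> <-; rewrite -(bin_fact (leq_addr b a)) addKn 2!natrM.
by field; rewrite !fact_neq0.
Qed.

Lemma series_exp_le (x : R) n : 0 <= x -> series (exp_coeff x) n <= expR x.
Proof.
move=> x0; apply: nondecreasing_cvgn_le; last exact: is_cvg_series_exp_coeff.
by apply: nondecreasing_series => k _ _; exact: exp_coeff_ge0.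
Qed.

(** The terms of the power series of the Bessel function J_m(2z). *)
Definition bes m z n : R := (-1) ^+ n * z ^+ (2 * n + m) / (n`!%:R * (n + m)`!%:R).

Lemma norm_bes m z n : `|bes m z n| <= `|z| ^+ m / m`!%:R * exp_coeff (z ^+ 2) n.
Proof.
rewrite /bes /exp_coeff /= normrM normfV [X in _ / X]normrM !normr_nat normrM normrX.
rewrite normrN1 expr1n mul1r normrX exprD exprM.
have -> : `|z| ^+ 2 = z ^+ 2 by rewrite real_normK// num_real.
rewrite [leLHS](_ : _ = ((z ^+ 2) ^+ n / n`!%:R * `|z| ^+ m) / (n + m)`!%:R); last first.
  by field; rewrite !fact_neq0.
rewrite [leRHS](_ : _ = ((z ^+ 2) ^+ n / n`!%:R * `|z| ^+ m) / m`!%:R); last first.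
  by field; rewrite !fact_neq0.
apply: ler_wpM2l; first by rewrite mulr_ge0 ?divr_ge0 ?(exprn_ge0 _ (sqr_ge0 z)) ?exprn_ge0.
rewrite lef_pV2 ?posrE ?ltr0n ?fact_gt0// ler_nat.
by apply: leq_fact; exact: leq_addl.
Qed.

Definition bes_bound m z : R := `|z| ^+ m / m`!%:R * expR (z ^+ 2).

Lemma series_norm_bes m z n : series (fun i => `|bes m z i|) n <= bes_bound m z.
Proof.
apply: (@le_trans _ _ (\sum_(0 <= i < n) `|z| ^+ m / m`!%:R * exp_coeff (z ^+ 2) i)).
  by rewrite /series /=; apply: ler_sum => i _; exact: norm_bes.
rewrite -big_distrr /=; apply: ler_wpM2l; first by rewrite divr_ge0// exprn_ge0.
by apply: series_exp_le; exact: sqr_ge0.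
Qed.

Lemma cvg_norm_bes m z : cvgn (series (fun i => `|bes m z i|)).
Proof.
apply: nondecreasing_is_cvgn; first by apply: nondecreasing_series => *.
by exists (bes_bound m z) => _ [n _ <-]; exact: series_norm_bes.
Qed.

(** In the usual notation this is J_m(2z). *)
Definition J m z : R := limn (series (bes m z)).

Lemma cvg_bes m z : series (bes m z) @ \oo --> J m z.
Proof.
have h : cvgn (series (bes m z)) by apply: normed_cvg; exact: cvg_norm_bes.
exact: h.
Qed.

Lemma J_bound r z : `|J r z| <= bes_bound r z.
Proof.
have h : `|series (bes r z) n| @[n --> \oo] --> `|J r z| by apply: cvg_norm; exact: cvg_bes.
apply: (cvgr_to_le h); apply: nearW => n.
exact: le_trans (ler_norm_sum _ _ _) (series_norm_bes _ _ _).
Qed.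

Definition bes2 m z := cauchy_prod (bes m z) (bes m z).

Lemma cvg_bes2 m z : series (bes2 m z) @ \oo --> J m z ^+ 2.
Proof. by rewrite expr2; apply: cvg_series_cauchy_prod; exact: cvg_norm_bes. Qed.

(** The Cauchy square of the Bessel series is summed by Vandermonde's convolution. *)
Lemma bes2E m z n :
  bes2 m z n = (-1) ^+ n * z ^+ (2 * (n + m)) * 'C(2 * (n + m), n)%:R / (n + m)`!%:R ^+ 2.
Proof.
rewrite mulnC muln2 -addnn -binomial.Vandermonde natr_sum big_distrr big_distrl /=.
apply: eq_bigr => i _; have iN : (i <= n)%N by rewrite -ltnS.
rewrite natrM [X in _ = _ * (_ * X%:R) / _](_ : _ = 'C(n + m, i + m))%N; last first.
  by rewrite -bin_sub; [congr binomial; lia|lia].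
rewrite (@binomial_factE _ _ (n - i + m)); last by lia.
rewrite (@binomial_factE _ (i + m) (n - i)); last by lia.
rewrite /bes.
have -> : (-1) ^+ n = (-1) ^+ i * (-1) ^+ (n - i) :> R by rewrite -exprD subnKC.
have -> : z ^+ (n + m + (n + m)) = z ^+ (2 * i + m) * z ^+ (2 * (n - i) + m).
  by rewrite -exprD; congr (_ ^+ _); lia.
by field; rewrite !fact_neq0.
Qed.

(** Since J_{-r} = (-1)^r J_r, the law r |-> J_r(2z)^2 on the integers is folded onto the
naturals: nonzero indices count twice. *)
Definition mirror_wt r : R := if r is 0%N then 1 else 2.

Lemma mirror_wt_ge0 r : 0 <= mirror_wt r. Proof. by case: r => /=. Qed.

(** The central factorial r^2 (r^2 - 1) ... (r^2 - (k-1)^2). *)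
Definition cfact k r : R := \prod_(i < k) (r%:R ^+ 2 - i%:R ^+ 2).

Lemma cfactS k r : cfact k.+1 r = cfact k r * (r%:R ^+ 2 - k%:R ^+ 2).
Proof. exact: big_ord_recr. Qed.

(** The partial alternating sums of a row of Pascal's triangle telescope. *)
Lemma alt_binom N n : \sum_(j < n.+1) (-1) ^+ j * 'C(N.+1, j)%:R = (-1) ^+ n * 'C(N, n)%:R :> R.
Proof.
elim: n => [|n IH]; first by rewrite big_ord1 !bin0.
by rewrite big_ord_recr /= IH binS natrD exprS; ring.
Qed.

(** Up to the factor 1 / p!^2, the coefficient of z^(2p) in the sum over [r] of the central
factorials against the squares J_r(2z)^2. *)
Definition alt_moment p k : R :=
  \sum_(r < p.+1) mirror_wt r * cfact k r * ((-1) ^+ (p - r) * 'C(2 * p, p - r)%:R).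

(** With q = p + 1, r^2 - k^2 is split as (q^2 - k^2) - (q^2 - r^2), and q^2 - r^2 cancels
the last factors of the two factorials in the denominator of 'C(2q, q - r). *)
Lemma alt_momentS p k : alt_moment p.+1 k.+1 =
  (p.+1%:R ^+ 2 - k%:R ^+ 2) * alt_moment p.+1 k +
  (2 * p.+1%:R * (2 * p%:R + 1)) * alt_moment p k.
Proof.
have key r : (r <= p)%N -> (p.+1%:R ^+ 2 - r%:R ^+ 2) * 'C(2 * p.+1, p.+1 - r)%:R =
    2 * p.+1%:R * (2 * p%:R + 1) * 'C(2 * p, p - r)%:R :> R.
  move=> rp.
  rewrite (@binomial_factE _ (p.+1 - r) (p + r).+1); last by lia.
  rewrite (@binomial_factE _ (p - r) (p + r)); last by lia.
  rewrite subSn// (_ : 2 * p.+1 = (2 * p).+2)%N; last by lia.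
  rewrite !factS !natrM.
  have -> : (p - r).+1%:R = p.+1%:R - r%:R :> R by rewrite -subSn// natrB//; lia.
  have -> : (p + r).+1%:R = p.+1%:R + r%:R :> R by rewrite -addSn natrD.
  have h1 : p.+1%:R - r%:R != 0 :> R by rewrite -natrB ?pnatr_eq0; lia.
  have h2 : p.+1%:R + r%:R != 0 :> R by rewrite -natrD pnatr_eq0; lia.
  have -> : (2 * p).+2%:R = 2 * p.+1%:R :> R by rewrite -natrM; congr (_%:R); lia.
  have -> : (2 * p).+1%:R = 2 * p%:R + 1 :> R by rewrite -natr1 natrM.
  by field; rewrite !nat1r h1 h2 !fact_neq0.
rewrite /alt_moment [LHS]big_ord_recr [X in _ * X + _]big_ord_recr /= mulrDr addrAC.
congr (_ + _); last by rewrite cfactS; ring.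
rewrite !big_distrr -big_split; apply: eq_bigr => r _ /=.
have rp : (r <= p)%N by rewrite -ltnS.
rewrite cfactS [X in _ = _ + X](_ : _ = - (mirror_wt r * cfact k r * ((-1) ^+ (p.+1 - r) *
   ((p.+1%:R ^+ 2 - r%:R ^+ 2) * 'C(2 * p.+1, p.+1 - r)%:R)))); last first.
  by rewrite key// subSn// exprS; ring.
by ring.
Qed.

Lemma alt_moment0 k : alt_moment 0 k = (k == 0%N)%:R.
Proof.
rewrite /alt_moment big_ord1 /= bin0 !mulr1 mul1r /cfact.
case: k => [|k]; first by rewrite big_ord0.
by rewrite big_ord_recl subrr mul0r.
Qed.

(** The alternating sum is a 2p-th finite difference of an even polynomial of degree 2k in
[r]: it vanishes for k < p, it is (2k)! for k = p, and for k > p all central factorials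
involved vanish. *)
Lemma alt_momentE p k : alt_moment p k = if p == k then (2 * k)`!%:R else 0.
Proof.
elim: k p => [|k IH] [|p]; first by rewrite alt_moment0.
- rewrite /alt_moment big_ord_recl /= subn0.
  rewrite (_ : cfact 0 0 = 1); last by rewrite /cfact big_ord0.
  have -> : \sum_(i < p.+1) mirror_wt (bump 0 i) * cfact 0 (bump 0 i) *
      ((-1) ^+ (p.+1 - bump 0 i) * 'C(2 * p.+1, p.+1 - bump 0 i)%:R) =
      2 * \sum_(j < p.+1) (-1) ^+ j * 'C((2 * p).+2, j)%:R.
    rewrite [in RHS](reindex_inj rev_ord_inj) big_distrr; apply: eq_bigr => i _ /=.
    rewrite /bump /= add1n /cfact big_ord0 mulr1; congr (_ * (_ ^+ _ * _%:R)).
    by congr binomial; lia.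
  rewrite alt_binom (_ : 2 * p.+1 = (2 * p).+2)%N; last by lia.
  rewrite binS natrD (_ : 'C((2 * p).+1, p.+1) = 'C((2 * p).+1, p)); last first.
    by rewrite -bin_sub; [congr binomial; lia|lia].
  by rewrite exprS; ring.
- by rewrite alt_moment0.
rewrite alt_momentS !IH eqSS; case: (eqVneq p k) => [->|pk].
  rewrite ifF; last by apply/eqP; lia.
  rewrite mulr0 add0r (_ : 2 * k.+1 = (2 * k).+2)%N; last by lia.
  rewrite !factS !natrM.
  have -> : (2 * k).+2%:R = 2 * k.+1%:R :> R by rewrite -natrM; congr (_%:R); lia.
  have -> : (2 * k).+1%:R = 2 * k%:R + 1 :> R by rewrite -natr1 natrM.
  by rewrite mulrA.
case: (eqVneq p.+1 k) => [->|pk']; first by rewrite subrr mul0r mulr0 addr0.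
by rewrite !mulr0 addr0.
Qed.

(** Truncating the series of J_r^2 at total degree below 2M makes the identity of power
series a finite one. *)
Lemma bes2_truncated k z M : (k < M)%N ->
  \sum_(0 <= r < M) mirror_wt r * cfact k r * series (bes2 r z) (M - r)%N =
  'C(2 * k, k)%:R * z ^+ (2 * k).
Proof.
move=> kM.
transitivity (\sum_(0 <= p < M) z ^+ (2 * p) / p`!%:R ^+ 2 * alt_moment p k).
  rewrite (eq_bigr (fun r => series (fun n => mirror_wt r * cfact k r * bes2 r z n) (M - r)%N));
    last by move=> r _; rewrite /series /= big_distrr.
  rewrite -(series_triangle (fun r n => mirror_wt r * cfact k r * bes2 r z n)); apply: eq_bigr => p _.
  rewrite big_mkord /alt_moment big_distrr; apply: eq_bigr => r _ /=.
  rewrite bes2E subnK; last by rewrite -ltnS.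
  by ring.
rewrite (big_rem k) ?mem_index_iota//= alt_momentE eqxx.
rewrite big1_seq ?addr0; last first.
  move=> p /=; rewrite mem_rem_uniq ?iota_uniq// inE => /andP[pk _].
  by rewrite alt_momentE (negPf pk) mulr0.
rewrite (@binomial_factE _ k k); last by lia.
by field; rewrite !fact_neq0.
Qed.

(** A crude exponential bound, enough for domination since the Bessel squares decay
factorially in [r]. *)
Lemma cfact_bound k r : `|cfact k r| <= (1 + k%:R ^+ 2) ^+ k * (4 ^+ k) ^+ r.
Proof.
rewrite -exprM mulnC exprM -exprMn /cfact normr_prod.
rewrite -[X in _ <= _ ^+ X](card_ord k) -prodr_const.
apply: ler_prod => i _; rewrite normr_ge0 /=.
have ik : i%:R <= k%:R :> R by rewrite ler_nat ltnW.
have r4 : r%:R ^+ 2 <= 4 ^+ r :> R.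
  rewrite -[4](_ : 2 ^+ 2 = _); last by rewrite expr2 -natrM.
  rewrite exprAC ler_sqr ?nnegrE// -natrX ler_nat.
  exact/ltnW/ltn_expl.
have h1 : 1 <= 4 ^+ r :> R by rewrite exprn_ege1// ler1n.
have i0 : 0 <= i%:R :> R by [].
have i2 : i%:R ^+ 2 <= k%:R ^+ 2 :> R by rewrite ler_sqr// nnegrE (le_trans i0).
have := sqr_ge0 (r%:R : R); have := sqr_ge0 (i%:R : R); have := sqr_ge0 (k%:R : R).
by move=> k0 i0' r0; rewrite ler_norml; nra.
Qed.

Lemma cvg_exp_scaled (c x : R) : cvgn (series (fun r => c * exp_coeff x r)).
Proof.
rewrite (_ : series _ = (fun n => c * series (exp_coeff x) n)).
  by apply/cvg_ex; eexists; apply: cvgMl_tmp; exact: is_cvg_series_exp_coeff.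
by apply/funext => n; rewrite /series /= big_distrr.
Qed.

Lemma bes_bound2 m z : bes_bound m z ^+ 2 <= expR (z ^+ 2) ^+ 2 * exp_coeff (z ^+ 2) m.
Proof.
rewrite /bes_bound exprMn mulrC ler_wpM2l ?exprn_ge0 ?expR_ge0//.
rewrite expr_div_n exprAC real_normK ?num_real// /exp_coeff /=.
rewrite ler_wpM2l ?(exprn_ge0 _ (sqr_ge0 z))// lef_pV2 ?posrE ?exprn_gt0 ?ltr0n ?fact_gt0//.
by rewrite expr2 ler_peMl// ler1n fact_gt0.
Qed.

(** The central factorial moments of the law r |-> J_r(2z)^2 are monomials in z: by
[alt_momentE] a single power of z survives. *)
Lemma bessel_moment k z :
  series (fun r => mirror_wt r * cfact k r * J r z ^+ 2) @ \oo --> 'C(2 * k, k)%:R * z ^+ (2 * k).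
Proof.
pose a M r := if (r < M)%N then mirror_wt r * cfact k r * series (bes2 r z) (M - r)%N else 0.
pose c := 2 * (1 + k%:R ^+ 2) ^+ k * expR (z ^+ 2) ^+ 2.
have [] := @tannery _ a (fun r => mirror_wt r * cfact k r * J r z ^+ 2)
  (fun r => c * exp_coeff (4 ^+ k * z ^+ 2) r).
- move=> M r; have c0 : 0 <= c by rewrite !mulr_ge0// exprn_ge0// ?addr_ge0 ?sqr_ge0 ?expR_ge0.
  have x0 : 0 <= 4 ^+ k * z ^+ 2 by rewrite mulr_ge0 ?sqr_ge0// exprn_ge0.
  rewrite /a; case: ifP => _; last by rewrite normr0 mulr_ge0// exp_coeff_ge0.
  rewrite !normrM (ger0_norm (mirror_wt_ge0 r)).
  have hw : mirror_wt r <= 2 by case: r => [|r] //=; rewrite ler1n.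
  have h := series_cauchy_prod_bound (M - r)%N (series_norm_bes r z) (series_norm_bes r z).
  rewrite -expr2 in h; have {}h := le_trans h (bes_bound2 r z).
  rewrite [leRHS](_ : _ = (2 * ((1 + k%:R ^+ 2) ^+ k * (4 ^+ k) ^+ r)) *
     (expR (z ^+ 2) ^+ 2 * exp_coeff (z ^+ 2) r)); last first.
    by rewrite /exp_coeff /= exprMn /c; field; rewrite fact_neq0.
  apply: ler_pM => //; first by rewrite mulr_ge0 ?mirror_wt_ge0.
  by apply: ler_pM => //; [exact: mirror_wt_ge0|exact: cfact_bound].
- exact: cvg_exp_scaled.
- move=> r; apply: (@cvg_trans _ ((fun M =>
      mirror_wt r * cfact k r * series (bes2 r z) (M - r)%N) @ \oo)).
    by apply: near_eq_cvg; near=> M; rewrite /a ifT//; near: M; exists r.+1.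
  apply: cvgMl_tmp; rewrite -(cvg_shiftn r) /=.
  by under eq_fun do rewrite addnK; exact: cvg_bes2.
move=> cb h; suff <- : limn (series (fun r => mirror_wt r * cfact k r * J r z ^+ 2)) =
  'C(2 * k, k)%:R * z ^+ (2 * k) by [].
rewrite -(cvg_lim _ h)//; apply: cvg_lim => //.
apply: cvg_near_cst; near=> M; rewrite -(@bes2_truncated k z M).
  by apply: eq_big_nat => r /andP[_ rM]; rewrite /a rM.
by near: M; exists k.+1.
Unshelve. all: by end_near. Qed.

End bessel.

(** * Trigonometric sums in arithmetic progression *)

Section trigonometric_sums.
Context {R : realType}.
Implicit Types (x y al be th : R).

Lemma cosD_int (x : R) (k : int) : cos (x + k%:~R * (2 * pi)) = cos x.
Proof.
have H n y : cos (y + n%:R * (2 * pi)) = cos y.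
  rewrite (_ : n%:R * (2 * pi) = (pi *+ 2) *+ n); last by rewrite mulr_natl mulr_natl.
  exact: (periodicn (@cosD2pi R)).
case: k => n; first exact: H.
by rewrite -[RHS](H n.+1) -[LHS](H n.+1) NegzE rmorphN /= mulNr subrK H.
Qed.

Lemma sinD_int (x : R) (k : int) : sin (x + k%:~R * (2 * pi)) = sin x.
Proof. by rewrite -!cosBpihalf addrAC cosD_int. Qed.

(** Multiplying by 2 sin (al/2) turns the sum of cosines into a telescoping sum of sines. *)
Lemma sum_cos_arith al be N : 2 * sin (al / 2) * \sum_(0 <= a < N) cos (al * a%:R + be) =
  sin (al * N%:R - al / 2 + be) - sin (be - al / 2).
Proof.
elim: N => [|N IH]; first by rewrite big_geq// mulr0 mulr0 sub0r [- _ + _]addrC subrr.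
rewrite big_nat_recr//= mulrDr IH -(natr1 N).
set B := al * N%:R + be.
rewrite [in LHS](_ : al * N%:R - al / 2 + be = B - al / 2); last by rewrite /B; ring.
rewrite [in RHS](_ : al * (N%:R + 1) - al / 2 + be = B + al / 2); last by rewrite /B; field.
by rewrite (sinB B) (sinD B); ring.
Qed.

Lemma sum_cos_bound al be N : sin (al / 2) != 0 ->
  `|\sum_(0 <= a < N) cos (al * a%:R + be)| <= `|sin (al / 2)|^-1.
Proof.
move=> s0; have h := sum_cos_arith al be N.
have s0' : 0 < `|sin (al / 2)| by rewrite normr_gt0.
rewrite -[X in _ <= X]mulr1 ler_pdivlMl//.
rewrite -(@ler_pM2l _ 2)// mulr1 -[X in X * (_ * _)](ger0_norm (ler0n _ 2)) -!normrM mulrA h.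
apply: le_trans (ler_normB _ _) _.
by rewrite -[X in _ <= X](_ : 1 + 1 = _)// lerD// sin_max.
Qed.

Lemma sin_pi_ratio_gt0 r N : (0 < r < N)%N -> 0 < sin (r%:R * (pi / N%:R)) :> R.
Proof.
move=> /andP[r0 rN]; have N0 : 0 < N%:R :> R by rewrite ltr0n; lia.
have r0' : 0 < r%:R :> R by rewrite ltr0n.
apply: sin_gt0_pi; apply/andP; split; first by rewrite mulr_gt0 ?divr_gt0 ?pi_gt0.
by rewrite mulrCA gtr_pMr ?pi_gt0// ltr_pdivrMr// mul1r ltr_nat.
Qed.

(** Orthogonality of the characters of Z/N, real parts only. *)
Lemma sum_cos_roots N (m : int) : (0 < N)%N ->
  \sum_(0 <= a < N) cos (m%:~R * (2 * pi / N%:R) * a%:R) =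
  if (N%:Z %| m)%Z then N%:R else 0 :> R.
Proof.
move=> N0; have N0' : N%:R != 0 :> R by rewrite pnatr_eq0 -lt0n.
pose r := absz (m %% N%:Z)%Z.
have mE : m = (m %/ N%:Z)%Z * N%:Z + r%:Z.
  by rewrite {1}(divz_eq m N%:Z) /r gez0_abs ?modz_ge0// eqz_nat -lt0n.
have rN : (r < N)%N.
  by rewrite -ltz_nat /r gez0_abs ?modz_ge0 ?ltz_pmod// ?eqz_nat -?lt0n.
have red a : cos (m%:~R * (2 * pi / N%:R) * a%:R) = cos (r%:R * (2 * pi / N%:R) * a%:R) :> R.
  rewrite {1}mE -[RHS](cosD_int _ ((m %/ N%:Z)%Z * a%:Z)); congr cos.
  by rewrite rmorphD !rmorphM /=; field.
under eq_bigr do rewrite red.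
have -> : (N%:Z %| m)%Z = (r == 0)%N.
  by rewrite (sameP dvdz_mod0P eqP) -absz_eq0.
have [r0|r0] := eqVneq r 0%N.
  under eq_bigr do rewrite r0 !mul0r cos0.
  by rewrite sumr_const_nat subn0.
have s0 : sin (r%:R * (pi / N%:R)) != 0 :> R.
  by rewrite gt_eqF// sin_pi_ratio_gt0// lt0n r0.
have := sum_cos_arith (r%:R * (2 * pi / N%:R)) 0 N.
rewrite [X in _ * sin X * _](_ : _ = r%:R * (pi / N%:R)); last by field.
rewrite [X in sin X - _](_ : _ = - (r%:R * (pi / N%:R)) + r%:Z%:~R * (2 * pi)); last first.
  by rewrite /=; field.
rewrite [X in _ - sin X](_ : _ = - (r%:R * (pi / N%:R))); last by field.
rewrite sinD_int subrr => /eqP; rewrite mulf_eq0 mulf_eq0 pnatr_eq0 (negPf s0) /= => /eqP E.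
by rewrite -[RHS]E; apply: eq_bigr => a _; rewrite addr0.
Qed.

(** The imaginary part of a geometric sum of ratio exp (i (2d+1) pi/N); as the N-th power of
the ratio is -1, the sum is 2 / (1 - ratio), whose imaginary part is the cotangent of
half the angle. *)
Lemma sum_sin_odd N (d : int) : (0 < N)%N -> sin ((2 * d%:~R + 1) * (pi / (2 * N%:R))) != 0 :> R ->
  \sum_(0 <= a < N) sin ((2 * d%:~R + 1) * (pi / N%:R) * a%:R) =
  cot ((2 * d%:~R + 1) * (pi / (2 * N%:R))) :> R.
Proof.
move=> N0; have N0' : N%:R != 0 :> R by rewrite pnatr_eq0 -lt0n.
set h := _ * (pi / (2 * _)) => s0.
have := sum_cos_arith ((2 * d%:~R + 1) * (pi / N%:R)) (- (pi / 2)) N.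
rewrite [X in _ * sin X * _](_ : _ = h); last by rewrite /h; field.
rewrite [X in sin X - _](_ : _ = pi / 2 - h + d%:~R * (2 * pi)); last by rewrite /h; field.
rewrite [X in _ - sin X](_ : _ = - (h + pi / 2)); last by rewrite /h; field.
rewrite sinD_int sinN sinDpihalf opprK [pi / 2 - h]addrC sinDpihalf cosN => E.
rewrite /cot; apply: (@mulfI _ (2 * sin h)); first by rewrite mulf_neq0.
rewrite (_ : 2 * sin h * (cos h / sin h) = cos h + cos h); last by field.
by rewrite -E; congr (_ * _); apply: eq_bigr => a _; rewrite cosBpihalf.
Qed.

(** The binomial theorem for (exp (ix) + exp (-ix))^n, real parts only. *)
Lemma cos_pow_expand n x :
  2 ^+ n * cos x ^+ n = \sum_(i < n.+1) 'C(n, i)%:R * cos (((n - i)%N%:R - i%:R) * x).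
Proof.
elim: n => [|n IH]; first by rewrite big_ord1 !mul1r subrr mul0r cos0.
rewrite (binom_sum_shift (fun u v => cos ((v%:R - u%:R) * x))) -big_split /=.
rewrite !exprS mulrACA IH big_distrr; apply: eq_bigr => i _ /=.
rewrite -mulrDr mulrCA; congr (_ * _).
set B := ((n - i)%N%:R - i%:R) * x.
rewrite -(natr1 i) -(natr1 (n - i)%N).
rewrite [X in cos X + _](_ : _ = B - x); last by rewrite /B; ring.
rewrite [X in _ + cos X](_ : _ = B + x); last by rewrite /B; ring.
by rewrite cosB cosD; ring.
Qed.

(** The moments of the arcsine law on [0, 1], i.e. the mean of cos^(2k). *)
Definition cbin k : R := 'C(2 * k, k)%:R / 4 ^+ k.

(** The equidistant quadrature with N nodes is exact for trigonometric polynomials of degree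
less than N in 2x: only the constant Fourier coefficient survives. *)
Lemma cos_pow_average k N : (k < N)%N ->
  \sum_(0 <= a < N) cos (pi / N%:R * a%:R) ^+ (2 * k) = N%:R * cbin k.
Proof.
move=> kN; have N0 : (0 < N)%N by lia.
have N0' : N%:R != 0 :> R by rewrite pnatr_eq0 -lt0n.
have p0 : 2 ^+ (2 * k) != 0 :> R by rewrite expf_neq0.
apply: (@mulfI _ (2 ^+ (2 * k))) => //; rewrite big_distrr /=.
under eq_bigr do rewrite cos_pow_expand.
rewrite exchange_big /=.
rewrite (bigD1 (inord k : 'I_(2 * k).+1)) //= inordK; last by lia.
rewrite [X in _ + X]big1 ?addr0 => [|i].
  rewrite (_ : 2 * k - k = k)%N; last by lia.
  under eq_bigr do rewrite subrr mul0r cos0 mulr1.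
  rewrite sumr_const_nat subn0 /cbin exprM (_ : 2 ^+ 2 = 4 :> R); last by rewrite expr2 -natrM.
  rewrite -[LHS]mulr_natl; field; by rewrite expf_neq0.
rewrite -val_eqE /= inordK; last by lia.
move=> ik; rewrite -big_distrr /=; have i2 : (i <= 2 * k)%N by rewrite -ltnS.
have := @sum_cos_roots N (k%:Z - i%:Z) N0; rewrite ifF; last first.
  apply/negP => /dvdzP[q E]; have : (absz (k%:Z - i%:Z)%R < N)%N by lia.
  have [q0|q0] := eqVneq q 0; first by move: E; rewrite q0 mul0r; lia.
  have q1 : (0 < absz q)%N by lia.
  by rewrite E abszM absz_nat; nia.
move=> E.
rewrite [X in _ * X](_ : _ = 0) ?mulr0// -[RHS]E; apply: eq_bigr => a _; congr cos.
by rewrite natrB// natrM rmorphB /=; field.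
Qed.

End trigonometric_sums.

(** * Polynomials enclosing the square root *)

Section sqrt_polynomials.
Context {R : realType}.
Implicit Types (x y w : R) (n k : nat).

Lemma deriv_ge0_le (f df : R -> R) a b : a <= b ->
  (forall x, a <= x <= b -> is_derive x 1 f (df x)) ->
  (forall x, a <= x <= b -> 0 <= df x) -> f a <= f b.
Proof.
move=> ab Df df0.
have [||c] := @MVT_segment R f df a b ab.
- by move=> x; rewrite in_itv /= => /andP[ax xb]; apply: Df; rewrite !ltW.
- apply: derivable_within_continuous => x; rewrite in_itv /= => xab.
  by have := Df x xab => -[].
rewrite in_itv /= => cab E.
by rewrite -subr_ge0 E mulr_ge0 ?df0// subr_ge0.
Qed.

Lemma cbin0 : cbin 0 = 1 :> R.
Proof. by rewrite /cbin bin0 divr1. Qed.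

Lemma cbin_gt0 k : 0 < cbin k :> R.
Proof. by rewrite divr_gt0 ?exprn_gt0// ltr0n bin_gt0; lia. Qed.

Lemma cbinS k : cbin k.+1 = cbin k * (2 * k%:R + 1) / (2 * k%:R + 2) :> R.
Proof.
have k2 : 2 * k%:R + 2 != 0 :> R by rewrite -natrM -natrD pnatr_eq0; lia.
have k1 : k%:R + 1 != 0 :> R by rewrite natr1 pnatr_eq0.
rewrite /cbin (@binomial_factE _ (2 * k.+1) k.+1 k.+1); last by lia.
rewrite (@binomial_factE _ (2 * k) k k); last by lia.
rewrite (_ : 2 * k.+1 = (2 * k).+2)%N; last by lia.
rewrite !factS !natrM exprS.
have -> : (2 * k).+2%:R = 2 * k%:R + 2 :> R by rewrite -natr1 -natr1 natrM; ring.
have -> : (2 * k).+1%:R = 2 * k%:R + 1 :> R by rewrite -natr1 natrM.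
rewrite -(natr1 k).
have p4 : 4 ^+ k != 0 :> R by rewrite expf_neq0.
by field; rewrite k2 p4 !fact_neq0 k1.
Qed.

(** The coefficient of w^k in the Taylor series of sqrt (1 - w). *)
Definition dbin k : R := cbin k / (1 - 2 * k%:R).

Lemma odd_neq0 k : 1 - 2 * k%:R != 0 :> R.
Proof.
rewrite subr_eq0 -natrM -[1]/(1%:R) eqr_nat; lia.
Qed.

(** The Taylor polynomial of sqrt (1 - w), to be used at w = 1 - x^2, where the square root
is x. *)
Definition sqrt_poly n w : R := \sum_(k < n.+1) dbin k * w ^+ k.

Lemma is_derive_inv x : x != 0 -> is_derive x 1 (fun y : R => y^-1) (- x ^- 2 *: (1 : R)).
Proof. by move=> x0; exact: (is_deriveV x0 (is_derive_id x 1)). Qed.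

Lemma is_derive_one_sub_sqr_pow n x : is_derive x 1 (fun y : R => (1 - y ^+ 2) ^+ n.+1)
  ((n.+1%:R * (1 - x ^+ 2) ^+ n) *: (0 - (2 * x ^+ 1) *: (1 : R))).
Proof.
have dw : is_derive x 1 (fun y : R => 1 - y ^+ 2) (0 - (2 * x ^+ 1) *: (1 : R)).
  exact: (is_deriveB (is_derive_cst (1 : R) x 1) (is_deriveX 2 (is_derive_id x 1))).
have := is_deriveX n.+1 dw.
by have -> : (fun y : R => 1 - y ^+ 2) ^+ n.+1 = (fun y : R => (1 - y ^+ 2) ^+ n.+1)
  by rewrite exprfctE.
Qed.

(** Polynomial and square root satisfy the same differential equation up to the term that
truncation leaves, so that the derivative of their quotient is a single term. *)
Lemma is_derive_sqrt_poly n x : x != 0 ->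
  is_derive x 1 (fun y => sqrt_poly n (1 - y ^+ 2) / y)
    (- cbin n * (1 - x ^+ 2) ^+ n / x ^+ 2).
Proof.
move=> x0; elim: n => [|n IH].
  have -> : (fun y => sqrt_poly 0 (1 - y ^+ 2) / y) = (fun y : R => y^-1).
    by apply/funext => y; rewrite /sqrt_poly big_ord1 /dbin cbin0 !mulr0 subr0 divr1 !mul1r.
  have h := is_derive_inv x0.
  apply: is_derive_eq; rewrite cbin0 expr0 mulr1 mulN1r; exact: mulr1.
have dV := is_derive_inv x0; have dwn := is_derive_one_sub_sqr_pow n x.
have dc := is_deriveM (is_deriveZ (dbin n.+1) dwn) dV.
have := is_deriveD IH dc.
have -> : (fun y => sqrt_poly n (1 - y ^+ 2) / y) +
   (dbin n.+1 \*: (fun y => (1 - y ^+ 2) ^+ n.+1)) * (fun y => y^-1) =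
   (fun y => sqrt_poly n.+1 (1 - y ^+ 2) / y).
  by apply/funext => y; rewrite /sqrt_poly [in RHS]big_ord_recr /= mulrDl.
move=> /is_derive_eq; apply.
have n1 : 2 * n%:R + 1 != 0 :> R by rewrite -natrM natr1 pnatr_eq0.
have n2 : 2 * n%:R + 2 != 0 :> R by rewrite -natrM -natrD pnatr_eq0; lia.
have := odd_neq0 n.+1; rewrite -(natr1 n) => n3.
rewrite (_ : (dbin n.+1 \*: _) x = dbin n.+1 * (1 - x ^+ 2) ^+ n.+1)//.
rewrite /GRing.scale /= /dbin cbinS -(natr1 n); set W := 1 - x ^+ 2.
have WE : W = 1 - x ^+ 2 by [].
rewrite !exprSr; field: WE.
by rewrite x0 n2 n3.
Qed.

(** The subtracted term is the one for which the derivative is again a single term, now of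
the opposite sign. *)
Lemma is_derive_sqrt_poly_tail n x : x != 0 ->
  is_derive x 1 (fun y => (sqrt_poly n (1 - y ^+ 2) - cbin n * (1 - y ^+ 2) ^+ n.+1) / y)
    (cbin n * (2 * n%:R + 1) * (1 - x ^+ 2) ^+ n).
Proof.
move=> x0.
have dV := is_derive_inv x0; have dwn := is_derive_one_sub_sqr_pow n x.
have dc := is_deriveM (is_deriveZ (cbin n) dwn) dV.
have := is_deriveB (is_derive_sqrt_poly n x0) dc.
have -> : (fun y => sqrt_poly n (1 - y ^+ 2) / y) -
   (cbin n \*: (fun y => (1 - y ^+ 2) ^+ n.+1)) * (fun y => y^-1) =
   (fun y => (sqrt_poly n (1 - y ^+ 2) - cbin n * (1 - y ^+ 2) ^+ n.+1) / y).
  by apply/funext => y; rewrite mulrBl.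
move=> /is_derive_eq; apply.
rewrite (_ : (cbin n \*: _) x = cbin n * (1 - x ^+ 2) ^+ n.+1)//.
rewrite /GRing.scale /= -(natr1 n); set W := 1 - x ^+ 2.
have WE : W = 1 - x ^+ 2 by [].
by rewrite !exprSr; field: WE.
Qed.

Lemma sqrt_poly0 n : sqrt_poly n 0 = 1.
Proof.
rewrite /sqrt_poly big_ord_recl /= expr0 /dbin cbin0 mulr0 subr0 divr1 mulr1.
by rewrite big1 ?addr0// => k _; rewrite expr0n /= mulr0.
Qed.

Lemma sqrt_poly1 n : sqrt_poly n 1 = cbin n.
Proof.
rewrite /sqrt_poly; elim: n => [|n IH].
  by rewrite big_ord1 /dbin cbin0 mulr0 subr0 divr1 mulr1.
rewrite big_ord_recr /= IH expr1n mulr1 /dbin cbinS.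
have n1 : 2 * n%:R + 1 != 0 :> R by rewrite -natrM natr1 pnatr_eq0.
have n2 : 2 * n%:R + 2 != 0 :> R by rewrite -natrM -natrD pnatr_eq0; lia.
have := odd_neq0 n.+1; rewrite -(natr1 n) => n3.
by field; rewrite n2 n3.
Qed.

(** For odd n the derivative of sqrt_poly (1 - y^2) / y is negative before y = 1 and
positive after, so the quotient is minimal at y = 1, where it is 1. The argument is
global in y, so it reaches beyond the disc of convergence of the Taylor series. *)
Lemma sqrt_poly_ge n x : odd n -> 0 <= x -> x <= sqrt_poly n (1 - x ^+ 2).
Proof.
move=> on; rewrite le_eqVlt => /predU1P[<-|x0].
  by rewrite expr0n /= subr0 sqrt_poly1 ltW// cbin_gt0.
have E1 : sqrt_poly n (1 - 1 ^+ 2) / 1 = 1 by rewrite expr1n subrr sqrt_poly0 divr1.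
suff : 1 <= sqrt_poly n (1 - x ^+ 2) / x by rewrite ler_pdivlMr// mul1r.
rewrite -[leLHS]E1; have c0 := cbin_gt0 n.
have [x1|/ltW x1] := leP x 1.
- rewrite -lerN2; apply: (@deriv_ge0_le (fun y => - (sqrt_poly n (1 - y ^+ 2) / y))
    (fun y => - (- cbin n * (1 - y ^+ 2) ^+ n / y ^+ 2)) x 1) => //.
    move=> y /andP[xy _]; apply: is_deriveN; apply: is_derive_sqrt_poly.
    by rewrite gt_eqF// (lt_le_trans x0).
  move=> y /andP[xy y1]; rewrite !mulNr opprK divr_ge0 ?sqr_ge0// mulr_ge0 ?(ltW c0)//.
  rewrite exprn_ge0// subr_ge0 expr_le1//.
  by apply: le_trans xy; exact: ltW.
- apply: (@deriv_ge0_le (fun y => sqrt_poly n (1 - y ^+ 2) / y)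
    (fun y => - cbin n * (1 - y ^+ 2) ^+ n / y ^+ 2) 1 x) => //.
    move=> y /andP[y1 _]; apply: is_derive_sqrt_poly.
    by rewrite gt_eqF// (lt_le_trans _ y1).
  move=> y /andP[y1 _]; rewrite divr_ge0 ?sqr_ge0// mulNr -mulrN mulr_ge0 ?(ltW c0)//.
  rewrite oppr_ge0 exprn_odd_le0// subr_le0 expr_ge1//.
  by apply: le_trans y1.
Qed.

(** As in [sqrt_poly_ge], with a quotient that is maximal at y = 1. *)
Lemma sqrt_poly_le n x : odd n -> 0 <= x ->
  sqrt_poly n (1 - x ^+ 2) - cbin n * (1 - x ^+ 2) ^+ n.+1 <= x.
Proof.
move=> on; rewrite le_eqVlt => /predU1P[<-|x0].
  by rewrite expr0n /= subr0 sqrt_poly1 expr1n mulr1 subrr.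
pose psi y := (sqrt_poly n (1 - y ^+ 2) - cbin n * (1 - y ^+ 2) ^+ n.+1) / y.
have E1 : psi 1 = 1 by rewrite /psi expr1n subrr sqrt_poly0 expr0n /= mulr0 subr0 divr1.
suff : psi x <= 1 by rewrite /psi ler_pdivrMr// mul1r.
rewrite -[leRHS]E1; have c0 := cbin_gt0 n.
have n1 : 0 <= cbin n * (2 * n%:R + 1) :> R.
  by rewrite mulr_ge0 ?(ltW c0)// addr_ge0// mulr_ge0.
have [x1|/ltW x1] := leP x 1.
- apply: (@deriv_ge0_le psi
    (fun y => cbin n * (2 * n%:R + 1) * (1 - y ^+ 2) ^+ n) x 1) => //.
    move=> y /andP[xy _]; apply: is_derive_sqrt_poly_tail.
    by rewrite gt_eqF// (lt_le_trans x0).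
  move=> y /andP[xy y1]; rewrite mulr_ge0// exprn_ge0// subr_ge0 expr_le1//.
  by apply: le_trans xy; exact: ltW.
- rewrite -lerN2; apply: (@deriv_ge0_le (fun y => - psi y)
    (fun y => - (cbin n * (2 * n%:R + 1) * (1 - y ^+ 2) ^+ n)) 1 x) => //.
    move=> y /andP[y1 _]; apply: is_deriveN; apply: is_derive_sqrt_poly_tail.
    by rewrite gt_eqF// (lt_le_trans _ y1).
  move=> y /andP[y1 _]; rewrite -mulrN mulr_ge0// oppr_ge0.
  rewrite exprn_odd_le0// subr_le0 expr_ge1//.
  by apply: le_trans y1.
Qed.

(** A partial Wallis product; it is the mean of [sqrt_poly n] of w = cos^2 ([wallisE]),
whence its limit is the mean 2/pi of |sin|. *)
Definition wallis n : R := (2 * n%:R + 1) * cbin n ^+ 2.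

Lemma wallisE n : \sum_(k < n.+1) dbin k * cbin k = wallis n.
Proof.
rewrite /wallis; elim: n => [|n IH].
  by rewrite big_ord1 /dbin cbin0 !mulr0 subr0 divr1 add0r expr1n mulr1.
rewrite big_ord_recr /= IH /dbin cbinS.
have n1 : 2 * n%:R + 1 != 0 :> R by rewrite -natrM natr1 pnatr_eq0.
have n2 : 2 * n%:R + 2 != 0 :> R by rewrite -natrM -natrD pnatr_eq0; lia.
have := odd_neq0 n.+1; rewrite -(natr1 n) => n3.
by field; rewrite n2 n3.
Qed.

Lemma cbin_le n : cbin n.+1 <= cbin n :> R.
Proof.
rewrite cbinS -mulrA ler_piMr ?(ltW (cbin_gt0 n))//.
have n0 : 0 <= n%:R :> R by [].
by rewrite ler_pdivrMr ?mul1r; lra.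
Qed.

Lemma wallis_le1 n : wallis n <= 1.
Proof.
elim: n => [|n IH]; first by rewrite /wallis cbin0 mulr0 add0r expr1n mulr1.
rewrite -wallisE big_ord_recr /= wallisE -[leRHS]addr0 lerD//.
have c0 := ltW (cbin_gt0 n.+1).
rewrite /dbin mulrAC mulr_ge0_le0 ?mulr_ge0// invr_le0 subr_le0 -natrM ler1n; lia.
Qed.

(** By [wallis_le1], (2n + 1) cbin n ^ 2 <= 1. *)
Lemma cbin_small (e : R) : 0 < e -> exists2 n, odd n & cbin n * cbin n.+1 <= e :> R.
Proof.
move=> e0; pose n := (Num.truncn e^-1).*2.+1; exists n.
  by rewrite /n /= odd_double.
have hn : e^-1 <= 2 * n%:R + 1.
  have /truncn_itv/andP[_ h] : 0 <= e^-1 by rewrite invr_ge0 ltW.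
  apply: le_trans (ltW h) _; rewrite -natrM natr1 ler_nat /n; lia.
apply: (@le_trans _ _ (cbin n ^+ 2)).
  by rewrite expr2 ler_wpM2l ?(ltW (cbin_gt0 n))// cbin_le.
have := wallis_le1 n; rewrite /wallis => h.
have p : 0 < 2 * n%:R + 1 :> R by rewrite (lt_le_trans _ hn)// invr_gt0.
rewrite -(ler_pM2l p) (le_trans h)//.
by rewrite -[leLHS](mulVf (_ : e != 0)) ?gt_eqF// ler_wpM2r// ltW.
Qed.

End sqrt_polynomials.

(** * The Wallis product encloses 2 / pi *)

Section wallis_limit.
Context {R : realType}.
Implicit Types (h x : R) (n N : nat).

Lemma sin_le_id h : 0 <= h -> sin h <= h.
Proof.
move=> h0; rewrite -subr_ge0.
have D y : 0 <= y <= h -> is_derive y 1 (fun y => y - sin y) (1 - cos y).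
  by move=> _; exact: (is_deriveB (is_derive_id y 1) (is_derive_sin y)).
have P y : 0 <= y <= h -> 0 <= 1 - cos y by rewrite subr_ge0 cos_le1.
by have := deriv_ge0_le h0 D P; rewrite sin0 subrr.
Qed.

Lemma mul_cos_le_sin h : 0 <= h <= pi -> h * cos h <= sin h.
Proof.
move=> /andP[h0 hpi]; rewrite -subr_ge0.
have D y : 0 <= y <= h -> is_derive y 1 (fun y => sin y - y * cos y) (y * sin y).
  move=> _; have H := is_deriveB (is_derive_sin y) (is_deriveM (is_derive_id y 1) (is_derive_cos y)).
  apply: (is_derive_eq H).
  by rewrite /GRing.scale /=; ring.
have P y : 0 <= y <= h -> 0 <= y * sin y.
  by move=> /andP[y0 yh]; rewrite mulr_ge0// sin_ge0_pi// y0 (le_trans yh).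
by have := deriv_ge0_le h0 D P; rewrite sin0 mul0r subrr.
Qed.

Lemma cvg_inv_pinfty : z^-1 @[z --> +oo] --> (0 : R).
Proof.
apply/(@gtr0_cvgV0 R _ +oo _ (fun z => z)); last exact: cvg_id.
by near=> z; near: z; exact: nbhs_pinfty_gt.
Unshelve. all: by end_near. Qed.

(** Average the inequalities for x over the nodes x = sin (pi a / N): the powers of 1 - x^2
= cos^2 are averaged exactly, and the mean of x is a cotangent. *)
Lemma sqrt_poly_quadrature n N : odd n -> (n.+1 < N)%N ->
  (wallis n : R) - cbin n * cbin n.+1 <= cot (pi / (2 * N%:R)) / N%:R <= (wallis n : R).
Proof.
move=> on nN; have N0 : (0 < N)%N by lia.
have N0' : 0 < N%:R :> R by rewrite ltr0n.
have s0 : 0 < sin (pi / (2 * N%:R)) :> R.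
  have := @sin_pi_ratio_gt0 R 1 (2 * N)%N; rewrite mul1r natrM; apply; lia.
have := @sum_sin_odd R N 0 N0; rewrite mulr0 add0r mul1r => /(_ (lt0r_neq0 s0)).
under eq_bigr do rewrite mul1r.
move=> <-.
have x0 a : (a < N)%N -> 0 <= sin (pi / N%:R * a%:R) :> R.
  case: a => [|a] aN; first by rewrite mulr0 sin0.
  by rewrite mulrC ltW// sin_pi_ratio_gt0.
have wE a : 1 - sin (pi / N%:R * a%:R) ^+ 2 = cos (pi / N%:R * a%:R) ^+ 2 :> R.
  by rewrite cos2sin2.
have avg : \sum_(0 <= a < N) sqrt_poly n (cos (pi / N%:R * a%:R) ^+ 2) = N%:R * wallis n :> R.
  rewrite exchange_big -wallisE big_distrr; apply: eq_bigr => k _ /=.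
  rewrite -big_distrr /= mulrCA; congr (_ * _); rewrite -cos_pow_average.
    by apply: eq_bigr => a _; rewrite -exprM.
  by have := ltn_ord k; lia.
apply/andP; split.
- rewrite ler_pdivlMr// (_ : (_ - _) * _ =
    N%:R * wallis n - cbin n * (N%:R * cbin n.+1)); last by ring.
  rewrite -avg -cos_pow_average// big_distrr -sumrB /=.
  rewrite big_seq [leRHS]big_seq; apply: ler_sum => a.
  rewrite mem_index_iota => /andP[_ aN].
  by have := sqrt_poly_le on (x0 a aN); rewrite wE -exprM.
- rewrite ler_pdivrMr// [leRHS]mulrC -avg.
  rewrite big_seq [leRHS]big_seq; apply: ler_sum => a.
  rewrite mem_index_iota => /andP[_ aN].
  by have := sqrt_poly_ge on (x0 a aN); rewrite wE.
Qed.

(** Both outer terms of [sqrt_poly_quadrature] are independent of N, and the middle one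
increases to 2/pi. *)
Lemma wallis_bracket n : odd n -> (wallis n : R) - cbin n * cbin n.+1 <= 2 / pi <= (wallis n : R).
Proof.
move=> on.
have cotE N : (1 < N)%N ->
    (2 : R) / pi * cos (pi / (2 * N%:R)) <= cot (pi / (2 * N%:R)) / N%:R <= (2 : R) / pi.
  move=> N1; have N0 : (0 < N)%N by lia.
  have N0' : 0 < N%:R :> R by rewrite ltr0n.
  set h := pi / _; have h0 : 0 < h by rewrite divr_gt0 ?pi_gt0// mulr_gt0.
  have hpi : h <= pi.
    rewrite /h ler_pdivrMr ?mulr_gt0// ler_peMr ?pi_ge0//.
    by rewrite -natrM ler1n; lia.
  have hpi2 : h <= pi / 2.
    rewrite /h invfM mulrA ler_pdivrMr// ler_peMr ?divr_ge0 ?pi_ge0//.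
    by rewrite ler1n.
  have s0 : 0 < sin h.
    have := @sin_pi_ratio_gt0 R 1 (2 * N)%N; rewrite mul1r natrM; apply; lia.
  have c0 : 0 <= cos h.
    by apply: cos_ge0_pihalf; rewrite hpi2 andbT (le_trans _ (ltW h0))// oppr_le0 divr_ge0 ?pi_ge0.
  have -> : 2 / pi = h^-1 / N%:R :> R.
    rewrite /h; have := pi_gt0 R; move: (pi : R) => p p0; field.
    by rewrite !gt_eqF.
  rewrite /cot; apply/andP; split.
  - rewrite mulrAC ler_pM2r ?invr_gt0// mulrC ler_wpM2l//.
    by rewrite lef_pV2 ?posrE// sin_le_id// ltW.
  - rewrite ler_pM2r ?invr_gt0// ler_pdivrMr// mulrC ler_pdivlMr// mulrC.
    by apply: mul_cos_le_sin; rewrite ltW.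
apply/andP; split.
- have := sqrt_poly_quadrature on (ltnSn n.+1) => /andP[h _].
  apply: le_trans h _; have := cotE n.+2; move=> /(_ isT)/andP[_]; exact.
- have cv : 2 / pi * cos (pi / 2 * harmonic N) @[N --> \oo] --> (2 / pi * cos (pi / 2 * 0) : R).
    apply: cvgMl_tmp; apply: continuous_cvg; first exact: continuous_cos.
    by apply: cvgMl_tmp; exact: cvg_harmonic.
  rewrite mulr0 cos0 mulr1 in cv; apply: (cvgr_to_le cv).
  near=> N; have nN : (n.+1 < N.+1)%N by rewrite ltnS; near: N; exists n.+1.
  have /andP[_ h1] := sqrt_poly_quadrature on nN.
  apply: le_trans h1; have := cotE N.+1; move=> /(_ ltac:(lia))/andP[+ _].
  by rewrite /harmonic /= invfM mulrA.
Unshelve. all: by end_near. Qed.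

End wallis_limit.

(** * The first absolute moment of the squares of Bessel functions *)

Section bessel_law.
Context {R : realType}.
Implicit Types (z : R) (h : R -> nat -> R) (n r j k : nat).

(** The terms of the mean of [h z] under the folded law r |-> J_r(2z)^2. *)
Definition law h z : nat -> R := fun r => mirror_wt r * h z r * J r z ^+ 2.

Definition has_mom h (L : R) : Prop :=
  (forall z, 0 < z -> cvgn (series (law h z))) /\
  limn (series (law h z)) @[z --> +oo] --> L.

Lemma mom_lin (a b : R -> R) (A B : R) h h' (L L' : R) :
  a z @[z --> +oo] --> A -> b z @[z --> +oo] --> B ->
  has_mom h L -> has_mom h' L' ->
  has_mom (fun z r => a z * h z r + b z * h' z r) (A * L + B * L').
Proof.
move=> ca cb [c1 l1] [c2 l2].
have cv z : 0 < z -> series (law (fun z r => a z * h z r + b z * h' z r) z) @ \oo -->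
    a z * limn (series (law h z)) + b z * limn (series (law h' z)).
  move=> z0; have -> : series (law (fun z r => a z * h z r + b z * h' z r) z) =
     (fun n => a z * series (law h z) n + b z * series (law h' z) n).
    apply/funext => n; rewrite /series /= !big_distrr -big_split.
    by apply: eq_bigr => r _; rewrite /law /=; ring.
  by apply: cvgD; apply: cvgMl_tmp; [exact: c1|exact: c2].
split; first by move=> z z0; apply/cvg_ex; eexists; exact: cv.
apply: (@cvg_trans _ ((fun z => a z * limn (series (law h z)) +
   b z * limn (series (law h' z))) @ +oo)).
  apply: near_eq_cvg; near=> z; apply/esym/cvg_lim => //; apply: cv.
  by near: z; exact: nbhs_pinfty_gt.
by apply: cvgD; apply: cvgM.
Unshelve. all: by end_near. Qed.

Lemma eq_mom h h' L : (forall z r, 0 < z -> h z r = h' z r) -> has_mom h L -> has_mom h' L.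
Proof.
move=> E [c l]; have EE z : 0 < z -> law h z = law h' z.
  by move=> z0; apply/funext => r; rewrite /law E.
split=> [z z0|]; first by rewrite -EE//; exact: c.
apply: cvg_trans l; apply: near_eq_cvg; near=> z.
have z0 : 0 < z by near: z; exact: nbhs_pinfty_gt.
by rewrite EE.
Unshelve. all: by end_near. Qed.

(** With r^2 = (r^2 - i^2) + i^2, each power of r is absorbed into the central factorial;
the remainder is of lower order in z. *)
Lemma mom_cfact i j :
  has_mom (fun z r => cfact i r * r%:R ^+ (2 * j) / (2 * z) ^+ (2 * (i + j))) (cbin (i + j)).
Proof.
elim: j i => [|j IH] i.
  have cv z : 0 < z -> series (law (fun z r => cfact i r * r%:R ^+ (2 * 0) /
      (2 * z) ^+ (2 * (i + 0))) z) @ \oo --> cbin i.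
    move=> z0; have -> : series (law (fun z r => cfact i r * r%:R ^+ (2 * 0) /
      (2 * z) ^+ (2 * (i + 0))) z) = (fun n => series (fun r => mirror_wt r * cfact i r * J r z ^+ 2) n
      * ((2 * z) ^+ (2 * i))^-1).
      apply/funext => n; rewrite /series /= big_distrl.
      by apply: eq_bigr => r _; rewrite /law /= addn0 expr0 mulr1; ring.
    have -> : cbin i = 'C(2 * i, i)%:R * z ^+ (2 * i) * ((2 * z) ^+ (2 * i))^-1.
      rewrite /cbin exprMn (_ : 2 ^+ (2 * i) = 4 ^+ i :> R); last by rewrite exprM expr2 -natrM.
      by field; rewrite !expf_neq0// gt_eqF.
    by apply: cvgMr_tmp; exact: bessel_moment.
  split; first by move=> z z0; apply/cvg_ex; eexists; exact: cv.
  have -> : cbin (i + 0) = cbin i :> R by rewrite addn0.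
  apply: cvg_near_cst; near=> z; apply: cvg_lim => //; apply: cv.
  by near: z; exact: nbhs_pinfty_gt.
rewrite -[cbin _]addr0 -[cbin _]mul1r -(mul0r (cbin (i + j))) addnS -addSn.
apply: eq_mom (mom_lin (a := fun=> 1) (b := fun z => i%:R ^+ 2 / (2 * z) ^+ 2) _ _ (IH i.+1) (IH i)).
- move=> z r z0; rewrite cfactS (_ : 2 * (i.+1 + j) = 2 * (i + j) + 2)%N; last by lia.
  rewrite (_ : 2 * j.+1 = 2 * j + 2)%N; last by lia.
  rewrite !exprD mul1r; field.
  by rewrite !expf_neq0// ?mulf_neq0// gt_eqF.
- exact: cvg_cst.
- rewrite -(mulr0 (i%:R ^+ 2 / 4)) -(mulr0 0).
  rewrite (_ : (fun z => _) = (fun z => i%:R ^+ 2 / 4 * (z^-1 * z^-1))).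
    by apply: cvgMl_tmp; apply: cvgM; exact: cvg_inv_pinfty.
  apply/funext => z; rewrite exprMn -invfM -expr2 (_ : 2 ^+ 2 = 4 :> R).
    by rewrite invfM mulrA.
  by rewrite expr2 -natrM.
Unshelve. all: by end_near. Qed.

(** The square of r / 2z, the variable whose law tends to the arcsine law. *)
Definition ratio2 z r : R := (r%:R / (2 * z)) ^+ 2.

(** The mean of u^j (1 - u)^k under the arcsine law, that is B(j + 1/2, k + 1/2) / pi. *)
Definition arcsine_coef k j : R :=
  (2 * k)`!%:R * (2 * j)`!%:R / (4 ^+ (k + j) * (k`!%:R * j`!%:R * (k + j)`!%:R)).

Lemma arcsine_coef0 j : arcsine_coef 0 j = cbin j.
Proof.
rewrite /arcsine_coef /cbin (@binomial_factE _ (2 * j) j j); last by lia.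
have p4 : 4 ^+ j != 0 :> R by rewrite expf_neq0.
by rewrite muln0 !fact0 add0n; field; rewrite p4 !fact_neq0.
Qed.

Lemma arcsine_coef_r0 k : arcsine_coef k 0 = cbin k.
Proof.
rewrite /arcsine_coef /cbin (@binomial_factE _ (2 * k) k k); last by lia.
have p4 : 4 ^+ k != 0 :> R by rewrite expf_neq0.
by rewrite muln0 !fact0 addn0; field; rewrite p4 !fact_neq0.
Qed.

Lemma arcsine_coefS k j : arcsine_coef k.+1 j = arcsine_coef k j - arcsine_coef k j.+1.
Proof.
rewrite /arcsine_coef (_ : 2 * k.+1 = (2 * k).+2)%N; last by lia.
rewrite (_ : 2 * j.+1 = (2 * j).+2)%N; last by lia.
rewrite addnS addSn !factS !natrM !exprS.
have E n : (2 * n).+2%:R = 2 * n%:R + 2 :> R by rewrite -natr1 -natr1 natrM; ring.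
have E' n : (2 * n).+1%:R = 2 * n%:R + 1 :> R by rewrite -natr1 natrM.
rewrite !E !E' -(natr1 (k + j)%N) -(natr1 k) -(natr1 j) natrD.
have k1 : k%:R + 1 != 0 :> R by rewrite natr1 pnatr_eq0.
have j1 : j%:R + 1 != 0 :> R by rewrite natr1 pnatr_eq0.
have kj1 : k%:R + j%:R + 1 != 0 :> R by rewrite -natrD natr1 pnatr_eq0.
have p4 : 4 ^+ (k + j) != 0 :> R by rewrite expf_neq0.
by field; rewrite p4 !fact_neq0 k1 j1 kj1.
Qed.

(** Induction on the exponent of 1 - u, both sides obeying the same recursion
([arcsine_coefS]). *)
Lemma mom_mixed k j :
  has_mom (fun z r => ratio2 z r ^+ j * (1 - ratio2 z r) ^+ k) (arcsine_coef k j).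
Proof.
elim: k j => [|k IH] j.
  rewrite arcsine_coef0; have := mom_cfact 0 j; rewrite add0n; apply: eq_mom.
  move=> z r z0; rewrite /cfact big_ord0 mul1r expr0 mulr1 /ratio2.
  by rewrite -exprM expr_div_n.
rewrite arcsine_coefS -[arcsine_coef k j]mul1r -mulN1r.
apply: eq_mom (mom_lin (a := fun=> 1) (b := fun=> -1) _ _ (IH j) (IH j.+1)).
- by move=> z r _; rewrite !exprS; ring.
- exact: cvg_cst.
- exact: cvg_cst.
Qed.

Lemma mom_sqrt_poly n : has_mom (fun z r => sqrt_poly n (1 - ratio2 z r)) (wallis n).
Proof.
rewrite -wallisE /sqrt_poly; elim: n => [|n IH].
  have -> : \sum_(k < 1) dbin k * cbin k =
      dbin 0 * arcsine_coef 0 0 + 0 * arcsine_coef 0 0 :> R.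
    by rewrite big_ord1 arcsine_coef0 mul0r addr0.
  apply: eq_mom (mom_lin (a := fun=> dbin 0) (b := fun=> 0) _ _ (mom_mixed 0 0) (mom_mixed 0 0)).
  - by move=> z r _; rewrite big_ord1 !expr0; ring.
  - exact: cvg_cst.
  - exact: cvg_cst.
rewrite big_ord_recr /= -[X in X + _]mul1r -arcsine_coef_r0.
apply: eq_mom (mom_lin (a := fun=> 1) (b := fun=> dbin n.+1) _ _ IH (mom_mixed n.+1 0)).
- by move=> z r _; rewrite [in RHS]big_ord_recr /= expr0; ring.
- exact: cvg_cst.
- exact: cvg_cst.
Qed.

Lemma mom_sqrt_poly_tail n :
  has_mom (fun z r => sqrt_poly n (1 - ratio2 z r) - cbin n * (1 - ratio2 z r) ^+ n.+1)
    (wallis n - cbin n * cbin n.+1).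
Proof.
have -> : wallis n - cbin n * cbin n.+1 =
    1 * wallis n + - cbin n * arcsine_coef n.+1 0 by rewrite arcsine_coef_r0; ring.
apply: eq_mom (mom_lin (a := fun=> 1) (b := fun=> - cbin n) _ _ (mom_sqrt_poly n) (mom_mixed n.+1 0)).
- by move=> z r _; rewrite expr0; ring.
- exact: cvg_cst.
- exact: cvg_cst.
Qed.

Lemma cvg_J_sum z : cvgn (series (fun r => r%:R * J r z ^+ 2)).
Proof.
apply: (series_le_cvg _ _ _ (@cvg_exp_scaled R (expR (z ^+ 2) ^+ 2) (2 * z ^+ 2))).
- by move=> r; rewrite mulr_ge0// sqr_ge0.
- by move=> r; rewrite mulr_ge0 ?exprn_ge0 ?expR_ge0// exp_coeff_ge0// mulr_ge0// sqr_ge0.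
- move=> r; rewrite [leRHS](_ : _ = 2 ^+ r * (expR (z ^+ 2) ^+ 2 * exp_coeff (z ^+ 2) r)); last first.
    by rewrite /exp_coeff /= exprMn; ring.
  apply: ler_pM => //; first exact: sqr_ge0.
    by rewrite -natrX ler_nat ltnW// ltn_expl.
  rewrite -[J r z ^+ 2]real_normK ?num_real//.
  apply: le_trans (bes_bound2 r z); rewrite ler_sqr ?nnegrE//; first exact: J_bound.
  exact: le_trans (normr_ge0 _) (J_bound r z).
Qed.

Definition J_sum z : R := limn (series (fun r => r%:R * J r z ^+ 2)).

(** J_sum z / z is the mean of |r| / 2z, i.e. of the square root of [ratio2]. The mean lies
between those of the two enclosing polynomials; their limits differ by the small
quantity of [cbin_small] and enclose 2/pi by [wallis_bracket]. *)
Lemma J_sum_asymp : J_sum z / z @[z --> +oo] --> 2 / (pi : R).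
Proof.
apply/cvgrPdist_le => e e0; have e2 : 0 < e / 2 by rewrite divr_gt0.
(* The degree n is fixed first, z tends to infinity afterwards. *)
have [n on hn] := cbin_small e2.
have /andP[w1 w2] := @wallis_bracket R n on.
have [c1 /cvgrPdist_le/(_ _ e2) l1] := mom_sqrt_poly n.
have [c2 /cvgrPdist_le/(_ _ e2) l2] := mom_sqrt_poly_tail n.
near=> z; have z0 : 0 < z by near: z; exact: nbhs_pinfty_gt.
have m1 : `|wallis n - limn (series (law (fun z r => sqrt_poly n (1 - ratio2 z r)) z))| <= e / 2.
  by near: z; exact: l1.
have m2 : `|wallis n - cbin n * cbin n.+1 - limn (series (law (fun z r =>
    sqrt_poly n (1 - ratio2 z r) - cbin n * (1 - ratio2 z r) ^+ n.+1) z))| <= e / 2.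
  by near: z; exact: l2.
have lawE r : law (fun z r => r%:R / (2 * z)) z r = (r%:R * J r z ^+ 2) / z.
  rewrite /law; case: r => [|r]; first by rewrite !mul0r mulr0 mul0r.
  by rewrite /mirror_wt; field; rewrite gt_eqF.
have cS : series (law (fun z r => r%:R / (2 * z)) z) @ \oo --> J_sum z / z.
  rewrite (_ : series _ = (fun n => series (fun r => r%:R * J r z ^+ 2) n / z)).
    by apply: cvgMr_tmp; exact: cvg_J_sum.
  by apply/funext => k; rewrite /series /= big_distrl; apply: eq_bigr => r _; rewrite lawE.
have r0 r : 0 <= r%:R / (2 * z) by rewrite divr_ge0// mulr_ge0// ltW.
have u1 : J_sum z / z <= limn (series (law (fun z r => sqrt_poly n (1 - ratio2 z r)) z)).
  rewrite -(cvg_lim _ cS)//; apply: ler_lim; [by apply/cvg_ex; eexists; exact: cS|exact: c1|].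
  apply: nearW => k; apply: ler_sum => r _; rewrite /law.
  by rewrite ler_wpM2r ?sqr_ge0// ler_wpM2l ?mirror_wt_ge0// sqrt_poly_ge.
have u2 : limn (series (law (fun z r => sqrt_poly n (1 - ratio2 z r)
     - cbin n * (1 - ratio2 z r) ^+ n.+1) z)) <= J_sum z / z.
  rewrite -(cvg_lim _ cS)//; apply: ler_lim; [exact: c2|by apply/cvg_ex; eexists; exact: cS|].
  apply: nearW => k; apply: ler_sum => r _; rewrite /law.
  by rewrite ler_wpM2r ?sqr_ge0// ler_wpM2l ?mirror_wt_ge0// sqrt_poly_le.
move: m1 m2; rewrite !ler_distl => /andP[a1 a1'] /andP[a2 a2'].
by apply/andP; split; lra.
Unshelve. all: by end_near. Qed.

(** The case k = 0 of [bessel_moment]: total mass 1. *)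
Lemma J_square_sum z : series (fun r => mirror_wt r * J r z ^+ 2) @ \oo --> (1 : R).
Proof.
have := @bessel_moment R 0 z; rewrite bin0 mul1r expr0.
by under eq_fun do rewrite /cfact big_ord0 mulr1.
Qed.

End bessel_law.

(** * First and second moments of waves *)

Section poissonised_moments.
Context {R : realType}.
Implicit Types (t z : R) (F : intpart -> R).

(** The coefficients after Poissonisation: the binomial transform over the levels is undone
and only 1 / k!^2 remains. *)
Definition poisson_coef t (c : nat -> R) k : R := t ^+ k / k`!%:R ^+ 2 * c k.

(** t^n / n!^2 * 'C(n, k) * n!/k! = t^k / k!^2 * t^(n-k) / (n-k)!, so the series over the
levels is the Cauchy product of the coefficients with the exponential series, whose sum
cancels exp (-t). *)
Lemma expectation_coef t F (C : R) (c : nat -> R) : 0 < t ->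
  (forall la, `|F la| <= C * 4 ^+ psize la) ->
  (forall n, level_sum F n = \sum_(k < n.+1) 'C(n, k)%:R * (n ^_ (n - k))%:R * c k) ->
  cvgn (series (fun k => `|poisson_coef t c k|)) ->
  F \in Lfun (plancherel t) 1 /\
  ('E_(plancherel t)[F] = (limn (series (poisson_coef t c))%R)%:E)%E.
Proof.
move=> t0 FC Fc cc; have [LF cF ->] := expectation_level_series t0 FC; split=> //.
congr (_%:E); apply: cvg_lim => //.
have -> : series (fun n => level_weight t n * level_sum F n) =
    (fun n => expR (- t) * series (cauchy_prod (poisson_coef t c) (exp_coeff t)) n).
  apply/funext => n; rewrite /series /= big_distrr; apply: eq_bigr => m _ /=.
  rewrite /level_weight -mulrA; congr (_ * _); rewrite Fc /cauchy_prod big_distrr.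
  apply: eq_bigr => k _ /=; have kn : (k <= m)%N by rewrite -ltnS.
  have tE : t ^+ m = t ^+ k * t ^+ (m - k) by rewrite -exprD subnKC.
  rewrite /poisson_coef /exp_coeff /= tE.
  rewrite (@binomial_factE _ _ _ (m - k)); last by lia.
  have -> : (m ^_ (m - k))%:R = m`!%:R / k`!%:R :> R.
    have := @ffact_fact m (m - k) (leq_subr _ _); rewrite subKn// => <-.
    by rewrite natrM mulfK ?fact_neq0.
  by field; rewrite !fact_neq0.
(* The factor exp (-t) of the weights against the sum exp t of the second series. *)
have e1 : expR (- t) * (limn (series (poisson_coef t c)) * expR t) = limn (series (poisson_coef t c)).
  by rewrite mulrCA -expRD addNr expR0 mulr1.
rewrite -[X in _ --> X]e1; apply: cvgMl_tmp; apply: cvg_series_cauchy_prod => //.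
have := is_cvg_series_exp_coeff `|t|; rewrite -normed_series_exp_coeff//.
Qed.

End poissonised_moments.

Section waves.
Context {R : realType}.
Implicit Types (t z th al ph be : R).

(** The factor by which a discrete difference scales a wave. *)
Definition amp th : R := 2 * sin (th / 2).
(** The Bessel functions of a wave are taken at this argument. *)
Definition freq t th : R := Num.sqrt t * amp th.

Lemma cosD_natpi x n : cos (x + n%:R * pi) = (-1) ^+ n * cos x :> R.
Proof.
elim: n => [|n IH]; first by rewrite mul0r addr0 mul1r.
by rewrite -natr1 mulrDl mul1r addrA cosDpi IH exprS mulN1r mulNr.
Qed.

Lemma mean_term_wave th al k : mean_term (wave th al) k.+1 =
  (-1) ^+ k.+1 * amp th ^+ (2 * k).+1 * sin (al - th / 2).
Proof.
rewrite /mean_term iter_diff_wave /wave rmorph0 mulr0 add0r -/(amp th).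
rewrite (_ : k.+1 + k = (2 * k).+1)%N; last by lia.
rewrite [X in cos X](_ : _ = (al - th / 2) + pi / 2 + k%:R * pi); last first.
  by rewrite -(natr1 (2 * k)%N) -(natr1 k) natrM; field.
by rewrite cosD_natpi cosDpihalf [(-1) ^+ k.+1]exprS; ring.
Qed.

Lemma bes0_0 z : bes 0 z 0 = 1.
Proof. by rewrite /bes /= !mulr1 divr1. Qed.

(** The quotient is 0 when the amplitude is 0, in agreement with a constant wave having a
linear statistic equal to 0. *)
Definition wave_mean t th al : R := sin (al - th / 2) / amp th * (J 0 (freq t th) - 1).

Lemma poisson_coef_wave t th al k : 0 <= t ->
  poisson_coef t (mean_term (wave th al)) k =
  sin (al - th / 2) / amp th * (bes 0 (freq t th) k - (k == 0%N)%:R).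
Proof.
move=> t0; case: k => [|k].
  by rewrite /poisson_coef /= mulr0 bes0_0 subrr mulr0.
rewrite /poisson_coef mean_term_wave subr0 /bes !addn0.
have [A0|A0] := eqVneq (amp th) 0.
  by rewrite A0 invr0 mulr0 mul0r expr0n /= mulr0 mul0r mulr0.
have -> : freq t th ^+ (2 * k.+1) = t ^+ k.+1 * (amp th * amp th ^+ (2 * k).+1).
  by rewrite /freq exprMn exprM sqr_sqrtr// -exprS; congr (_ * _ ^+ _); lia.
field.
by rewrite fact_neq0 A0.
Qed.

Lemma cvg_norm_poisson_wave t th al : 0 <= t ->
  cvgn (series (fun k => `|poisson_coef t (mean_term (wave th al)) k|)).
Proof.
move=> t0; set q := sin (al - th / 2) / amp th.
apply: (series_le_cvg (v_ := fun k => `|q| * `|bes 0 (freq t th) k|)) => //.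
- move=> k; rewrite poisson_coef_wave// normrM ler_wpM2l//.
  case: k => [|k]; last by rewrite subr0.
  by rewrite bes0_0 subrr normr0.
- rewrite (_ : series _ = (fun n => `|q| * series (fun k => `|bes 0 (freq t th) k|) n)).
    by apply/cvg_ex; eexists; apply: cvgMl_tmp; exact: cvg_norm_bes.
  by apply/funext => n; rewrite /series /= big_distrr.
Qed.

Lemma lim_poisson_wave t th al : 0 <= t ->
  limn (series (poisson_coef t (mean_term (wave th al)))) = wave_mean t th al.
Proof.
move=> t0; apply: cvg_lim => //.
rewrite -cvg_shiftS.
rewrite (_ : (fun n => _) = (fun n => sin (al - th / 2) / amp th *
   (series (bes 0 (freq t th)) n.+1 - 1))).
  apply: cvgMl_tmp; apply: cvgB; last exact: cvg_cst.
  by have := @cvg_bes R 0 (freq t th); rewrite -cvg_shiftS.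
apply/funext => n; rewrite /series /=; under eq_bigr do rewrite poisson_coef_wave//.
rewrite -big_distrr /= sumrB; congr (_ * (_ - _)).
by rewrite big_nat_recl//= big1 ?addr0.
Qed.

(** The coefficient of J_m J'_m in the covariance of two waves: the two-point function of
the waves with their amplitudes and signs removed. *)
Definition pair_phase th al ph be m : R :=
  \sum_(0 <= p < m) cos (th * (- p%:R - 1) + al + m%:R * (th / 2) + m%:R * (pi / 2)) *
    cos (ph * (- p%:R - 1 + m%:R) + be - m%:R * (ph / 2) + m%:R * (pi / 2)).

(** The phases of the differences of order k - u and k - v, u and v contain the half-turns
(k - v) pi and u pi, which give the signs of the two Bessel series. *)
Lemma pair_coef_wave th al ph be k u v : (u < v)%N -> (v <= k)%N ->
  pair_coef (wave th al) (wave ph be) k u v =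
  (-1) ^+ u * (-1) ^+ (k - v) * amp th ^+ (u + v) * amp ph ^+ (k - u + (k - v)) *
    pair_phase th al ph be (v - u).
Proof.
move=> uv vk; rewrite /pair_coef /pair_phase big_distrr; apply: eq_bigr => p _ /=.
set m := (v - u)%N; have mE : v = (u + m)%N by rewrite /m; lia.
rewrite !iter_diff_wave /wave -/(amp th) -/(amp ph).
rewrite [X in _ * cos X * _](_ : _ = th * (- p%:R - 1) + al + m%:R * (th / 2) + m%:R * (pi / 2)
    + u%:R * pi); last first.
  by rewrite mE !natrD rmorphB rmorphN /=; field.
rewrite [X in _ * (_ * cos X)](_ : _ = ph * (- p%:R - 1 + m%:R) + be - m%:R * (ph / 2)
    + m%:R * (pi / 2) + (k - v)%N%:R * pi); last first.
  rewrite (_ : k - u = k - v + m)%N; last by lia.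
  by rewrite !natrD rmorphD rmorphB rmorphN /=; field.
rewrite !cosD_natpi; ring.
Qed.

Definition pair_coefs th al ph be k : R :=
  \sum_(u < k.+1) \sum_(v < k.+1 | (u < v)%N) 'C(k, u)%:R * 'C(k, v)%:R *
    pair_coef (wave th al) (wave ph be) k u v.

(** The gap m = v - u becomes the index of the Bessel functions. *)
Lemma sum_pairs_by_gap (H : nat -> nat -> R) K :
  \sum_(u < K) \sum_(v < K | (u < v)%N) H u v =
  \sum_(m < K | (0 < m)%N) \sum_(u < K - m) H u (u + m)%N.
Proof.
have E (u : 'I_K) : \sum_(v < K | (u < v)%N) H u v =
    \sum_(m < K) if (0 < m)%N && (u + m < K)%N then H u (u + m)%N else 0.
  rewrite -(big_mkord (fun v => (u < v)%N) (H u)) -(big_mkord xpredT (fun m =>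
    if (0 < m)%N && (u + m < K)%N then H u (u + m)%N else 0)).
  have uK := ltn_ord u.
  rewrite [LHS](big_cat_nat (n := u.+1))//= [X in X + _]big1_seq ?add0r => [|v]; last first.
    by rewrite mem_index_iota => /andP[uv /andP[_ vu]]; move: uv vu; lia.
  rewrite [RHS](big_cat_nat (n := K - u))//=; last by lia.
  rewrite [X in _ + X]big1_seq ?addr0 => [|m]; last first.
    by rewrite mem_index_iota => /andP[_ /andP[mK _]]; rewrite ifF//; lia.
  rewrite [RHS](big_cat_nat (n := 1))//=; last by lia.
  rewrite big_nat1 add0r [in LHS](_ : u.+1 = 1 + u)%N//.
  rewrite big_addn big_nat_cond [RHS]big_nat_cond.
  apply: eq_big => [m|m /andP[mK _]]; first by lia.
  by rewrite ifT 1?addnC//; lia.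
rewrite (eq_bigr _ (fun u _ => E u)) exchange_big [RHS]big_mkcond.
apply: eq_bigr => m _ /=; case: ifPn => m0; last by rewrite big1.
have mK := ltn_ord m.
rewrite -(big_mkord xpredT (fun u => if (u + m < K)%N then H u (u + m)%N else 0)).
rewrite (big_cat_nat (n := K - m))//=; last by lia.
rewrite [X in _ + X]big1_seq ?addr0 => [|u]; last first.
  by rewrite mem_index_iota => /andP[_ /andP[uK _]]; rewrite ifF//; lia.
rewrite -(big_mkord xpredT (fun u => H u (u + m)%N)).
by apply: eq_big_nat => u /andP[_ uK]; rewrite ifT//; lia.
Qed.

(** Splitting t^k / k!^2 and the two binomial coefficients between u and k - v turns the
summands into products of one term of each Bessel series. *)
Lemma poisson_pair_coefs t th al ph be k : 0 <= t ->
  poisson_coef t (pair_coefs th al ph be) k =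
  \sum_(m < k.+1) pair_phase th al ph be m *
    cauchy_prod (bes m (freq t th)) (bes m (freq t ph)) (k - m)%N.
Proof.
move=> t0; rewrite /poisson_coef /pair_coefs.
rewrite (sum_pairs_by_gap (fun u v => 'C(k, u)%:R * 'C(k, v)%:R *
    pair_coef (wave th al) (wave ph be) k u v)).
rewrite big_distrr [LHS]big_mkcond /=; apply: eq_bigr => m _.
case: ifPn => [m0|]; last first.
  by rewrite lt0n negbK => /eqP ->; rewrite /pair_phase big_geq// mul0r.
have mk : (m <= k)%N by rewrite -ltnS.
rewrite subSn// /cauchy_prod !big_distrr /=; apply: eq_bigr => u _.
have uk : (u <= k - m)%N by rewrite -ltnS.
rewrite pair_coef_wave; [|lia..].
set v' := (k - m - u)%N.
rewrite (_ : u + m - u = m)%N; last by lia.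
rewrite (_ : k - (u + m) = v')%N; last by rewrite /v'; lia.
rewrite (_ : k - u = v' + m)%N; last by rewrite /v'; lia.
rewrite (@binomial_factE _ k u (v' + m)); last by rewrite /v'; lia.
rewrite (@binomial_factE _ k (u + m) v'); last by rewrite /v'; lia.
rewrite /bes /freq !exprMn.
have sE : t ^+ k = Num.sqrt t ^+ (2 * u + m) * Num.sqrt t ^+ (2 * v' + m).
  rewrite -exprD (_ : 2 * u + m + (2 * v' + m) = 2 * k)%N; last by rewrite /v'; lia.
  by rewrite exprM sqr_sqrtr.
rewrite sE (_ : u + (u + m) = 2 * u + m)%N; last by lia.
rewrite (_ : v' + m + v' = 2 * v' + m)%N; last by lia.
by field; rewrite !fact_neq0.
Qed.

End waves.

Section wave_moments.
Context {R : realType}.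
Implicit Types (t z th al ph be : R).

Lemma pair_phase_bound th al ph be m : `|pair_phase th al ph be m| <= m%:R.
Proof.
rewrite /pair_phase; apply: le_trans (ler_norm_sum _ _ _) _.
apply: (@le_trans _ _ (\sum_(0 <= p < m) 1)); last by rewrite sumr_const_nat subn0.
apply: ler_sum => p _; rewrite normrM -[1]mulr1.
by apply: ler_pM => //; exact: cos_max.
Qed.

Definition sq_bound z m : R := expR (z ^+ 2) ^+ 2 * exp_coeff (2 * z ^+ 2) m.

(** Since m <= 2^m, the linear growth of [pair_phase] does not spoil the factorial decay of
the Bessel bounds. *)
Lemma weighted_bes_bound z w m : m%:R * (bes_bound m z * bes_bound m w) <= sq_bound z m + sq_bound w m.
Proof.
have b0 x : 0 <= bes_bound m x :> R by exact: le_trans (normr_ge0 _) (J_bound m x).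
have h x : 2 ^+ m * (bes_bound m x ^+ 2) <= sq_bound x m.
  rewrite /sq_bound (_ : exp_coeff _ _ = 2 ^+ m * exp_coeff (x ^+ 2) m); last first.
    by rewrite /exp_coeff /= exprMn; ring.
  by rewrite [leRHS]mulrCA ler_wpM2l ?exprn_ge0// bes_bound2.
have m2 : m%:R <= 2 ^+ m :> R by rewrite -natrX ler_nat ltnW// ltn_expl.
apply: le_trans (lerD (h z) (h w)); rewrite -mulrDr.
apply: ler_pM => //; first by rewrite mulr_ge0.
have := sqr_ge0 (bes_bound m z - bes_bound m w).
have := sqr_ge0 (bes_bound m z); have := sqr_ge0 (bes_bound m w); nra.
Qed.

Lemma cvg_sq_bound z w : cvgn (series (fun m => sq_bound z m + sq_bound w m)).
Proof.
rewrite (_ : series _ = (fun n => series (sq_bound z) n + series (sq_bound w) n)).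
  by apply: is_cvgD; exact: cvg_exp_scaled.
by apply/funext => n; rewrite /series /= big_split.
Qed.

Definition pair_sum t th al ph be : R :=
  limn (series (fun m => pair_phase th al ph be m * (J m (freq t th) * J m (freq t ph)))).

Lemma poisson_pair_sum t th al ph be : 0 <= t ->
  cvgn (series (fun k => `|poisson_coef t (pair_coefs th al ph be) k|)) /\
  limn (series (poisson_coef t (pair_coefs th al ph be))) = pair_sum t th al ph be.
Proof.
move=> t0; set z := freq t th; set w := freq t ph.
pose D m k := pair_phase th al ph be m * cauchy_prod (bes m z) (bes m w) k.
have DB m n : series (fun k => `|D m k|) n <= sq_bound z m + sq_bound w m.
  rewrite (_ : series _ _ = `|pair_phase th al ph be m| *
      series (fun k => `|cauchy_prod (bes m z) (bes m w) k|) n); last first.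
    by rewrite /series /= big_distrr; apply: eq_bigr => k _; rewrite /D normrM.
  apply: le_trans (weighted_bes_bound z w m).
  apply: ler_pM => //; first by rewrite sumr_ge0.
    exact: pair_phase_bound.
  by apply: series_norm_cauchy_prod_bound => k; exact: series_norm_bes.
have limD m : limn (series (D m)) = pair_phase th al ph be m * (J m z * J m w).
  apply: cvg_lim => //.
  rewrite (_ : series (D m) = (fun n => pair_phase th al ph be m *
      series (cauchy_prod (bes m z) (bes m w)) n)).
    by apply: cvgMl_tmp; apply: cvg_series_cauchy_prod; exact: cvg_norm_bes.
  by apply/funext => n; rewrite /series /= big_distrr.
have [h1 h3] := diag_sum DB (@cvg_sq_bound z w).
have E1 : (fun k => \sum_(m < k.+1) D m (k - m)%N) = poisson_coef t (pair_coefs th al ph be).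
  by apply/funext => k; rewrite poisson_pair_coefs.
have E2 : (fun m => limn (series (D m))) =
    (fun m => pair_phase th al ph be m * (J m z * J m w)).
  by apply/funext => m; rewrite limD.
split.
- by move: h1; under eq_fun do rewrite -/(D _ _); rewrite -E1.
- by rewrite -E1 /pair_sum -/z -/w -E2; apply: cvg_lim.
Qed.

Lemma linstat_growth (f : int -> R) la : (forall x, `|f x| <= 1) ->
  `|linstat f la| <= 2 * 2 ^+ psize la.
Proof.
move=> f1; apply: le_trans (linstat_bound la f1) _; rewrite mulr1 ler_wpM2l//.
by rewrite -natrX ler_nat ltnW// ltn_expl.
Qed.

Lemma growth2 n : (2 ^+ n) * (2 ^+ n) = 4 ^+ n :> R.
Proof. by rewrite -exprMn -natrM. Qed.

Lemma linstat_growth1 (f : int -> R) la : (forall x, `|f x| <= 1) ->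
  `|linstat f la| <= 4 * 4 ^+ psize la.
Proof.
move=> f1; apply: le_trans (linstat_growth la f1) _.
apply: ler_pM => //; first by rewrite ler_nat.
by rewrite lerXn2r ?nnegrE// ler_nat.
Qed.

Lemma linstat_growth2 (f g : int -> R) la : (forall x, `|f x| <= 1) -> (forall x, `|g x| <= 1) ->
  `|linstat f la * linstat g la| <= 4 * 4 ^+ psize la.
Proof.
move=> f1 g1; rewrite normrM.
apply: le_trans (ler_pM _ _ (linstat_growth la f1) (linstat_growth la g1)) _ => //.
by rewrite mulrACA growth2 -natrM.
Qed.

Lemma wave_first_moment t th al : 0 < t ->
  linstat (wave th al) \in Lfun (plancherel t) 1 /\
  ('E_(plancherel t)[linstat (wave th al)] = (wave_mean t th al)%:E)%E.
Proof.
move=> t0; have t0' := ltW t0; rewrite -lim_poisson_wave//.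
apply: (expectation_coef t0 (C := 4)).
- by move=> la; apply: linstat_growth1; exact: wave_bound.
- by move=> n; exact: level_linstat.
- exact: cvg_norm_poisson_wave.
Qed.

(** The product-of-means part of [level_linstat2] is a Cauchy product after Poissonisation
and gives the product of the expectations; [pair_sum] is the covariance. *)
Lemma wave_second_moment t th al ph be : 0 < t ->
  (fun la => linstat (wave th al) la * linstat (wave ph be) la) \in Lfun (plancherel t) 1 /\
  ('E_(plancherel t)[fun la => (linstat (wave th al) la * linstat (wave ph be) la)%R] =
    (wave_mean t th al * wave_mean t ph be + pair_sum t th al ph be)%R%:E)%E.
Proof.
move=> t0; have t0' := ltW t0.
have [p1 p3] := poisson_pair_sum th al ph be t0'.
have c1 := @cvg_norm_poisson_wave R t th al t0'; have c2 := @cvg_norm_poisson_wave R t ph be t0'.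
pose c k := \sum_(u < k.+1) 'C(k, u)%:R ^+ 2 *
  (mean_term (wave th al) u * mean_term (wave ph be) (k - u)) + pair_coefs th al ph be k.
have cE k : poisson_coef t c k =
    cauchy_prod (poisson_coef t (mean_term (wave th al)))
      (poisson_coef t (mean_term (wave ph be))) k + poisson_coef t (pair_coefs th al ph be) k.
  rewrite {1}/poisson_coef /c mulrDr; congr (_ + _).
  rewrite big_distrr; apply: eq_bigr => u _ /=; have uk : (u <= k)%N by rewrite -ltnS.
  rewrite /poisson_coef (@binomial_factE _ k u (k - u)); last by lia.
  have -> : t ^+ k = t ^+ u * t ^+ (k - u) by rewrite -exprD subnKC.
  by field; rewrite !fact_neq0.
have -> : wave_mean t th al * wave_mean t ph be + pair_sum t th al ph be =
    limn (series (poisson_coef t c)).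
  apply/esym/cvg_lim => //.
  rewrite (_ : series _ = (fun n =>
      series (cauchy_prod (poisson_coef t (mean_term (wave th al)))
      (poisson_coef t (mean_term (wave ph be)))) n +
      series (poisson_coef t (pair_coefs th al ph be)) n)); last first.
    by apply/funext => n; rewrite /series /= -big_split; apply: eq_bigr => k _; rewrite cE.
  apply: cvgD; first by rewrite -!lim_poisson_wave//; exact: cvg_series_cauchy_prod.
  by rewrite -p3; have h : cvgn (series (poisson_coef t (pair_coefs th al ph be))) by exact: normed_cvg.
apply: (expectation_coef t0 (C := 4)).
- by move=> la; apply: linstat_growth2; exact: wave_bound.
- by move=> n; exact: level_linstat2.
- apply: (series_le_cvg (v_ := fun k =>
    `|cauchy_prod (poisson_coef t (mean_term (wave th al)))
      (poisson_coef t (mean_term (wave ph be))) k| +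
    `|poisson_coef t (pair_coefs th al ph be) k|)) => //.
    by move=> k; rewrite cE ler_normD.
  rewrite (_ : series _ = (fun n =>
    series (fun k => `|cauchy_prod (poisson_coef t (mean_term (wave th al)))
      (poisson_coef t (mean_term (wave ph be))) k|) n +
    series (fun k => `|poisson_coef t (pair_coefs th al ph be) k|) n)).
    by apply: is_cvgD => //; exact: is_cvg_series_norm_cauchy_prod.
  by apply/funext => n; rewrite /series /= big_split.
Qed.

Lemma expectation_lin_comb t (I : Type) (s : seq I) (c : I -> R) (F : I -> intpart -> R) (m : I -> R) :
  (forall a, F a \in Lfun (plancherel t) 1) ->
  (forall a, ('E_(plancherel t)[F a] = (m a)%:E)%E) ->
  (fun la => \sum_(a <- s) c a * F a la) \in Lfun (plancherel t) 1 /\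
  ('E_(plancherel t)[fun la => (\sum_(a <- s) c a * F a la)%R] =
    (\sum_(a <- s) c a * m a)%R%:E)%E.
Proof.
move=> FL Fm; elim: s => [|a s [IH1 IH2]].
  rewrite big_nil (_ : (fun=> _) = cst 0); last by apply/funext => la; rewrite big_nil.
  by rewrite expectation_cst; split => //; exact: Lfun_cst.
have -> : (fun la => \sum_(b <- a :: s) c b * F b la) =
    (c a \o* F a) \+ (fun la => \sum_(b <- s) c b * F b la).
  by apply/funext => la; rewrite big_cons /= mulrC.
have L1 : (c a \o* F a) \in Lfun (plancherel t) 1.
  apply/Lfun1_integrable; rewrite (_ : _ \o _ = (fun x => (c a)%:E * (F a x)%:E)%E).
    by apply: integrableZl => //; apply/Lfun1_integrable.
  by apply/funext => x /=; rewrite mulrC EFinM.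
split; first exact: rpredD.
by rewrite expectationD// expectationZl// IH2 Fm big_cons.
Qed.

End wave_moments.

(** * Bounded and linear parts of the covariance coefficients *)

Section bessel_sums.
Context {R : realType}.
Implicit Types (t z w th al ph be K : R) (C : nat -> R).

(** If the sine vanished, the angle 2 pi m / N would be a multiple of 2 pi, and the sum of
[sum_cos_roots] would be N instead of 0. *)
Lemma sin_pi_int_neq0 N (m : int) : (0 < N)%N -> ~~ (N%:Z %| m)%Z ->
  sin (m%:~R * (pi / N%:R)) != 0 :> R.
Proof.
move=> N0 Nm; have N0' : N%:R != 0 :> R by rewrite pnatr_eq0 -lt0n.
apply/negP => /eqP s0.
have := @sum_cos_roots R N m N0; rewrite (negPf Nm).
have c1 a : cos (m%:~R * (2 * pi / N%:R) * a%:R) = 1 :> R.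
  have -> : m%:~R * (2 * pi / N%:R) * a%:R = (m%:~R * (2 * pi / N%:R)) *+ a :> R.
    by rewrite mulr_natr.
  have [cx sx] : cos (m%:~R * (2 * pi / N%:R)) = 1 :> R /\ sin (m%:~R * (2 * pi / N%:R)) = 0 :> R.
    have -> : m%:~R * (2 * pi / N%:R) = (m%:~R * (pi / N%:R)) *+ 2 :> R.
      by rewrite -mulr_natr; ring.
    by rewrite cos_mulr2n sin_mulr2n cos2sin2 s0 mulr0 mul0rn expr0n /= subr0 mulr2n addrK.
  suff [-> _] : cos ((m%:~R * (2 * pi / N%:R)) *+ a) = 1 :> R /\
    sin ((m%:~R * (2 * pi / N%:R)) *+ a) = 0 :> R by [].
  elim: a => [|a [IHc IHs]]; first by rewrite mulr0n cos0 sin0.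
  by rewrite mulrSr cosD sinD IHc IHs cx sx !mulr1 !mulr0 subr0 addr0.
under eq_bigr do rewrite c1.
by rewrite sumr_const_nat subn0 => /eqP; rewrite (negPf N0').
Qed.

Lemma J_square_partial z n : series (fun m => J m z ^+ 2) n <= 1.
Proof.
have h := J_square_sum z.
apply: (@le_trans _ _ (series (fun r => mirror_wt r * J r z ^+ 2) n)).
  apply: ler_sum => r _; rewrite ler_peMl ?sqr_ge0//.
  by case: r => //= r; rewrite ler1n.
rewrite -(cvg_lim _ h)//; apply: nondecreasing_cvgn_le.
  by apply: nondecreasing_series => r _ _; rewrite mulr_ge0 ?mirror_wt_ge0 ?sqr_ge0.
by apply/cvg_ex; exists 1.
Qed.

Lemma J0_le1 z : `|J 0 z| <= 1.
Proof.
have := J_square_partial z 1; rewrite /series /= big_nat1 => h.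
by rewrite -(@ler_sqr _ `|_|) ?nnegrE// expr1n real_normK ?num_real.
Qed.

(** Because the squares of the Bessel functions sum to at most 1, bounded coefficients give
a contribution that is bounded uniformly in the arguments, that is in t. *)
Lemma bounded_J_sum C K z w : (forall m, `|C m| <= K) ->
  cvgn (series (fun m => C m * (J m z * J m w))) /\
  `|limn (series (fun m => C m * (J m z * J m w)))| <= K.
Proof.
move=> CK; have K0 : 0 <= K by exact: le_trans (CK 0%N).
have bnd n : series (fun m => `|C m * (J m z * J m w)|) n <= K.
  apply: (@le_trans _ _ (\sum_(0 <= m < n) K * (2^-1 * (J m z ^+ 2 + J m w ^+ 2)))).
    apply: ler_sum => m _; rewrite normrM; apply: ler_pM => //.
    rewrite normrM -[J m z ^+ 2]real_normK ?num_real// -[J m w ^+ 2]real_normK ?num_real//.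
    by have := sqr_ge0 (`|J m z| - `|J m w|); nra.
  rewrite -big_distrr -big_distrr big_split /= -[leRHS]mulr1 ler_wpM2l//.
  have := J_square_partial z n; have := J_square_partial w n; rewrite /series /=; lra.
have ca : cvgn (series (fun m => `|C m * (J m z * J m w)|)).
  apply: nondecreasing_is_cvgn; first by apply: nondecreasing_series => *.
  by exists K => _ [n _ <-].
have cb : cvgn (series (fun m => C m * (J m z * J m w))) by exact: normed_cvg.
split=> //.
have h : `|series (fun m => C m * (J m z * J m w)) n| @[n --> \oo] -->
   `|limn (series (fun m => C m * (J m z * J m w)))| by apply: cvg_norm.
apply: (cvgr_to_le h); apply: nearW => n.
exact: le_trans (ler_norm_sum _ _ _) (bnd n).
Qed.

Lemma J_at0 m : (0 < m)%N -> J m 0 = 0 :> R.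
Proof.
move=> m0; apply: cvg_lim => //.
rewrite (_ : series _ = (fun=> 0)); first exact: cvg_cst.
apply/funext => n; rewrite /series /= big1// => i _.
by rewrite /bes expr0n (_ : (_ == 0)%N = false) ?mulr0 ?mul0r//; apply/eqP; lia.
Qed.

(** The part of [pair_phase] with the difference of the two angles. *)
Definition diff_phase th al ph be m : R :=
  \sum_(0 <= p < m) cos (- (th - ph) * p%:R + (al - be - (th - ph) + m%:R * ((th - ph) / 2))).

(** The part of [pair_phase] with the sum of the two angles; the two quarter-turns per step
add up to m pi. *)
Definition sum_phase th al ph be m : R :=
  \sum_(0 <= p < m) cos (- (th + ph) * p%:R +
     (al + be - (th + ph) + m%:R * ((th + ph) / 2) + m%:R * pi)).

Lemma pair_phase_split th al ph be m : pair_phase th al ph be m =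
  2^-1 * (diff_phase th al ph be m + sum_phase th al ph be m).
Proof.
rewrite /pair_phase /diff_phase /sum_phase -big_split big_distrr; apply: eq_bigr => p _ /=.
set A := th * _ + _ + _ + _; set B := ph * _ + _ - _ + _.
rewrite (_ : - (th - ph) * _ + _ = A - B); last by rewrite /A /B; field.
rewrite (_ : - (th + ph) * _ + _ = A + B); last by rewrite /A /B; field.
by rewrite (cosB A B) (cosD A B); field.
Qed.

(** A geometric sum of a ratio other than 1 is bounded independently of its length. *)
Lemma diff_phase_bound th al ph be m : sin ((th - ph) / 2) != 0 ->
  `|diff_phase th al ph be m| <= `|sin ((th - ph) / 2)|^-1.
Proof.
move=> s0; have E : - (th - ph) / 2 = - ((th - ph) / 2) by rewrite mulNr.
have h := @sum_cos_bound R (- (th - ph)) (al - be - (th - ph) + m%:R * ((th - ph) / 2)) m.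
by move: h; rewrite E sinN oppr_eq0 normrN; apply.
Qed.

Lemma sum_phase_bound th al ph be m : sin ((th + ph) / 2) != 0 ->
  `|sum_phase th al ph be m| <= `|sin ((th + ph) / 2)|^-1.
Proof.
move=> s0; have E : - (th + ph) / 2 = - ((th + ph) / 2) by rewrite mulNr.
have h := @sum_cos_bound R (- (th + ph))
  (al + be - (th + ph) + m%:R * ((th + ph) / 2) + m%:R * pi) m.
by move: h; rewrite E sinN oppr_eq0 normrN; apply.
Qed.

(** Equal angles: all terms coincide. *)
Lemma diff_phase_eq th al be m : diff_phase th al th be m = m%:R * cos (al - be).
Proof.
rewrite /diff_phase subrr (eq_bigr (fun=> cos (al - be))); last first.
  by move=> p _; congr cos; field.
by rewrite sumr_const_nat subn0 mulr_natl.
Qed.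

(** Opposite angles modulo 2 pi: all terms coincide, the half-turns combining with m (th +
ph) / 2 = m pi into full turns. *)
Lemma sum_phase_eq th al ph be m : th + ph = 2 * pi ->
  sum_phase th al ph be m = m%:R * cos (al + be).
Proof.
move=> E; rewrite /sum_phase E.
rewrite (eq_bigr (fun=> cos (al + be))); last first.
  move=> p _; rewrite -(cosD_int (al + be) (m%:Z - p%:Z - 1)); congr cos.
  by rewrite !rmorphB /=; field.
by rewrite sumr_const_nat subn0 mulr_natl.
Qed.

End bessel_sums.

(** * Residue counts as averages of waves *)

Section residue_waves.
Context {R : realType} (e : nat) (he : (2 <= e)%N).

Definition angle (a : nat) : R := a%:R * (2 * pi / e%:R).

Let e0 : e%:R != 0 :> R. Proof. by rewrite pnatr_eq0; lia. Qed.
Let e0' : (0 < e)%N. Proof. by lia. Qed.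

Lemma int_Zp_eq0 (x : int) : (x%:~R == 0 :> 'Z_e) = (e%:Z %| x)%Z.
Proof.
have H (n : nat) : (n%:R == 0 :> 'Z_e) = (e %| n)%N.
  by rewrite -val_eqE /= val_Zp_nat//.
case: x => n; first by rewrite [LHS]H.
by rewrite NegzE rmorphN oppr_eq0 [LHS]H [RHS]dvdzE abszN.
Qed.

(** Finite Fourier expansion of the indicator of a residue class. *)
Lemma indicator_waves (i : 'Z_e) (x : int) :
  (x%:~R == i)%:R = \sum_(a <- iota 0 e) e%:R^-1 * wave (angle a) (- (angle a * i%:R)) x :> R.
Proof.
rewrite -big_distrr /=.
have -> : (x%:~R == i) = (e%:Z %| x - (i : nat)%:Z)%Z.
  by rewrite -int_Zp_eq0 intrB -[(i : nat)%:~R]/((i : nat)%:R) natr_Zp subr_eq0.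
have := @sum_cos_roots R e (x - (i : nat)%:Z) e0'; rewrite /index_iota subn0.
have -> : \sum_(a <- iota 0 e) wave (angle a) (- (angle a * i%:R)) x =
    \sum_(a <- iota 0 e) cos ((x - (i : nat)%:Z)%:~R * (2 * pi / e%:R) * a%:R) :> R.
  by apply: eq_bigr => a _; rewrite /wave /angle intrB -!pmulrn; congr cos; ring.
move=> ->; case: ifP => _; first by rewrite mulVf.
by rewrite mulr0.
Qed.

Lemma res_diff_waves (i : 'Z_e) la : res_diff i la =
  \sum_(a <- iota 0 e) e%:R^-1 * linstat (wave (angle a) (- (angle a * i%:R))) la :> R.
Proof.
rewrite res_diff_linstat -linstat_sum; congr linstat.
by apply/funext => x; exact: indicator_waves.
Qed.

Lemma res_diff_mean t (i : 'Z_e) : 0 < t ->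
  (res_diff i : intpart -> R) \in Lfun (plancherel t) 1 /\
  ('E_(plancherel t)[(res_diff i : intpart -> R)] = (\sum_(a <- iota 0 e)
     e%:R^-1 * wave_mean t (angle a) (- (angle a * i%:R)))%R%:E)%E.
Proof.
move=> t0; have -> : (res_diff i : intpart -> R) = (fun la => \sum_(a <- iota 0 e)
    e%:R^-1 * linstat (wave (angle a) (- (angle a * i%:R))) la).
  by apply/funext => la; exact: res_diff_waves.
by apply: expectation_lin_comb => a; have [] := wave_first_moment (angle a) (- (angle a * i%:R)) t0.
Qed.

(** J_0 is bounded, so the mean of a wave stays bounded in t. *)
Lemma wave_mean_bound t th al : `|wave_mean t th al| <= 2 * `|amp th|^-1 :> R.
Proof.
rewrite /wave_mean normrM mulrC; apply: ler_pM => //.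
  by apply: le_trans (ler_normB _ _) _; rewrite normr1 -[2]/(1 + 1) lerD// J0_le1.
by rewrite normrM normfV ler_piMl// sin_max.
Qed.

Lemma res_diff_mean_bounded (i : 'Z_e) : exists M : R, \forall t \near +oo,
  (`|'E_(plancherel t)[(res_diff i : intpart -> R)]| <= M%:E)%E.
Proof.
exists (\sum_(a <- iota 0 e) e%:R^-1 * (2 * `|amp (angle a)|^-1)).
near=> t; have t0 : 0 < t by near: t; exact: nbhs_pinfty_gt.
have [_ ->] := res_diff_mean i t0.
rewrite lee_fin; apply: le_trans (ler_norm_sum _ _ _) _.
apply: ler_sum => a _; rewrite normrM ger0_norm ?invr_ge0// ler_wpM2l ?invr_ge0//.
exact: wave_mean_bound.
Unshelve. all: by end_near. Qed.

(** The covariance of the waves number [a] of the statistic i and number [b] of the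
statistic j, before normalisation by e^-2. *)
Definition pair_cov t (i j : 'Z_e) a b : R :=
  pair_sum t (angle a) (- (angle a * i%:R)) (angle b) (- (angle b * j%:R)).

Lemma res_diff_covariance t (i j : 'Z_e) : 0 < t ->
  covariance (plancherel t) (res_diff i) (res_diff j) =
  (e%:R^-1 ^+ 2 * \sum_(0 <= a < e) \sum_(0 <= b < e) pair_cov t i j a b)%:E.
Proof.
move=> t0; have [L1 E1] := res_diff_mean i t0; have [L2 E2] := res_diff_mean j t0.
pose F (p : nat * nat) la := linstat (wave (angle p.1) (- (angle p.1 * i%:R))) la *
  linstat (wave (angle p.2) (- (angle p.2 * j%:R))) la.
(* Products of averages of waves are averages over pairs of waves. *)
pose s := [seq (a, b) | a <- iota 0 e, b <- iota 0 e].
have XYE : ((res_diff i : intpart -> R) * (res_diff j : intpart -> R)) =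
    (fun la => \sum_(p <- s) e%:R^-1 ^+ 2 * F p la).
  apply/funext => la; rewrite -[LHS]/(res_diff i la * res_diff j la) !res_diff_waves.
  rewrite /s big_allpairs big_distrlr /=.
  by apply: eq_bigr => a _; apply: eq_bigr => b _; rewrite /F /=; ring.
have [L3 E3] := expectation_lin_comb s (fun=> e%:R^-1 ^+ 2)
  (fun p => (wave_second_moment (angle p.1) (- (angle p.1 * i%:R)) (angle p.2)
      (- (angle p.2 * j%:R)) t0).1)
  (fun p => (wave_second_moment (angle p.1) (- (angle p.1 * i%:R)) (angle p.2)
      (- (angle p.2 * j%:R)) t0).2).
rewrite covarianceE//; last by rewrite XYE.
rewrite XYE [X in (X - _)%E]E3 E1 E2 -EFinM -EFinB; congr (_%:E).
rewrite /s big_allpairs big_distrlr /= -sumrB big_distrr /index_iota subn0.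
apply: eq_bigr => a _; rewrite -sumrB big_distrr; apply: eq_bigr => b _ /=.
by rewrite /pair_cov; ring.
Qed.

End residue_waves.

(** * Asymptotics *)

Section asymptotics.
Context {R : realType}.
Implicit Types (t z w th al ph be K c : R).

(** Subtracting the linear part of the coefficients leaves bounded ones. A linear part can
only be compared with [J_sum] when both waves have the same Bessel argument. *)
Lemma pair_sum_approx t th al ph be c K : c = 0 \/ freq t ph = freq t th ->
  (forall m, `|pair_phase th al ph be m - c * m%:R| <= K) ->
  `|pair_sum t th al ph be - c * J_sum (freq t th)| <= K.
Proof.
move=> czw hK; set z := freq t th; set w := freq t ph.
have [cC CK] := bounded_J_sum z w hK.
have cJ : series (fun m => c * m%:R * (J m z * J m w)) @ \oo --> c * J_sum z.
  rewrite (_ : series _ = (fun n => c * series (fun r => r%:R * J r z ^+ 2) n)).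
    by apply: cvgMl_tmp; exact: cvg_J_sum.
  apply/funext => n; rewrite /series /= big_distrr; apply: eq_bigr => m _ /=.
  by case: czw => [->|]; [rewrite !mul0r|rewrite /w => ->; rewrite -/z; ring].
suff -> : pair_sum t th al ph be =
    limn (series (fun m => (pair_phase th al ph be m - c * m%:R) * (J m z * J m w))) + c * J_sum z.
  by rewrite addrK.
apply: cvg_lim => //.
rewrite (_ : series _ = series (fun m => (pair_phase th al ph be m - c * m%:R) * (J m z * J m w)) \+
  series (fun m => c * m%:R * (J m z * J m w))); first exact: cvgD.
apply/funext => n; rewrite /series /= -big_split; apply: eq_bigr => m _ /=.
by rewrite mulrBl subrK.
Qed.

(** A wave of zero amplitude has a deterministic linear statistic. *)
Lemma pair_sum_at0 t th al ph be : freq t th = 0 \/ freq t ph = 0 ->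
  pair_sum t th al ph be = 0.
Proof.
move=> z0; apply: cvg_lim => //.
rewrite (_ : series _ = (fun=> 0)); first exact: cvg_cst.
apply/funext => n; rewrite /series /= big1// => -[|m] _.
  by rewrite /pair_phase big_geq// mul0r.
by case: z0 => ->; rewrite J_at0// ?mul0r !mulr0.
Qed.

Lemma sqrt_cvg_pinfty : Num.sqrt t @[t --> +oo] --> (+oo : set_system R).
Proof.
apply/cvgryPge => M; near=> t.
have tM : M ^+ 2 <= t by near: t; by apply: nbhs_pinfty_ge; exact: num_real.
have MM : M <= Num.sqrt (M ^+ 2) by rewrite sqrtr_sqr ler_norm.
by apply: (le_trans MM); apply: ler_wsqrtr.
Unshelve. all: by end_near. Qed.

Lemma J_sum_freq (A : R) : 0 < A ->
  J_sum (Num.sqrt t * A) / Num.sqrt t @[t --> +oo] --> 2 / pi * A.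
Proof.
move=> A0.
have h : J_sum (Num.sqrt t * A) / (Num.sqrt t * A) @[t --> +oo] --> 2 / (pi : R).
  apply: (cvg_comp (fun t => Num.sqrt t * A) (fun z => J_sum z / z)) J_sum_asymp.
  by apply: gt0_cvgMly => //; exact: sqrt_cvg_pinfty.
have hA : J_sum (Num.sqrt t * A) / (Num.sqrt t * A) * A @[t --> +oo] --> 2 / (pi : R) * A.
  exact: cvgMr_tmp.
apply: cvg_trans hA; apply: near_eq_cvg; near=> t.
have t0 : 0 < t by near: t; exact: nbhs_pinfty_gt.
by field; rewrite !gt_eqF ?sqrtr_gt0.
Unshelve. all: by end_near. Qed.

Lemma cvg_bounded_perturb (f g : R -> R) c K (l : R) :
  (forall t, 0 < t -> `|f t - c * g t| <= K) ->
  g t / Num.sqrt t @[t --> +oo] --> l ->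
  f t / Num.sqrt t @[t --> +oo] --> c * l.
Proof.
move=> fg gl.
have inv0 : (Num.sqrt t)^-1 @[t --> +oo] --> (0 : R).
  by apply: (cvg_comp (fun t => Num.sqrt t) (fun z => z^-1)) cvg_inv_pinfty; exact: sqrt_cvg_pinfty.
have K0 : K * (Num.sqrt t)^-1 @[t --> +oo] --> (0 : R).
  by rewrite -(mulr0 K); exact: cvgMl_tmp.
have h0 : (f t - c * g t) / Num.sqrt t @[t --> +oo] --> (0 : R).
  apply/norm_cvg0P; apply: (squeeze_cvgr _ (cvg_cst 0) K0); near=> t.
  have t0 : 0 < t by near: t; exact: nbhs_pinfty_gt.
  have s0 : 0 <= (Num.sqrt t)^-1 by rewrite invr_ge0 sqrtr_ge0.
  by rewrite normr_ge0 normrM [X in _ * X](ger0_norm s0) ler_wpM2r//= fg.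
rewrite -[c * l]add0r (_ : (fun t => _) = (fun t =>
    (f t - c * g t) / Num.sqrt t + c * (g t / Num.sqrt t))).
  by apply: cvgD h0 _; exact: cvgMl_tmp.
by apply/funext => t; ring.
Unshelve. all: by end_near. Qed.

Lemma asymp_equiv_sqrt (f : R -> \bar R) (c g : R -> R) (k : R) : k != 0 ->
  (forall t, 0 < t -> f t = (c t)%:E) -> (forall t, g t = k * Num.sqrt t) ->
  c t / Num.sqrt t @[t --> +oo] --> k -> asymp_equiv f g.
Proof.
move=> k0 fc gk ck; rewrite /asymp_equiv.
have h1 : c t / Num.sqrt t * k^-1 @[t --> +oo] --> k * k^-1 by exact: cvgMr_tmp.
rewrite mulfV// in h1.
have h : (c t / Num.sqrt t * k^-1)%:E @[t --> +oo] --> (1%:E : \bar R).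
  by apply: cvg_EFin; first exact: nearW.
apply: cvg_trans h; apply: near_eq_cvg; near=> t.
have t0 : 0 < t by near: t; exact: nbhs_pinfty_gt.
by rewrite fc// gk -EFinM invfM -mulrA [k^-1 * _]mulrC.
Unshelve. all: by end_near. Qed.

(** The subtraction formula for the sine, divided by the product of the sines. *)
Lemma cot_sub x y : sin x != 0 -> sin y != 0 ->
  cot x - cot y = sin (y - x) / (sin x * sin y) :> R.
Proof. by move=> x0 y0; rewrite /cot sinB; field; rewrite x0 y0. Qed.

Lemma sum_indicator n k : (k < n)%N -> \sum_(0 <= b < n) (b == k)%:R = 1 :> R.
Proof.
move=> kn; rewrite (bigD1_seq k) ?mem_index_iota ?iota_uniq//= eqxx big1 ?addr0//.
by move=> b /negPf ->.
Qed.

End asymptotics.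

Section pair_asymptotics.
Context {R : realType} (e : nat) (he : (2 <= e)%N).
Local Notation angle := (@angle R e).

Let e0 : e%:R != 0 :> R. Proof. by rewrite pnatr_eq0; lia. Qed.
Let e0' : (0 < e)%N. Proof. by lia. Qed.

Lemma amp_angle a : amp (angle a) = 2 * sin (a%:R * (pi / e%:R)).
Proof. by rewrite /amp /angle; congr (2 * sin _); field. Qed.

Lemma amp_angle0 : amp (angle 0) = 0.
Proof. by rewrite amp_angle mul0r sin0 mulr0. Qed.

(** The waves number a and e - a are complex conjugate characters. *)
Lemma amp_angle_refl a b : (a + b = e)%N -> amp (angle b) = amp (angle a).
Proof.
move=> abe; rewrite !amp_angle; congr (2 * _).
have -> : b%:R = e%:R - a%:R :> R by rewrite -abe natrD addrAC subrr add0r.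
rewrite (_ : _ * _ = - (a%:R * (pi / e%:R)) + pi) ?sinDpi ?sinN ?opprK//.
by field.
Qed.

(** The linear part is present when the two angles are equal (difference part) or opposite
(sum part). In these cases the corresponding sine in the bound is 0, and so is its
inverse; the linear part is then exact. *)
Lemma pair_phase_angle a b m (i j : 'Z_e) : (0 < a < e)%N -> (0 < b < e)%N ->
  `|pair_phase (angle a) (- (angle a * i%:R)) (angle b) (- (angle b * j%:R)) m -
    2^-1 * ((b == a)%:R + (b == e - a)%N%:R) * cos (angle a * (j%:R - i%:R)) * m%:R| <=
  2^-1 * (`|sin ((angle a - angle b) / 2)|^-1 + `|sin ((angle a + angle b) / 2)|^-1).
Proof.
move=> /andP[a0 ae] /andP[b0 be]; set X := cos _.
set pa := - (angle a * _); set pb := - (angle b * _).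
rewrite pair_phase_split (_ : _ - _ = 2^-1 *
  ((diff_phase (angle a) pa (angle b) pb m - (b == a)%:R * (X * m%:R)) +
   (sum_phase (angle a) pa (angle b) pb m - (b == e - a)%N%:R * (X * m%:R)))); last by ring.
rewrite normrM ger0_norm ?invr_ge0// ler_wpM2l ?invr_ge0//.
apply: le_trans (ler_normD _ _) _; apply: lerD.
  case: eqVneq => [bE|ba].
    rewrite /pa /pb bE diff_phase_eq mul1r (_ : - _ - - _ = angle a * (j%:R - i%:R)); last by ring.
    by rewrite [m%:R * _]mulrC subrr normr0 invr_ge0.
  rewrite mul0r subr0; apply: diff_phase_bound.
  rewrite (_ : _ / 2 = (a%:Z - b%:Z)%:~R * (pi / e%:R)); last first.
    by rewrite /angle intrB -!pmulrn; field.
  apply: sin_pi_int_neq0 => //; apply/negP => /dvdzP[q Eq].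
  have : q = 0 \/ q <= -1 \/ 1 <= q by lia.
  by case=> [q0|[q0|q0]]; nia.
case: eqVneq => [bE|ba].
  rewrite sum_phase_eq; last first.
    by rewrite bE /angle natrB ?(ltnW ae)//; field.
  rewrite (_ : cos _ = X) ?[m%:R * _]mulrC ?mul1r ?subrr ?normr0 ?invr_ge0//.
  rewrite /X -(cosD_int (angle a * (j%:R - i%:R)) (- (j : nat)%:Z)); congr cos.
  by rewrite /pa /pb bE /angle natrB ?(ltnW ae)// mulrNz -!pmulrn; field.
rewrite mul0r subr0; apply: sum_phase_bound.
rewrite (_ : _ / 2 = (a%:Z + b%:Z)%:~R * (pi / e%:R)); last first.
  by rewrite /angle intrD -!pmulrn; field.
apply: sin_pi_int_neq0 => //; apply/negP => /dvdzP[q Eq].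
have : q <= 0 \/ q = 1 \/ 2 <= q by lia.
by case=> [q0|[q0|q0]]; nia.
Qed.

Lemma pair_cov_asymp (i j : 'Z_e) a b : (a < e)%N -> (b < e)%N ->
  pair_cov t i j a b / Num.sqrt t @[t --> +oo] -->
  2^-1 * ((b == a)%:R + (b == e - a)%N%:R) * cos (angle a * (j%:R - i%:R)) *
    (2 / pi * amp (angle a)).
Proof.
move=> ae be; have [ab|ab] := boolP ((a == 0) || (b == 0))%N.
  rewrite [X in _ --> X](_ : _ = 0); last first.
    case: (posnP a) ab => [-> _|a0 /= /eqP ->]; first by rewrite amp_angle0 !mulr0.
    have [-> ->] : (0 == a)%N = false /\ (0 == e - a)%N = false by lia.
    by rewrite addr0 mulr0 !mul0r.
  rewrite (_ : (fun t => _) = fun=> 0); first exact: cvg_cst.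
  apply/funext => t; rewrite /pair_cov pair_sum_at0 ?mul0r// /freq.
  by case/orP: ab => /eqP ->; [left|right]; rewrite amp_angle0 mulr0.
have {ab} [a0 b0] : (0 < a < e)%N /\ (0 < b < e)%N by lia.
have A0 : 0 < amp (angle a) by rewrite amp_angle mulr_gt0// sin_pi_ratio_gt0.
apply: cvg_bounded_perturb (J_sum_freq A0) => t t0.
apply: (@pair_sum_approx); last first.
  by move=> m; exact: pair_phase_angle.
have [->|ba] := eqVneq b a; first by right.
have [bE|ba'] := eqVneq b (e - a)%N; last by left; rewrite addr0 mulr0 mul0r.
by right; rewrite /freq (@amp_angle_refl a b)//; lia.
Qed.

(** In each row a > 0 of the double sum exactly two entries have a linear part, b = a and b
= e - a, each with coefficient 1/2 (they coincide when e = 2a, and then both parts of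
the phase are linear). *)
Lemma sum_cov_asymp (i j : 'Z_e) :
  (\sum_(0 <= a < e) \sum_(0 <= b < e) pair_cov t i j a b) / Num.sqrt t @[t --> +oo] -->
  2 / pi * \sum_(0 <= a < e) cos (angle a * (j%:R - i%:R)) * amp (angle a).
Proof.
rewrite (_ : (fun t => _) = fun t =>
    \sum_(0 <= a < e) \sum_(0 <= b < e) (pair_cov t i j a b / Num.sqrt t)); last first.
  by apply/funext => t; rewrite big_distrl; apply: eq_bigr => a _; rewrite big_distrl.
rewrite big_distrr /=.
have h a : (a < e)%N -> \sum_(0 <= b < e) (pair_cov t i j a b / Num.sqrt t) @[t --> +oo] -->
    2 / pi * (cos (angle a * (j%:R - i%:R)) * amp (angle a)).
  move=> ae.
  rewrite [X in _ --> X](_ : _ = \sum_(0 <= b < e) 2^-1 * ((b == a)%:R + (b == e - a)%N%:R) *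
      cos (angle a * (j%:R - i%:R)) * (2 / pi * amp (angle a))); last first.
    rewrite -!big_distrl -big_distrr big_split /= sum_indicator//.
    case: (posnP a) => [->|a0]; first by rewrite amp_angle0 !mulr0.
    rewrite sum_indicator; last lia.
    by rewrite (_ : 2^-1 * (1 + 1) = 1) ?mul1r 1?mulrCA//; field.
  by apply: cvg_sum_nat => b be; exact: pair_cov_asymp.
exact: cvg_sum_nat.
Qed.

Lemma sin_half_odd_neq0 (d : int) : sin ((2 * d%:~R + 1) * (pi / (2 * e%:R))) != 0 :> R.
Proof.
have -> : (2 * d%:~R + 1) * (pi / (2 * e%:R)) = (2 * d + 1)%:~R * (pi / (2 * e)%N%:R) :> R.
  by rewrite natrM intrD intrM.
apply: sin_pi_int_neq0; first by lia.
apply/negP => /dvdzP[q]; rewrite PoszM; nia.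
Qed.

(** Product-to-sum, then [sum_sin_odd] for the two sums of sines. *)
Lemma sum_cos_amp (d : int) :
  \sum_(0 <= a < e) cos (angle a * d%:~R) * amp (angle a) =
  cot ((2 * d%:~R + 1) * (pi / (2 * e%:R))) - cot ((2 * (d - 1)%:~R + 1) * (pi / (2 * e%:R))).
Proof.
rewrite -!sum_sin_odd ?sin_half_odd_neq0// -sumrB; apply: eq_bigr => a _.
rewrite amp_angle; set x := angle a * d%:~R; set y := a%:R * (pi / e%:R).
rewrite (_ : _ * a%:R = x + y); last by rewrite /x /y /angle; field.
rewrite (_ : _ * a%:R = x - y); last by rewrite /x /y /angle intrB; field.
by rewrite sinB sinD; ring.
Qed.

(** By [cot_sub] the numerator is - sin (pi / e). Dividing by the claimed equivalent is thus
legitimate. *)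
Lemma cot_diff_neq0 (d : int) :
  cot ((2 * d%:~R + 1) * (pi / (2 * e%:R))) - cot ((2 * (d - 1)%:~R + 1) * (pi / (2 * e%:R))) != 0 :> R.
Proof.
rewrite cot_sub ?sin_half_odd_neq0// mulf_neq0 ?invr_neq0 ?mulf_neq0 ?sin_half_odd_neq0//.
rewrite (_ : _ - _ = - (1%:R * (pi / e%:R))); last by rewrite intrB; field.
by rewrite sinN oppr_eq0 gt_eqF// sin_pi_ratio_gt0.
Qed.

(** The claim is stated for a function [g] given by its values so that the same result
applies to the variance, where the cotangents are combined. *)
Lemma covariance_asymp (i j : 'Z_e) (g : R -> R) :
  (forall t, g t = 2 * Num.sqrt t / (pi * e%:R ^+ 2) *
     (cot ((j%:R - i%:R + 2^-1) * (pi / e%:R)) -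
      cot ((j%:R - i%:R - 2^-1) * (pi / e%:R)))) ->
  asymp_equiv (fun t : R => covariance (plancherel t) (res_diff i) (res_diff j)) g.
Proof.
move=> gE; pose d : int := (j : nat)%:Z - (i : nat)%:Z.
have dE : j%:R - i%:R = d%:~R :> R by rewrite /d intrB -!pmulrn.
move: d dE => d dE.
set D := cot _ - cot _ in gE.
have DE : D = cot ((2 * d%:~R + 1) * (pi / (2 * e%:R))) -
    cot ((2 * (d - 1)%:~R + 1) * (pi / (2 * e%:R))).
  by rewrite /D dE intrB; congr (cot _ - cot _); field.
have pi0 : pi != 0 :> R by rewrite gt_eqF// pi_gt0.
apply: (@asymp_equiv_sqrt R _ _ g (e%:R^-1 ^+ 2 * (2 / pi * D)) _
  (fun t t0 => res_diff_covariance he i j t0)).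
- by rewrite !mulf_neq0 ?invr_neq0// DE cot_diff_neq0.
- by move=> t; rewrite gE invfM exprVn; ring.
rewrite DE -sum_cos_amp -dE; under eq_fun do rewrite -mulrA.
by apply: cvgMl_tmp; exact: sum_cov_asymp.
Qed.

End pair_asymptotics.

Theorem theorem1 (R : realType) (e : nat) (he : (2 <= e)%N) (i j : 'Z_e) :
  [/\ exists M : R, \forall t \near +oo,
        (`|'E_(plancherel t)[res_diff i : intpart -> R]| <= M%:E)%E,
      asymp_equiv
        (fun t : R => covariance (plancherel t) (res_diff i) (res_diff j))
        (fun t => 2 * Num.sqrt t / (pi * e%:R ^+ 2) *
           (cot ((j%:R - i%:R + 2^-1) * (pi / e%:R)) -
            cot ((j%:R - i%:R - 2^-1) * (pi / e%:R))))
    & asymp_equiv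
        (fun t : R => 'V_(plancherel t)[res_diff i : intpart -> R])
        (fun t => 4 * Num.sqrt t / (pi * e%:R ^+ 2) * cot (pi / (2 * e%:R)))].
Proof.
split; [exact: res_diff_mean_bounded|exact: covariance_asymp|].
apply: (covariance_asymp he) => t.
have e0 : e%:R != 0 :> R by rewrite pnatr_eq0; lia.
rewrite subrr add0r sub0r (_ : 2^-1 * _ = pi / (2 * e%:R)); last by field.
rewrite (_ : - 2^-1 * _ = - (pi / (2 * e%:R))); last by field.
by rewrite [cot (- _)]/cot cosN sinN invrN mulrN opprK -/(cot _) -mulr2n -mulr_natr; ring.
Qed.
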